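(* Let $\mathbb{F}$ be an algebraically closed field, $\Gamma$ an arbitrary digraph and $J$ a two-sided ideal of the Leavitt path algebra $L_{\mathbb{F}}(\Gamma)$. The following are equivalent: (a) $L_{\mathbb{F}}(\Gamma)/J$ is isomorphic to a Leavitt path algebra (over $\mathbb{F}$); (b) $L_{\mathbb{F}}(\Gamma)/J$ is reduced, that is, its nilradical is zero; (c) $L_{\mathbb{F}}(\Gamma)/J$ is semiprimitive, that is, its Jacobson radical is zero.
   Context: A digraph $\Gamma=(V,E,s,t)$ consists of arbitrary (possibly infinite) sets $V$ of vertices and $E$ of arrows and functions $s,t:E\to V$ (source, target). The Leavitt path algebra $L_{\mathbb{F}}(\Gamma)$ is the (not necessarily unital) $\mathbb{F}$-algebra generated by $V\sqcup E\sqcup\{e^*: e\in E\}$ subject to: $uv=\delta_{u,v}u$ for $u,v\in V$; $s(e)e=e=e\,t(e)$ and $t(e)e^*=e^*=e^*s(e)$ for $e\in E$; (CK1) $e^*f=\delta_{e,f}t(e)$ for $e,f\in E$; (CK2) $v=\sum_{s(e)=v}ee^*$ for every $v\in V$ with $0<|s^{-1}(v)|<\infty$. The nilradical of a ring is the largest (two-sided) nil ideal, i.e. the sum of all ideals consisting of nilpotent elements. ''Reduced'' here means only that this nilradical is zero (not that there are no nonzero nilpotent elements). *)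

(* Defs.v *)
From HB Require Import structures.
From mathcomp Require Import all_boot all_algebra.
From mathcomp Require Import boolp classical_sets.
From Stdlib Require List.

Set Implicit Arguments.
Unset Strict Implicit.
Unset Printing Implicit Defensive.

Import GRing.Theory.
Local Open Scope classical_set_scope.
Local Open Scope ring_scope.
Local Open Scope quotient_scope.

Reserved Notation "x ** y" (at level 40, left associativity).

(* Associative rings and algebras, not assumed to have a unit (MathComp's own
   ring structures are all unital). *)

HB.mixin Record Zmodule_isNuRing R & GRing.Zmodule R := {
  numul : R -> R -> R;
  numulA : associative numul;
  numulDl : left_distributive numul +%R;
  numulDr : right_distributive numul +%R
}.

#[short(type="nuRingType")]
HB.structure Definition NuRing := {R of GRing.Zmodule R & Zmodule_isNuRing R}.

Notation "x ** y" := (numul x y) : ring_scope.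

HB.mixin Record NuRing_isNuAlgebra (F : fieldType) A
    & GRing.Lmodule F A & NuRing A := {
  scale_numull : forall (c : F) (x y : A), c *: (x ** y) = (c *: x) ** y;
  scale_numulr : forall (c : F) (x y : A), c *: (x ** y) = x ** (c *: y)
}.

#[short(type="nuAlgType")]
HB.structure Definition NuAlgebra (F : fieldType) :=
  {A of GRing.Lmodule F A & NuRing A & NuRing_isNuAlgebra F A}.

Definition nualg_isomorphic (F : fieldType) (A B : nuAlgType F) : Prop :=
  exists f : {linear A -> B},
    (forall x y, f (x ** y) = f x ** f y) /\ bijective f.

Record two_sided_ideal (R : nuRingType) (I : set R) : Prop := TwoSidedIdeal {
  ideal0 : I 0;
  idealB : forall x y, I x -> I y -> I (x - y);
  idealMl : forall a x, I x -> I (a ** x);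
  idealMr : forall a x, I x -> I (x ** a)
}.

(* [iter n (numul x) x] is x to the power n + 1. *)
Definition nu_nilpotent (R : nuRingType) (x : R) : Prop :=
  exists n : nat, iter n (numul x) x = 0.

Definition nil_ideal (R : nuRingType) (I : set R) : Prop :=
  two_sided_ideal I /\ forall x, I x -> nu_nilpotent x.

(* The sum of all nil ideals, as the set of finite sums of their elements. *)
Definition nilradical (R : nuRingType) : set R :=
  [set x | exists s : seq R, x = \sum_(y <- s) y /\
     forall y, y \in s -> exists2 I : set R, nil_ideal I & I y].

Arguments nilradical : clear implicits.

(* Weaker than the absence of nonzero nilpotent elements. *)
Definition reduced (R : nuRingType) : Prop := nilradical R = [set 0].

Record nuLeftModule (R : nuRingType) := NuLeftModule {
  numod_sort :> zmodType;
  nuact : R -> numod_sort -> numod_sort;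
  nuactA : forall a b m, nuact (a ** b) m = nuact a (nuact b m);
  nuactDl : forall a b m, nuact (a + b) m = nuact a m + nuact b m;
  nuactDr : forall a m n, nuact a (m + n) = nuact a m + nuact a n
}.

Record nu_submodule (R : nuRingType) (M : nuLeftModule R) (N : set M) : Prop :=
  NuSubmodule {
    submod0 : N 0;
    submodB : forall m n, N m -> N n -> N (m - n);
    submodM : forall a m, N m -> N (nuact a m)
  }.

(* In the absence of a unit, the condition RM <> 0 has to be required: it
   excludes the groups of prime order with trivial action. *)
Definition simple_module (R : nuRingType) (M : nuLeftModule R) : Prop :=
  (exists (a : R) (m : M), nuact a m <> 0) /\
  (forall N : set M, nu_submodule N -> N = [set 0] \/ N = setT).

Definition jacobson_radical (R : nuRingType) : set R :=
  [set a | forall M : nuLeftModule R, simple_module M ->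
             forall m : M, nuact a m = 0].

Arguments jacobson_radical : clear implicits.

Definition semiprimitive (R : nuRingType) : Prop :=
  jacobson_radical R = [set 0].

(* Ideals stable under scalars: those by which the quotient is an F-algebra. *)
Record alg_ideal (F : fieldType) (A : nuAlgType F) := AlgIdeal {
  alg_ideal_set :> set A;
  alg_idealP : two_sided_ideal alg_ideal_set;
  alg_idealZ : forall (c : F) x, alg_ideal_set x -> alg_ideal_set (c *: x)
}.

Section QuotientAlgebra.
Variables (F : fieldType) (A : nuAlgType F) (I : alg_ideal A).

Definition quot_rel (x y : A) : bool := `[< (I : set A) (x - y) >].

Lemma quot_rel_is_equiv : equiv_class_of quot_rel.
Proof.
have [I0 IB _ _] := alg_idealP I.
have IN x : (I : set A) x -> (I : set A) (- x).
  by move=> Ix; rewrite -sub0r; apply: IB.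
split=> [x|x y|y x z]; first by apply/asboolP; rewrite subrr.
- by apply/asboolP/asboolP => /IN; rewrite opprB.
- move=> /asboolP h1 /asboolP h2; apply/asboolP.
  by have := IB _ _ h1 (IN _ h2); rewrite opprK addrA subrK.
Qed.

Canonical quot_rel_equiv := EquivRelPack quot_rel_is_equiv.
Canonical quot_rel_encModRel := defaultEncModRel quot_rel.

Definition quot_alg := {eq_quot quot_rel}.

HB.instance Definition _ : EqQuotient A quot_rel quot_alg :=
  EqQuotient.on quot_alg.
HB.instance Definition _ := Choice.on quot_alg.

Lemma quot_eqP (x y : A) :
  (I : set A) (x - y) <-> \pi_quot_alg x = \pi_quot_alg y.
Proof.
split=> [h|/eqP]; first by apply/eqP; rewrite piE; apply/asboolP.
by rewrite piE => /asboolP.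
Qed.

Let reprE (x : A) : (I : set A) (repr (\pi_quot_alg x) - x).
Proof. by apply/quot_eqP; rewrite reprK. Qed.

Definition quot_zero : quot_alg := \pi_quot_alg 0.
Definition quot_opp (x : quot_alg) : quot_alg := \pi_quot_alg (- repr x).
Definition quot_add (x y : quot_alg) : quot_alg := \pi_quot_alg (repr x + repr y).
Definition quot_scale (c : F) (x : quot_alg) : quot_alg := \pi_quot_alg (c *: repr x).
Definition quot_mul (x y : quot_alg) : quot_alg := \pi_quot_alg (repr x ** repr y).

Let IP := alg_idealP I.
Let ID x y : (I : set A) x -> (I : set A) y -> (I : set A) (x + y).
Proof.
move=> Ix Iy; rewrite -[y]opprK; apply: (idealB IP) => //.
by rewrite -sub0r; apply: (idealB IP) => //; apply: ideal0 IP.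
Qed.

Let numulBl (x y z : A) : (x - y) ** z = x ** z - y ** z.
Proof. by apply: (addIr (y ** z)); rewrite -numulDl !subrK. Qed.
Let numulBr (x y z : A) : z ** (x - y) = z ** x - z ** y.
Proof. by apply: (addIr (z ** y)); rewrite -numulDr !subrK. Qed.

Lemma quot_piN (x : A) : quot_opp (\pi_quot_alg x) = \pi_quot_alg (- x).
Proof.
apply/quot_eqP; rewrite -opprD -sub0r.
by apply: (idealB IP (ideal0 IP)); apply: reprE.
Qed.

Lemma quot_piD (x y : A) : quot_add (\pi_quot_alg x) (\pi_quot_alg y) = \pi_quot_alg (x + y).
Proof. by apply/quot_eqP; rewrite opprD addrACA; apply: ID; apply: reprE. Qed.

Lemma quot_piZ (c : F) (x : A) : quot_scale c (\pi_quot_alg x) = \pi_quot_alg (c *: x).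
Proof.
by apply/quot_eqP; rewrite -scalerBr; apply: alg_idealZ; apply: reprE.
Qed.

Lemma quot_piM (x y : A) : quot_mul (\pi_quot_alg x) (\pi_quot_alg y) = \pi_quot_alg (x ** y).
Proof.
apply/quot_eqP; set x' := repr _; set y' := repr _.
rewrite -[_ - _](subrKA (x' ** y)) -numulBr -numulBl.
by apply: ID; [apply: idealMl IP _ _ _ | apply: idealMr IP _ _ _]; apply: reprE.
Qed.

Let quotW (P : quot_alg -> Prop) : (forall x : A, P (\pi_quot_alg x)) -> forall x, P x.
Proof. by move=> h x; rewrite -[x]reprK. Qed.

Lemma quot_addA : associative quot_add.
Proof. by do 3!elim/quotW=> ?; rewrite !quot_piD addrA. Qed.
Lemma quot_addC : commutative quot_add.
Proof. by do 2!elim/quotW=> ?; rewrite !quot_piD addrC. Qed.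
Lemma quot_add0 : left_id quot_zero quot_add.
Proof. by elim/quotW=> ?; rewrite !quot_piD add0r. Qed.
Lemma quot_addN : left_inverse quot_zero quot_opp quot_add.
Proof. by elim/quotW=> ?; rewrite quot_piN quot_piD addNr. Qed.

HB.instance Definition _ := GRing.isZmodule.Build quot_alg
  quot_addA quot_addC quot_add0 quot_addN.

Lemma quot_scaleA c d x : quot_scale c (quot_scale d x) = quot_scale (c * d) x.
Proof. by elim/quotW: x => ?; rewrite !quot_piZ scalerA. Qed.
Lemma quot_scale1 : left_id 1 quot_scale.
Proof. by elim/quotW=> ?; rewrite !quot_piZ scale1r. Qed.
Lemma quot_scaleDr : right_distributive quot_scale +%R.
Proof.
move=> c; do 2!elim/quotW=> ?.
by rewrite [in LHS]/GRing.add/= quot_piD !quot_piZ scalerDr -quot_piD.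
Qed.
Lemma quot_scaleDl x : {morph quot_scale^~ x : c d / c + d}.
Proof.
by move=> c d /=; elim/quotW: x => ?; rewrite !quot_piZ scalerDl -quot_piD.
Qed.

HB.instance Definition _ := GRing.Zmodule_isLmodule.Build F quot_alg
  quot_scaleA quot_scale1 quot_scaleDr quot_scaleDl.

Lemma quot_mulA : associative quot_mul.
Proof. by do 3!elim/quotW=> ?; rewrite !quot_piM numulA. Qed.
Lemma quot_mulDl : left_distributive quot_mul +%R.
Proof.
do 3!elim/quotW=> ?.
by rewrite [in LHS]/GRing.add/= quot_piD !quot_piM numulDl -quot_piD.
Qed.
Lemma quot_mulDr : right_distributive quot_mul +%R.
Proof.
do 3!elim/quotW=> ?.
by rewrite [in LHS]/GRing.add/= quot_piD !quot_piM numulDr -quot_piD.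
Qed.

HB.instance Definition _ := Zmodule_isNuRing.Build quot_alg
  quot_mulA quot_mulDl quot_mulDr.

Lemma quot_scale_mull (c : F) (x y : quot_alg) :
  c *: (x ** y) = (c *: x) ** y.
Proof.
elim/quotW: x => x; elim/quotW: y => y.
rewrite /GRing.scale/= /numul/=.
by rewrite !(quot_piM, quot_piZ) scale_numull.
Qed.
Lemma quot_scale_mulr (c : F) (x y : quot_alg) :
  c *: (x ** y) = x ** (c *: y).
Proof.
elim/quotW: x => x; elim/quotW: y => y.
rewrite /GRing.scale/= /numul/=.
by rewrite !(quot_piM, quot_piZ) scale_numulr.
Qed.

HB.instance Definition _ := NuRing_isNuAlgebra.Build F quot_alg
  quot_scale_mull quot_scale_mulr.

End QuotientAlgebra.

(* The non-unital algebra with generators in [X] subject to the relations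
   [rel]: formal expressions modulo the least congruence that contains [rel]
   and the axioms of F-algebras. *)

Inductive alg_term (F X : Type) : Type :=
| TGen of X
| TZero
| TOpp of alg_term F X
| TAdd of alg_term F X & alg_term F X
| TScale of F & alg_term F X
| TMul of alg_term F X & alg_term F X.

Arguments TGen {F X}.
Arguments TZero {F X}.

Inductive alg_cong (F : fieldType) (X : Type)
    (rel : alg_term F X -> alg_term F X -> Prop) :
    alg_term F X -> alg_term F X -> Prop :=
| cong_rel t u : rel t u -> alg_cong rel t u
| cong_refl t : alg_cong rel t t
| cong_sym t u : alg_cong rel t u -> alg_cong rel u t
| cong_trans t u w : alg_cong rel t u -> alg_cong rel u w -> alg_cong rel t w
| cong_opp t t' : alg_cong rel t t' -> alg_cong rel (TOpp t) (TOpp t')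
| cong_add t t' u u' : alg_cong rel t t' -> alg_cong rel u u' ->
    alg_cong rel (TAdd t u) (TAdd t' u')
| cong_scale c t t' :
    alg_cong rel t t' -> alg_cong rel (TScale c t) (TScale c t')
| cong_mul t t' u u' : alg_cong rel t t' -> alg_cong rel u u' ->
    alg_cong rel (TMul t u) (TMul t' u')
| cong_addA t u w : alg_cong rel (TAdd t (TAdd u w)) (TAdd (TAdd t u) w)
| cong_addC t u : alg_cong rel (TAdd t u) (TAdd u t)
| cong_add0 t : alg_cong rel (TAdd TZero t) t
| cong_addN t : alg_cong rel (TAdd (TOpp t) t) TZero
| cong_scaleA c d t : alg_cong rel (TScale c (TScale d t)) (TScale (c * d) t)
| cong_scale1 t : alg_cong rel (TScale 1 t) t
| cong_scaleDr c t u :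
    alg_cong rel (TScale c (TAdd t u)) (TAdd (TScale c t) (TScale c u))
| cong_scaleDl c d t :
    alg_cong rel (TScale (c + d) t) (TAdd (TScale c t) (TScale d t))
| cong_mulA t u w : alg_cong rel (TMul t (TMul u w)) (TMul (TMul t u) w)
| cong_mulDl t u w :
    alg_cong rel (TMul (TAdd t u) w) (TAdd (TMul t w) (TMul u w))
| cong_mulDr t u w :
    alg_cong rel (TMul t (TAdd u w)) (TAdd (TMul t u) (TMul t w))
| cong_scaleAl c t u :
    alg_cong rel (TScale c (TMul t u)) (TMul (TScale c t) u)
| cong_scaleAr c t u :
    alg_cong rel (TScale c (TMul t u)) (TMul t (TScale c u)).

HB.instance Definition _ (F X : Type) := gen_eqMixin (alg_term F X).
HB.instance Definition _ (F X : Type) := gen_choiceMixin (alg_term F X).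

Section PresentedAlgebra.
Variables (F : fieldType) (X : Type).
Variable rel : alg_term F X -> alg_term F X -> Prop.

Local Notation term := (alg_term F X).

Definition pres_rel (t u : term) : bool := `[< alg_cong rel t u >].

Lemma pres_rel_is_equiv : equiv_class_of pres_rel.
Proof.
split=> [t|t u|u t w]; first by apply/asboolP; apply: cong_refl.
- by apply/asboolP/asboolP; apply: cong_sym.
- by move=> /asboolP h1 /asboolP h2; apply/asboolP; apply: cong_trans h1 h2.
Qed.

Canonical pres_rel_equiv := EquivRelPack pres_rel_is_equiv.
Canonical pres_rel_encModRel := defaultEncModRel pres_rel.

Definition presented_alg := {eq_quot pres_rel}.

HB.instance Definition _ : EqQuotient term pres_rel presented_alg :=
  EqQuotient.on presented_alg.
HB.instance Definition _ := Choice.on presented_alg.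

Lemma pres_eqP (t u : term) :
  alg_cong rel t u <-> \pi_presented_alg t = \pi_presented_alg u.
Proof.
split=> [h|/eqP]; first by apply/eqP; rewrite piE; apply/asboolP.
by rewrite piE => /asboolP.
Qed.

Let reprE (t : term) : alg_cong rel (repr (\pi_presented_alg t)) t.
Proof. by apply/pres_eqP; rewrite reprK. Qed.

Definition pres_zero : presented_alg := \pi_presented_alg TZero.
Definition pres_opp (x : presented_alg) : presented_alg := \pi_presented_alg (TOpp (repr x)).
Definition pres_add (x y : presented_alg) : presented_alg :=
  \pi_presented_alg (TAdd (repr x) (repr y)).
Definition pres_scale (c : F) (x : presented_alg) : presented_alg :=
  \pi_presented_alg (TScale c (repr x)).
Definition pres_mul (x y : presented_alg) : presented_alg :=
  \pi_presented_alg (TMul (repr x) (repr y)).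

Lemma pres_piN (t : term) : pres_opp (\pi_presented_alg t) = \pi_presented_alg (TOpp t).
Proof. by apply/pres_eqP; apply: cong_opp; apply: reprE. Qed.
Lemma pres_piD (t u : term) : pres_add (\pi_presented_alg t) (\pi_presented_alg u) = \pi_presented_alg (TAdd t u).
Proof. by apply/pres_eqP; apply: cong_add; apply: reprE. Qed.
Lemma pres_piZ (c : F) (t : term) : pres_scale c (\pi_presented_alg t) = \pi_presented_alg (TScale c t).
Proof. by apply/pres_eqP; apply: cong_scale; apply: reprE. Qed.
Lemma pres_piM (t u : term) : pres_mul (\pi_presented_alg t) (\pi_presented_alg u) = \pi_presented_alg (TMul t u).
Proof. by apply/pres_eqP; apply: cong_mul; apply: reprE. Qed.

Let presW (P : presented_alg -> Prop) :
  (forall t : term, P (\pi_presented_alg t)) -> forall x, P x.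
Proof. by move=> h x; rewrite -[x]reprK. Qed.

Lemma pres_addA : associative pres_add.
Proof.
by do 3!elim/presW=> ?; rewrite !pres_piD; apply/pres_eqP; apply: cong_addA.
Qed.
Lemma pres_addC : commutative pres_add.
Proof.
by do 2!elim/presW=> ?; rewrite !pres_piD; apply/pres_eqP; apply: cong_addC.
Qed.
Lemma pres_add0 : left_id pres_zero pres_add.
Proof.
by elim/presW=> ?; rewrite !pres_piD; apply/pres_eqP; apply: cong_add0.
Qed.
Lemma pres_addN : left_inverse pres_zero pres_opp pres_add.
Proof.
elim/presW=> ?; rewrite pres_piN pres_piD; apply/pres_eqP.
exact: cong_addN.
Qed.

HB.instance Definition _ := GRing.isZmodule.Build presented_alg
  pres_addA pres_addC pres_add0 pres_addN.

Lemma pres_scaleA c d x : pres_scale c (pres_scale d x) = pres_scale (c * d) x.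
Proof.
elim/presW: x => ?; rewrite !pres_piZ; apply/pres_eqP.
exact: cong_scaleA.
Qed.
Lemma pres_scale1 : left_id 1 pres_scale.
Proof.
by elim/presW=> ?; rewrite !pres_piZ; apply/pres_eqP; apply: cong_scale1.
Qed.
Lemma pres_scaleDr : right_distributive pres_scale +%R.
Proof.
move=> c; do 2!elim/presW=> ?; rewrite /GRing.add/=.
by rewrite !(pres_piD, pres_piZ); apply/pres_eqP; apply: cong_scaleDr.
Qed.
Lemma pres_scaleDl x : {morph pres_scale^~ x : c d / c + d}.
Proof.
move=> c d /=; elim/presW: x => ?; rewrite [in RHS]/GRing.add/=.
by rewrite !(pres_piD, pres_piZ); apply/pres_eqP; apply: cong_scaleDl.
Qed.

HB.instance Definition _ := GRing.Zmodule_isLmodule.Build F presented_alg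
  pres_scaleA pres_scale1 pres_scaleDr pres_scaleDl.

Lemma pres_mulA : associative pres_mul.
Proof.
by do 3!elim/presW=> ?; rewrite !pres_piM; apply/pres_eqP; apply: cong_mulA.
Qed.
Lemma pres_mulDl : left_distributive pres_mul +%R.
Proof.
do 3!elim/presW=> ?; rewrite /GRing.add/=.
by rewrite !(pres_piD, pres_piM); apply/pres_eqP; apply: cong_mulDl.
Qed.
Lemma pres_mulDr : right_distributive pres_mul +%R.
Proof.
do 3!elim/presW=> ?; rewrite /GRing.add/=.
by rewrite !(pres_piD, pres_piM); apply/pres_eqP; apply: cong_mulDr.
Qed.

HB.instance Definition _ := Zmodule_isNuRing.Build presented_alg
  pres_mulA pres_mulDl pres_mulDr.

Lemma pres_scale_mull (c : F) (x y : presented_alg) :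
  c *: (x ** y) = (c *: x) ** y.
Proof.
elim/presW: x => x; elim/presW: y => y; rewrite /GRing.scale/= /numul/=.
by rewrite !(pres_piM, pres_piZ); apply/pres_eqP; apply: cong_scaleAl.
Qed.
Lemma pres_scale_mulr (c : F) (x y : presented_alg) :
  c *: (x ** y) = x ** (c *: y).
Proof.
elim/presW: x => x; elim/presW: y => y; rewrite /GRing.scale/= /numul/=.
by rewrite !(pres_piM, pres_piZ); apply/pres_eqP; apply: cong_scaleAr.
Qed.

HB.instance Definition _ := NuRing_isNuAlgebra.Build F presented_alg
  pres_scale_mull pres_scale_mulr.

End PresentedAlgebra.

Record digraph := Digraph {
  vertex : Type;
  arrow : Type;
  source : arrow -> vertex;
  target : arrow -> vertex
}.

Inductive lpa_gen (G : digraph) : Type :=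
| Vertex of vertex G
| Arrow of arrow G
| Ghost of arrow G.

Section LeavittPathAlgebra.
Variables (F : fieldType) (G : digraph).

Local Notation term := (alg_term F (lpa_gen G)).
Let V (v : vertex G) : term := TGen (Vertex v).
Let E (e : arrow G) : term := TGen (Arrow e).
Let E' (e : arrow G) : term := TGen (Ghost e).

(* In [rel_CK2], [es] enumerates the arrows with source v without repetition;
   such a nonempty list exists exactly when 0 < |s^-1(v)| < oo. *)
Inductive leavitt_rel : term -> term -> Prop :=
| rel_vv v : leavitt_rel (TMul (V v) (V v)) (V v)
| rel_vw v w : v <> w -> leavitt_rel (TMul (V v) (V w)) TZero
| rel_se e : leavitt_rel (TMul (V (source e)) (E e)) (E e)
| rel_et e : leavitt_rel (TMul (E e) (V (target e))) (E e)
| rel_te e : leavitt_rel (TMul (V (target e)) (E' e)) (E' e)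
| rel_es e : leavitt_rel (TMul (E' e) (V (source e))) (E' e)
| rel_CK1 e : leavitt_rel (TMul (E' e) (E e)) (V (target e))
| rel_CK1_neq e f : e <> f -> leavitt_rel (TMul (E' e) (E f)) TZero
| rel_CK2 v (es : list (arrow G)) :
    List.NoDup es -> es <> nil -> (forall e, List.In e es <-> source e = v) ->
    leavitt_rel (V v) (foldr (@TAdd _ _) TZero
                         [seq TMul (E e) (E' e) | e <- es]).

Definition lpa := presented_alg leavitt_rel.

HB.instance Definition _ := NuAlgebra.on lpa.
HB.instance Definition _ := EqQuotient.on lpa.

(* Local units: every element is fixed by multiplication on the left by the sum
   of any large enough finite set of vertices. *)

Let vsum (vs : list (vertex G)) : lpa :=
  foldr (fun v x => (\pi_lpa (V v) : lpa) + x) 0 vs.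

Let piM (t u : term) : (\pi_lpa (TMul t u) : lpa) = (\pi_lpa t : lpa) ** \pi_lpa u.
Proof. by symmetry; exact: pres_piM. Qed.
Let piD (t u : term) : (\pi_lpa (TAdd t u) : lpa) = (\pi_lpa t : lpa) + \pi_lpa u.
Proof. by symmetry; exact: pres_piD. Qed.
Let piN (t : term) : (\pi_lpa (TOpp t) : lpa) = - (\pi_lpa t : lpa).
Proof. by symmetry; exact: pres_piN. Qed.
Let piZ c (t : term) : (\pi_lpa (TScale c t) : lpa) = c *: (\pi_lpa t : lpa).
Proof. by symmetry; exact: pres_piZ. Qed.

Let num0 (x : lpa) : x ** 0 = 0.
Proof. by apply: (addrI (x ** 0)); rewrite -numulDr !addr0. Qed.
Let n0um (x : lpa) : 0 ** x = 0.
Proof. by apply: (addrI (0 ** x)); rewrite -numulDl !addr0. Qed.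

Let rel_pi (t u : term) : leavitt_rel t u -> (\pi_lpa t : lpa) = \pi_lpa u.
Proof. by move=> h; apply/pres_eqP; apply: cong_rel. Qed.

Let vsum_vertex v vs : List.NoDup vs ->
  (List.In v vs -> vsum vs ** \pi_lpa (V v) = \pi_lpa (V v)) /\
  (~ List.In v vs -> vsum vs ** \pi_lpa (V v) = 0).
Proof.
elim=> [|w ws wNws _ [IH1 IH2]]; first by split=> // _; rewrite n0um.
rewrite /= numulDl -piM; split.
- case=> [wv|vws].
    by subst w; rewrite IH2 // addr0; apply/rel_pi/rel_vv.
  rewrite IH1 // (rel_pi (rel_vw _)) ?add0r // => wv.
  by apply: wNws; rewrite wv.
- move=> h; rewrite IH2; last by move=> ?; apply: h; right.
  by rewrite addr0; apply/rel_pi/rel_vw => wv; apply: h; left.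
Qed.

Let fixed_by (ws : list (vertex G)) (x : lpa) :=
  forall vs, List.NoDup vs -> List.incl ws vs -> vsum vs ** x = x.

Let fixed_gen (g : lpa_gen G) v :
  leavitt_rel (TMul (V v) (TGen g)) (TGen g) -> fixed_by [:: v] (\pi_lpa (TGen g)).
Proof.
move=> /rel_pi; rewrite piM => vg vs nd sub.
rewrite -{1}vg numulA (vsum_vertex v nd).1 //.
by apply: sub; left.
Qed.

Lemma lpa_local_unit (x : lpa) : exists u : lpa, u ** x = x.
Proof.
suff [ws h] : exists ws, fixed_by ws x.
  have dec (v w : vertex G) : {v = w} + {v <> w} by apply: pselect.
  exists (vsum (List.nodup dec ws)); apply: h; first exact: List.NoDup_nodup.
  by move=> v; rewrite List.nodup_In.
rewrite -[x]reprK; elim: (repr x) => {x}.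
- case=> [v|e|e].
  + exists [:: v]; exact/fixed_gen/rel_vv.
  + exists [:: source e]; exact/fixed_gen/rel_se.
  + exists [:: target e]; exact/fixed_gen/rel_te.
- by exists [::] => vs _ _; exact: num0.
- move=> t [ws h]; exists ws => vs nd sub; rewrite piN.
  apply: (addIr (\pi_lpa t : lpa)).
  by rewrite addNr -{2}(h vs nd sub) -numulDr addNr num0.
- move=> t [ws h] u [ws' h']; exists (ws ++ ws') => vs nd sub.
  rewrite piD numulDr h ?h' // => v hv; apply: sub; apply/List.in_or_app.
    by right.
  by left.
- move=> c t [ws h]; exists ws => vs nd sub.
  by rewrite piZ -scale_numulr h.
- move=> t [ws h] u _; exists ws => vs nd sub.
  by rewrite piM numulA h.
Qed.

Lemma lpa_idealZ (J : set lpa) : two_sided_ideal J ->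
  forall (c : F) x, J x -> J (c *: x).
Proof.
move=> hJ c x Jx; have [u ux] := lpa_local_unit x.
by rewrite -ux scale_numull; apply: idealMl.
Qed.

Definition lpa_ideal (J : set lpa) (hJ : two_sided_ideal J) : alg_ideal lpa :=
  AlgIdeal hJ (lpa_idealZ hJ).

End LeavittPathAlgebra.

Arguments lpa : clear implicits.

(* Main.v *)
(* A Leavitt family in an algebra A consists of elements of A that satisfy the
   relations of the Leavitt path algebra of a digraph. When it generates A, every
   nonzero x in A can be multiplied on both sides into a nonzero multiple of a
   vertex, or into p(c) for some nonzero polynomial p and some cycle c without
   exit (this is a formal computation, whose result may vanish in A).

   (a) => (c): in a Leavitt path algebra no such element lies in the Jacobson
   radical. Indeed the algebra acts on functions on a branching system, with a
   freely chosen weight for each arrow; there the vertices act nontrivially, and c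
   has an eigenvector for any prescribed nonzero eigenvalue, for instance one that
   is not a root of p. Zorn's lemma yields simple modules with such vectors.

   (c) => (b): an element of a nil ideal kills all simple modules.

   (b) => (a): the images of the generators form a generating family in A = L/J.
   Splitting vertices into sums of orthogonal idempotents of A turns it into a
   generating family for another digraph, first one without zero vertices, and then
   one in which p(c) <> 0 for all p <> 0 and all cycles c without exit. In the
   second step, if p(c) = 0 then reducedness makes c diagonalisable in its corner
   v A v, which is therefore spanned by eigenprojections of c; the cycle is replaced
   by as many stars of arrows as c has eigenvalues. By the reduction above, the
   Leavitt path algebra of the final digraph then maps isomorphically onto A. *)

From HB Require Import structures.
Require Import Defs.
From mathcomp Require Import all_boot all_algebra boolp classical_sets functions.
Set Implicit Arguments.
Unset Strict Implicit.
Unset Printing Implicit Defensive.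

Import GRing.Theory.
Local Open Scope ring_scope.
Local Open Scope quotient_scope.

(** * Nonunital algebras and Leavitt families *)

(** Linear independence of paths is never invoked. The arguments concern families in an arbitrary
    algebra, where a path may have the value 0; so the reduction tracks formal expressions, and only
    its two possible outcomes have to be shown nonzero: by modules in the Leavitt path algebra, by
    the choice of the digraph in A. That F is algebraically closed enters twice: a nonzero
    polynomial has a nonzero non-root, and the polynomial that annihilates a cycle splits, so that
    the corner becomes a product of copies of F and not of larger fields. Zero vertices cannot
    simply be deleted: a vertex with infinitely many arrows may be left with finitely many, and CK2,
    now demanded of it, may fail. Splitting off the defect as a new vertex repairs this. The
    vertices of a cycle without exit are equivalent idempotents. Hence one decomposition, at a
    chosen representative, can be carried to all of them; the arrows of the cycle may then be
    dropped, because the corners between its vertices are already spanned by the transported matrix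
    units. *)

HB.instance Definition _ (G : digraph) := gen_eqMixin (vertex G).
HB.instance Definition _ (G : digraph) := gen_choiceMixin (vertex G).
HB.instance Definition _ (G : digraph) := gen_eqMixin (arrow G).

Lemma inP (T : eqType) (x : T) (s : seq T) : reflect (List.In x s) (x \in s).
Proof.
elim: s => [|y s IH]; first by rewrite in_nil; constructor.
rewrite in_cons eq_sym /=.
by apply: (iffP orP) => -[h|h]; [left; apply/eqP|right; apply/IH|left;
  apply/eqP|right; apply/IH].
Qed.

Lemma uniqP_NoDup (T : eqType) (s : seq T) : reflect (List.NoDup s) (uniq s).
Proof.
apply: (iffP idP) => [|nd].
  elim: s => [_|x s IH /= /andP[/inP xs us]]; constructor => //; exact: IH.
by elim: nd => //= x l /inP -> _ ->.
Qed.

Lemma sum_by_label (M : nmodType) (T : eqType) (U : Type) (lab : U -> T)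
    (s : seq U) (r : seq T) (f : U -> M) :
  uniq r -> all (fun i => lab i \in r) s ->
  \sum_(i <- s) f i = \sum_(x <- r) \sum_(i <- s | lab i == x) f i.
Proof.
move=> ur; elim: s => [_|i s IH /= /andP[ir sr]].
  by rewrite big_nil big1 // => x _; rewrite big_nil.
rewrite big_cons (IH sr) [RHS](bigD1_seq (lab i)) //= big_cons eqxx -addrA.
congr (_ + _); rewrite (bigD1_seq (lab i)) //=; congr (_ + _).
apply: eq_bigr => x /negPf xi; rewrite [RHS]big_cons eq_sym xi //.
Qed.

Section NonunitalRing.
Variable R : nuRingType.
Implicit Types x y z : R.

Lemma numulr0 x : x ** 0 = 0.
Proof. by apply: (addrI (x ** 0)); rewrite -numulDr !addr0. Qed.
Lemma numul0r x : 0 ** x = 0.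
Proof. by apply: (addrI (0 ** x)); rewrite -numulDl !addr0. Qed.
Lemma numulrN x y : x ** (- y) = - (x ** y).
Proof. by apply/eqP; rewrite -addr_eq0 -numulDr addNr numulr0. Qed.
Lemma numulNr x y : (- x) ** y = - (x ** y).
Proof. by apply/eqP; rewrite -addr_eq0 -numulDl addNr numul0r. Qed.
Lemma numulrBr x y z : x ** (y - z) = x ** y - x ** z.
Proof. by rewrite numulDr numulrN. Qed.
Lemma numulrBl x y z : (x - y) ** z = x ** z - y ** z.
Proof. by rewrite numulDl numulNr. Qed.
Lemma numul_sumr I (s : seq I) (P : pred I) (f : I -> R) x :
  x ** (\sum_(i <- s | P i) f i) = \sum_(i <- s | P i) x ** f i.
Proof. exact: (big_morph _ (numulDr x) (numulr0 x)). Qed.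
Lemma numul_suml I (s : seq I) (P : pred I) (f : I -> R) x :
  (\sum_(i <- s | P i) f i) ** x = \sum_(i <- s | P i) f i ** x.
Proof.
exact: (big_morph (fun y => y ** x) (fun y z => numulDl y z x) (numul0r x)).
Qed.

End NonunitalRing.

Section NonunitalAlgebra.
Variables (F : fieldType) (A : nuAlgType F).

Definition lin_closed (P : A -> Prop) : Prop :=
  P 0 /\ forall (c : F) x y, P x -> P y -> P (c *: x + y).

Definition nusubalg_closed (P : A -> Prop) : Prop :=
  lin_closed P /\ forall x y, P x -> P y -> P (x ** y).

Section LinClosed.
Variable P : A -> Prop.
Hypothesis clP : lin_closed P.

Lemma lin_closedD x y : P x -> P y -> P (x + y).
Proof. by move=> hx hy; rewrite -[x]scale1r; apply clP. Qed.
Lemma lin_closedZ c x : P x -> P (c *: x).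
Proof. by move=> hx; rewrite -[_ *: _]addr0; apply clP => //; apply clP. Qed.
Lemma lin_closedN x : P x -> P (- x).
Proof. by move=> hx; rewrite -scaleN1r; exact: lin_closedZ. Qed.
Lemma lin_closed_sum I (s : seq I) (Q : pred I) (f : I -> A) :
  (forall i, Q i -> P (f i)) -> P (\sum_(i <- s | Q i) f i).
Proof.
by move=> h; apply: (big_ind P) => //; [apply clP|exact: lin_closedD].
Qed.
Lemma lin_closed_sum_seq (I : eqType) (s : seq I) (f : I -> A) :
  (forall i, i \in s -> P (f i)) -> P (\sum_(i <- s) f i).
Proof. by move=> h; rewrite big_seq; exact: lin_closed_sum. Qed.

End LinClosed.
End NonunitalAlgebra.

(** Nothing forces the vertices to be nonzero: in a quotient some of them may vanish, and with them
    the arrows that end there. *)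
Record leavitt_family (F : fieldType) (A : nuAlgType F) (G : digraph) :=
  LeavittFamily {
  famV : vertex G -> A;
  famE : arrow G -> A;
  famG : arrow G -> A;
  famVV : forall v, famV v ** famV v = famV v;
  famVW : forall v w, v != w -> famV v ** famV w = 0;
  famVE : forall e, famV (source e) ** famE e = famE e;
  famEV : forall e, famE e ** famV (target e) = famE e;
  famVG : forall e, famV (target e) ** famG e = famG e;
  famGV : forall e, famG e ** famV (source e) = famG e;
  famGE : forall e, famG e ** famE e = famV (target e);
  famGE0 : forall e f, e != f -> famG e ** famE f = 0;
  famCK2 : forall v (es : seq (arrow G)), uniq es -> es <> [::] ->
    (forall e, e \in es <-> source e = v) ->
    famV v = \sum_(e <- es) famE e ** famG e }.

(** Phrased as an induction principle over [A], the form in which generation is applied. *)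
Definition generating (F : fieldType) (A : nuAlgType F) (G : digraph)
    (f : leavitt_family A G) : Prop :=
  forall P : A -> Prop, nusubalg_closed P ->
    (forall v, P (famV f v)) -> (forall e, P (famE f e)) ->
    (forall e, P (famG f e)) -> forall x, P x.

(** * Actions of a presented algebra and maps out of it *)

Section PresentedAlgebraMaps.
Variables (F : fieldType) (X : Type).
Variable rel : alg_term F X -> alg_term F X -> Prop.
Local Notation B := (presented_alg rel).

Lemma pres_ind (P : B -> Prop) : nusubalg_closed P ->
  (forall g, P (\pi_B (TGen g))) -> forall x, P x.
Proof.
move=> [cl clM] hg x; rewrite -[x]reprK; elim: (repr x) => {x}.
- exact: hg.
- exact: cl.1.
- move=> t ht; rewrite (_ : \pi_B _ = - (\pi_B t : B)); first exact: lin_closedN.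
  by symmetry; exact: pres_piN.
- move=> t ht u hu; rewrite (_ : \pi_B _ = (\pi_B t : B) + \pi_B u).
    exact: lin_closedD.
  by symmetry; exact: pres_piD.
- move=> c t ht; rewrite (_ : \pi_B _ = c *: (\pi_B t : B)).
    exact: lin_closedZ.
  by symmetry; exact: pres_piZ.
- move=> t ht u hu; rewrite (_ : \pi_B _ = (\pi_B t : B) ** \pi_B u).
    exact: clM.
  by symmetry; exact: pres_piM.
Qed.

Section Action.
Variables (W : lmodType F) (rho : X -> W -> W).
Hypothesis rho_lin : forall g (c : F) x y,
  rho g (c *: x + y) = c *: rho g x + rho g y.

(** Evaluation in the endomorphisms of [W], written pointwise so that they need not be made into an
    algebra. *)
Fixpoint term_act (t : alg_term F X) (w : W) : W :=
  match t with
  | TGen g => rho g w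
  | TZero => 0
  | TOpp t => - term_act t w
  | TAdd t u => term_act t w + term_act u w
  | TScale c t => c *: term_act t w
  | TMul t u => term_act t (term_act u w)
  end.

Lemma term_act_lin t (c : F) x y :
  term_act t (c *: x + y) = c *: term_act t x + term_act t y.
Proof.
elim: t c x y => /= [g c x y|c x y|t IH c x y|t IHt u IHu c x y
    |d t IH c x y|t IHt u IHu c x y].
- exact: rho_lin.
- by rewrite scaler0 addr0.
- by rewrite IH scalerN opprD.
- by rewrite IHt IHu scalerDr addrACA.
- by rewrite IH scalerDr !scalerA mulrC.
- by rewrite IHu IHt.
Qed.

Lemma term_actD t x y : term_act t (x + y) = term_act t x + term_act t y.
Proof. by rewrite -[x]scale1r term_act_lin !scale1r. Qed.

Lemma term_actZ t c x : term_act t (c *: x) = c *: term_act t x.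
Proof.
have t0: term_act t 0 = 0 by apply: (addrI (term_act t 0));
  rewrite -term_actD !addr0.
by rewrite -[c *: x]addr0 term_act_lin t0 addr0.
Qed.

Hypothesis rho_rel : forall t u, rel t u -> term_act t =1 term_act u.

Lemma term_act_cong t u : alg_cong rel t u -> term_act t =1 term_act u.
Proof.
elim=> {t u} //=.
- by move=> t u _ h w; rewrite h.
- by move=> t u s _ h1 _ h2 w; rewrite h1.
- by move=> t t' _ h w; rewrite h.
- by move=> t t' u u' _ h _ h' w; rewrite h h'.
- by move=> c t t' _ h w; rewrite h.
- by move=> t t' u u' _ h _ h' w; rewrite h' h.
- by move=> t u s w; rewrite addrA.
- by move=> t u w; rewrite addrC.
- by move=> t w; rewrite add0r.
- by move=> t w; rewrite addNr.
- by move=> c d t w; rewrite scalerA.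
- by move=> t w; rewrite scale1r.
- by move=> c t u w; rewrite scalerDr.
- by move=> c d t w; rewrite scalerDl.
- by move=> t u s w; rewrite term_actD.
- by move=> c t u w; rewrite term_actZ.
Qed.

Definition pres_act (x : B) (w : W) : W := term_act (repr x) w.

Lemma pres_act_pi t w : pres_act (\pi_B t) w = term_act t w.
Proof. by apply: term_act_cong; apply/pres_eqP; rewrite reprK. Qed.

Lemma pres_actM x y w : pres_act (x ** y) w = pres_act x (pres_act y w).
Proof. exact: (pres_act_pi (TMul (repr x) (repr y))). Qed.
Lemma pres_actDl x y w : pres_act (x + y) w = pres_act x w + pres_act y w.
Proof. exact: (pres_act_pi (TAdd (repr x) (repr y))). Qed.
Lemma pres_actDr x w w' : pres_act x (w + w') = pres_act x w + pres_act x w'.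
Proof. exact: term_actD. Qed.
Lemma pres_actZ c x w : pres_act (c *: x) w = c *: pres_act x w.
Proof. exact: (pres_act_pi (TScale c (repr x))). Qed.

Definition pres_module : nuLeftModule B :=
  NuLeftModule pres_actM pres_actDl pres_actDr.

End Action.

Section Lift.
Variables (A : nuAlgType F) (rho : X -> A).

Fixpoint term_eval (t : alg_term F X) : A :=
  match t with
  | TGen g => rho g
  | TZero => 0
  | TOpp t => - term_eval t
  | TAdd t u => term_eval t + term_eval u
  | TScale c t => c *: term_eval t
  | TMul t u => term_eval t ** term_eval u
  end.

Hypothesis rho_rel : forall t u, rel t u -> term_eval t = term_eval u.

Lemma term_eval_cong t u : alg_cong rel t u -> term_eval t = term_eval u.
Proof.
elim=> {t u} //=.
- by move=> t u s _ -> _ ->.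
- by move=> t t' _ ->.
- by move=> t t' u u' _ -> _ ->.
- by move=> c t t' _ ->.
- by move=> t t' u u' _ -> _ ->.
- by move=> t u s; rewrite addrA.
- by move=> t u; rewrite addrC.
- by move=> t; rewrite add0r.
- by move=> t; rewrite addNr.
- by move=> c d t; rewrite scalerA.
- by move=> t; rewrite scale1r.
- by move=> c t u; rewrite scalerDr.
- by move=> c d t; rewrite scalerDl.
- by move=> t u s; rewrite numulA.
- by move=> t u s; rewrite numulDl.
- by move=> t u s; rewrite numulDr.
- by move=> c t u; rewrite scale_numull.
- by move=> c t u; rewrite scale_numulr.
Qed.

Definition pres_lift (x : B) : A := term_eval (repr x).

Lemma pres_lift_pi t : pres_lift (\pi_B t) = term_eval t.
Proof. by apply: term_eval_cong; apply/pres_eqP; rewrite reprK. Qed.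

Lemma pres_liftM x y : pres_lift (x ** y) = pres_lift x ** pres_lift y.
Proof. exact: (pres_lift_pi (TMul (repr x) (repr y))). Qed.
Lemma pres_liftD x y : pres_lift (x + y) = pres_lift x + pres_lift y.
Proof. exact: (pres_lift_pi (TAdd (repr x) (repr y))). Qed.
Lemma pres_liftZ c x : pres_lift (c *: x) = c *: pres_lift x.
Proof. exact: (pres_lift_pi (TScale c (repr x))). Qed.

End Lift.
End PresentedAlgebraMaps.

Section CanonicalFamily.
Variables (F : fieldType) (G : digraph).
Local Notation L := (lpa F G).

Definition lpa_gen_elt (g : lpa_gen G) : L := \pi_L (TGen g).

Lemma lpa_rel_eq (t u : alg_term F (lpa_gen G)) :
  leavitt_rel t u -> (\pi_L t : L) = \pi_L u.
Proof. by move=> h; apply/pres_eqP; apply: cong_rel. Qed.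

Lemma lpa_mulE (g h : lpa_gen G) :
  lpa_gen_elt g ** lpa_gen_elt h = \pi_L (TMul (TGen g) (TGen h)).
Proof. exact: pres_piM. Qed.

Lemma lpa_sumE (es : seq (arrow G)) :
  \sum_(e <- es) lpa_gen_elt (Arrow e) ** lpa_gen_elt (Ghost e) =
  \pi_L (foldr (@TAdd _ _) TZero
    [seq TMul (TGen (Arrow e)) (TGen (Ghost e)) | e <- es]).
Proof.
elim: es => [|e es IH]; first by rewrite big_nil.
by rewrite big_cons IH lpa_mulE; exact: pres_piD.
Qed.

Definition lpa_family : leavitt_family L G.
Proof.
refine (@LeavittFamily F L G (fun v => lpa_gen_elt (Vertex v))
  (fun e => lpa_gen_elt (Arrow e)) (fun e => lpa_gen_elt (Ghost e))
  _ _ _ _ _ _ _ _ _).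
- by move=> v; rewrite lpa_mulE; apply: lpa_rel_eq; constructor.
- move=> v w /eqP vw; rewrite lpa_mulE; apply: lpa_rel_eq; exact: rel_vw.
- by move=> e; rewrite lpa_mulE; apply: lpa_rel_eq; constructor.
- by move=> e; rewrite lpa_mulE; apply: lpa_rel_eq; constructor.
- by move=> e; rewrite lpa_mulE; apply: lpa_rel_eq; constructor.
- by move=> e; rewrite lpa_mulE; apply: lpa_rel_eq; constructor.
- by move=> e; rewrite lpa_mulE; apply: lpa_rel_eq; constructor.
- move=> e f /eqP ef; rewrite lpa_mulE; apply: lpa_rel_eq; exact: rel_CK1_neq.
- move=> v es /uniqP_NoDup ues es0 esv; rewrite lpa_sumE; apply: lpa_rel_eq.
  by apply: rel_CK2 => // e; rewrite -esv; split=> /inP.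
Defined.

Lemma lpa_family_generating : generating lpa_family.
Proof.
by move=> P cl hV hE hG; apply: (pres_ind cl) => -[v|e|e];
  [exact: hV|exact: hE|exact: hG].
Qed.

Variables (A : nuAlgType F) (f : leavitt_family A G).

Definition fam_gen (g : lpa_gen G) : A :=
  match g with
  | Vertex v => famV f v
  | Arrow e => famE f e
  | Ghost e => famG f e
  end.

Lemma fam_gen_rel (t u : alg_term F (lpa_gen G)) :
  leavitt_rel t u -> term_eval fam_gen t = term_eval fam_gen u.
Proof.
case=> {t u} /=.
- exact: famVV.
- by move=> v w /eqP; exact: famVW.
- exact: famVE.
- exact: famEV.
- exact: famVG.
- exact: famGV.
- exact: famGE.
- by move=> e e' /eqP; exact: famGE0.
- move=> v es /uniqP_NoDup ues es0 esv.
  rewrite (@famCK2 _ _ _ f v es) //; last first.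
    by move=> e; rewrite -esv; split=> /inP.
  by elim: (es) => [|e es' IH]; rewrite ?big_nil // big_cons IH.
Qed.

Definition lpa_lift : L -> A := pres_lift fam_gen.

Lemma lpa_liftM x y : lpa_lift (x ** y) = lpa_lift x ** lpa_lift y.
Proof. exact: (pres_liftM fam_gen_rel). Qed.
Lemma lpa_liftD x y : lpa_lift (x + y) = lpa_lift x + lpa_lift y.
Proof. exact: (pres_liftD fam_gen_rel). Qed.
Lemma lpa_liftZ c x : lpa_lift (c *: x) = c *: lpa_lift x.
Proof. exact: (pres_liftZ fam_gen_rel). Qed.
Lemma lpa_lift_gen g : lpa_lift (lpa_gen_elt g) = fam_gen g.
Proof. exact: (pres_lift_pi fam_gen_rel). Qed.

End CanonicalFamily.

(** * Paths *)

Section Paths.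
Variable G : digraph.
Implicit Types (u v : vertex G) (e f : arrow G) (p q : seq (arrow G)).

Fixpoint valid_path u p : bool :=
  if p is e :: p' then (source e == u) && valid_path (target e) p' else true.

Definition path_end u p : vertex G := last u [seq target e | e <- p].

Definition no_exit p : Prop :=
  forall e, e \in p -> forall f, source f = source e -> f = e.

Lemma path_end_cat u p q : path_end u (p ++ q) = path_end (path_end u p) q.
Proof. by rewrite /path_end map_cat last_cat. Qed.

Lemma valid_path_cat u p q :
  valid_path u (p ++ q) = valid_path u p && valid_path (path_end u p) q.
Proof. by elim: p u => //= e p IH u; rewrite IH andbA. Qed.

End Paths.

Section PathElements.
Variables (F : fieldType) (A : nuAlgType F) (G : digraph).
Variable f : leavitt_family A G.
Implicit Types (u v w : vertex G) (e : arrow G) (p q : seq (arrow G)).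
Local Notation V := (famV f).
Local Notation E := (famE f).
Local Notation E' := (famG f).

(** The factor [V u] in front of each arrow makes the value 0 on lists that are not paths from [u],
    so sums may range over arbitrary lists of arrows. *)
Fixpoint path_elt u p : A :=
  if p is e :: p' then V u ** (E e ** path_elt (target e) p') else V u.

Fixpoint ghost_elt u p : A :=
  if p is e :: p' then ghost_elt (target e) p' ** (E' e ** V u) else V u.

Lemma famVV_if v w : V v ** V w = if v == w then V v else 0.
Proof. by case: eqVneq => [<-|]; [exact: famVV|exact: famVW]. Qed.

Lemma famVE_if v e : V v ** E e = if v == source e then E e else 0.
Proof.
by rewrite -famVE numulA famVV_if; case: eqVneq => [->|]; rewrite ?numul0r.
Qed.

Lemma famGV_if v e : E' e ** V v = if v == source e then E' e else 0.
Proof.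
by rewrite -famGV -numulA famVV_if eq_sym; case: eqVneq => _; rewrite ?numulr0.
Qed.

Lemma famGE_if e e' : E' e ** E e' = if e == e' then V (target e) else 0.
Proof. by case: eqVneq => [<-|]; [exact: famGE|exact: famGE0]. Qed.

(** CK2 at a vertex that emits a single arrow. *)
Lemma famEG_noexit e : (forall e', source e' = source e -> e' = e) ->
  E e ** E' e = V (source e).
Proof.
move=> h; rewrite (@famCK2 _ _ _ f (source e) [:: e]) ?big_seq1 // => e'.
by rewrite inE; split=> [/eqP ->|/h ->].
Qed.

Lemma path_elt_V u p : path_elt u p = V u ** path_elt u p.
Proof. by case: p => [|e p] /=; rewrite ?numulA famVV. Qed.

Lemma ghost_elt_V u p : ghost_elt u p = ghost_elt u p ** V u.
Proof. by case: p => [|e p] /=; rewrite -?numulA famVV. Qed.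

Lemma path_elt_cons e p : path_elt (source e) (e :: p) = E e ** path_elt
  (target e) p.
Proof. by rewrite /= numulA famVE. Qed.

Lemma path_elt_invalid u p : ~~ valid_path u p -> path_elt u p = 0.
Proof.
elim: p u => //= e p IH u; rewrite negb_and numulA famVE_if eq_sym.
case: eqVneq => [_|] /=; last by rewrite numul0r.
by move=> /IH ->; rewrite numulr0.
Qed.

Lemma ghost_elt_invalid u p : ~~ valid_path u p -> ghost_elt u p = 0.
Proof.
elim: p u => //= e p IH u; rewrite negb_and famGV_if eq_sym.
case: eqVneq => [_|] /=; last by rewrite numulr0.
by move=> /IH ->; rewrite numul0r.
Qed.

Lemma path_elt_end u p w :
  path_elt u p ** V w = if path_end u p == w then path_elt u p else 0.
Proof.
elim: p u => [|e p IH] u /=; first exact: famVV_if.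
by rewrite -!numulA IH; case: eqP => // _; rewrite !numulr0.
Qed.

Lemma ghost_elt_end u p w :
  V w ** ghost_elt u p = if path_end u p == w then ghost_elt u p else 0.
Proof.
elim: p u => [|e p IH] u /=; first by rewrite famVV_if eq_sym; case: eqP => // ->.
by rewrite numulA IH; case: eqP => // _; rewrite !numul0r.
Qed.

Lemma path_elt_cat u p q :
  path_elt u (p ++ q) = path_elt u p ** path_elt (path_end u p) q.
Proof.
by elim: p u => [|e p IH] u /=; [exact: path_elt_V|rewrite IH !numulA].
Qed.

Lemma ghost_elt_cat u p q :
  ghost_elt u (p ++ q) = ghost_elt (path_end u p) q ** ghost_elt u p.
Proof.
by elim: p u => [|e p IH] u /=; [exact: ghost_elt_V|rewrite IH !numulA].
Qed.

Lemma path_elt_rcons u p e : path_elt u (rcons p e) = path_elt u p ** E e.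
Proof.
by rewrite -cats1 path_elt_cat /= famEV numulA path_elt_end eqxx.
Qed.

Lemma ghost_elt_rcons u p e : ghost_elt u (rcons p e) = E' e ** ghost_elt u p.
Proof.
by rewrite -cats1 ghost_elt_cat /= numulA famVG -numulA ghost_elt_end eqxx.
Qed.

Lemma ghost_path_cat u p q : valid_path u p ->
  ghost_elt u p ** path_elt u (p ++ q) = path_elt (path_end u p) q.
Proof.
elim: p u => [u _|e p IH u /= /andP[/eqP <- hp]]; first by rewrite -path_elt_V.
rewrite famGV [famV _ _ ** (_ ** _)]numulA famVE.
by rewrite -numulA [E' e ** _]numulA famGE -path_elt_V; exact: IH.
Qed.

Lemma ghost_path u p : valid_path u p ->
  ghost_elt u p ** path_elt u p = V (path_end u p).
Proof. by move=> hp; rewrite -[in path_elt _ _](cats0 p) ghost_path_cat. Qed.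

(** Lists that are not prefixes of each other differ at some first position; CK1 cancels what
    precedes it and gives 0 there. *)
Lemma ghost_path0 u p q : ~~ prefix p q -> ~~ prefix q p ->
  ghost_elt u p ** path_elt u q = 0.
Proof.
elim: p u q => [|e p IH] u [|e' q] //=.
rewrite famGV_if [famV _ _ ** (_ ** _)]numulA famVE_if.
case: (u == source e); last by rewrite numulr0 !numul0r.
case: (u == source e'); last by rewrite numul0r numulr0.
rewrite -numulA [E' e ** _]numulA famGE_if [e' == e]eq_sym.
case: eqVneq => [<-|_ _ _]; last by rewrite numul0r numulr0.
by move=> /= h1 h2; rewrite -path_elt_V; apply: IH.
Qed.

Lemma path_ghost_noexit u p : valid_path u p -> no_exit p ->
  path_elt u p ** ghost_elt u p = V u.
Proof.
elim: p u => [u _ _|e p IH u /= /andP[/eqP <- hp] ne]; first exact: famVV.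
rewrite famGV [famV _ _ ** (_ ** _)]numulA famVE -numulA [path_elt _ _ **
  _]numulA IH //.
  by rewrite famVG famEG_noexit //; apply: ne; exact: mem_head.
by move=> e' e'p; apply: ne; rewrite inE e'p orbT.
Qed.

End PathElements.

(** * Closed paths and shortest cycles *)

Section ClosedPaths.
Variable G : digraph.
Implicit Types (u v : vertex G) (e f : arrow G) (p q c : seq (arrow G)).

Definition path_pow n c := flatten (nseq n c).

Definition closed_path v c : bool := valid_path v c && (path_end v c == v).

(** A shortest closed path plays the role of a cycle: minimality alone will show that its first
    arrow does not recur and that closed paths running along it are its powers. *)
Definition min_closed v c : Prop :=
  [/\ closed_path v c, c != [::] &
      forall c', closed_path v c' -> c' != [::] -> (size c <= size c')%N].

Lemma path_powS n c : path_pow n.+1 c = c ++ path_pow n c.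
Proof. by []. Qed.

Lemma path_powD m n c : path_pow (m + n) c = path_pow m c ++ path_pow n c.
Proof. by rewrite /path_pow nseqD flatten_cat. Qed.

Lemma path_powC m n c :
  path_pow m c ++ path_pow n c = path_pow n c ++ path_pow m c.
Proof. by rewrite -!path_powD addnC. Qed.

Lemma size_path_pow n c : size (path_pow n c) = (n * size c)%N.
Proof. by elim: n => // n IH; rewrite path_powS size_cat IH mulSn. Qed.

Lemma mem_path_pow n c e : e \in path_pow n c -> e \in c.
Proof. by elim: n => // n IH; rewrite path_powS mem_cat => /orP[|/IH]. Qed.

Lemma closed_path_cat v c c' :
  closed_path v c -> closed_path v c' -> closed_path v (c ++ c').
Proof.
rewrite /closed_path valid_path_cat path_end_cat.
by move=> /andP[-> /eqP ->] /andP[-> /eqP ->] /=.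
Qed.

Lemma closed_path_pow v c n : closed_path v c -> closed_path v (path_pow n c).
Proof.
move=> cl; elim: n => [|n IH]; first by rewrite /closed_path /= eqxx.
by rewrite path_powS; exact: closed_path_cat.
Qed.

Lemma closed_path_drop v c c' :
  closed_path v c -> closed_path v (c ++ c') -> closed_path v c'.
Proof.
rewrite /closed_path valid_path_cat path_end_cat.
by move=> /andP[-> /eqP ->].
Qed.

Lemma closed_path_next v c e : closed_path v c -> e \in c ->
  exists2 e', e' \in c & source e' = target e.
Proof.
move=> cl ec; case/splitPr: ec cl => c1 [|e' c2].
  rewrite /closed_path path_end_cat => /andP[+ /eqP ve].
  case: c1 ve => [|e1 c1] ve /= /andP[/eqP se _].
    by exists e; rewrite ?mem_head // se.
  by exists e1; rewrite ?mem_head // se.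
move=> /andP[]; rewrite valid_path_cat => /andP[_ /= /and3P[_ /eqP se _]] _.
by exists e'; rewrite // mem_cat !inE eqxx !orbT.
Qed.

Lemma min_closed_exists v c : closed_path v c -> c != [::] ->
  exists c0, min_closed v c0.
Proof.
move=> cl c0.
have ex: exists n, `[< exists c', [/\ closed_path v c', c' != [::] & size c' =
  n] >].
  by exists (size c); apply/asboolP; exists c.
case: (ex_minnP ex) => n /asboolP[c' [cl' c'0 <-]] hmin.
by exists c'; split=> // d cld d0; apply: hmin; apply/asboolP; exists d.
Qed.

(** If nonempty, [p] is at least as long as [c] by minimality, hence begins with [c]; removing this
    copy leaves a shorter closed path of the same kind. *)
Lemma min_closed_pow v c p n : min_closed v c -> closed_path v p ->
  prefix p (path_pow n c) -> exists j, p = path_pow j c.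
Proof.
move=> [cl c0 cmin]; elim: n p => [|n IH] p clp.
  by rewrite prefixs0 => /eqP ->; exists 0%N.
rewrite path_powS; have [->|p0] := eqVneq p [::]; first by exists 0%N.
move=> /prefixP[r hr].
have hp: p = c ++ drop (size c) p.
  rewrite -{1}(cat_take_drop (size c) p); congr (_ ++ _).
  have := congr1 (take (size c)) hr.
  by rewrite [take _ (c ++ _)]take_size_cat // takel_cat ?cmin.
have [||j hj] := IH (drop (size c) p).
- by apply: closed_path_drop cl _; rewrite -hp.
- apply/prefixP; exists r; move: hr; rewrite {1}hp -catA => /eqP.
  by rewrite eqseq_cat // eqxx => /eqP.
by exists j.+1; rewrite path_powS -hj.
Qed.

(** Without exits a path from [v] has no choice: arrow by arrow it follows [c] round and round. *)
Lemma no_exit_prefix v c p : closed_path v c -> c != [::] -> no_exit c ->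
  valid_path v p -> exists n, prefix p (path_pow n c).
Proof.
move=> cl c0 ne; elim/last_ind: p => [|p e IH]; first by exists 0%N.
rewrite -cats1 valid_path_cat /= andbT => /andP[hp /eqP se].
have [n /prefixP[r hr]] := IH hp.
have: path_pow n.+1 c = p ++ (r ++ c) by rewrite -addn1 path_powD hr /path_pow
  /= cats0 catA.
case rc: (r ++ c) => [|g r'] hpow.
  by case: (r) rc => //= rc; rewrite rc in c0.
exists n.+1; rewrite hpow.
have /andP[] := closed_path_pow n.+1 cl.
rewrite hpow valid_path_cat => /andP[_ /= /andP[/eqP sg _]] _.
have gc: g \in c by apply: (@mem_path_pow n.+1); rewrite hpow mem_cat mem_head orbT.
by rewrite (ne g gc e) ?se // -[g :: r']cat1s catA prefix_prefix.
Qed.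

(** A shortest closed path at [v] runs along [c], so it has no exit either; hence [c] runs along it
    in turn and is one of its powers. *)
Lemma no_exit_min_closed v c : closed_path v c -> c != [::] -> no_exit c ->
  exists c0 j, [/\ min_closed v c0, no_exit c0 & c = path_pow j c0].
Proof.
move=> cl c0 ne; have [d hd] := min_closed_exists cl c0.
have [cld d0 dmin] := hd.
have [n /prefixP[r hr]] : exists n, prefix d (path_pow n c).
  by apply: (no_exit_prefix cl) => //; case/andP: cld.
have ned: no_exit d.
  by move=> e ed; apply: ne; apply: (@mem_path_pow n); rewrite hr mem_cat ed.
have [m hm] : exists m, prefix c (path_pow m d).
  by apply: (no_exit_prefix cld) => //; case/andP: cl.
by have [j hj] := min_closed_pow hd cl hm; exists d, j.
Qed.

End ClosedPaths.

(** * Polynomials in an element of a corner *)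

Section CornerPolynomials.
Variables (F : fieldType) (A : nuAlgType F) (v c : A).
Hypotheses (vv : v ** v = v) (vc : v ** c = c) (cv : c ** v = c).
Implicit Types p q : {poly F}.

(** Powers in the corner with unit [v]: the power 0 is [v], so constant terms of polynomials are
    multiples of [v]. *)
Definition corner_pow n : A := iter n (numul c) v.

Definition corner_eval p : A := \sum_(i < size p) p`_i *: corner_pow i.

Lemma corner_powS n : corner_pow n.+1 = c ** corner_pow n. Proof. by []. Qed.

Lemma corner_pow1 : corner_pow 1 = c. Proof. exact: cv. Qed.

Lemma corner_vpow n : v ** corner_pow n = corner_pow n.
Proof. by case: n => [|n] //=; rewrite numulA vc. Qed.

Lemma corner_powv n : corner_pow n ** v = corner_pow n.
Proof. by elim: n => [|n IH] //=; rewrite -numulA IH. Qed.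

Lemma corner_powD m n : corner_pow m ** corner_pow n = corner_pow (m + n).
Proof. by elim: m => [|m IH]; rewrite ?corner_vpow //= -numulA IH. Qed.

Lemma corner_eval_wide n p : (size p <= n)%N ->
  corner_eval p = \sum_(i < n) p`_i *: corner_pow i.
Proof.
move=> pn; rewrite /corner_eval (big_ord_widen n (fun i => p`_i *: corner_pow
  i)) //.
rewrite big_mkcond; apply: eq_bigr => i _; case: ltnP => // /leq_sizeP -> //.
by rewrite scale0r.
Qed.

Lemma corner_evalP (a : F) p q :
  corner_eval (a *: p + q) = a *: corner_eval p + corner_eval q.
Proof.
set n := maxn (size p) (size q).
rewrite !(@corner_eval_wide n) ?leq_maxl ?leq_maxr //; last first.
  rewrite (leq_trans (size_polyD _ _)) // geq_max leq_maxr andbT.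
  by rewrite (leq_trans (size_scale_leq _ _)) ?leq_maxl.
rewrite scaler_sumr -big_split; apply: eq_bigr => i _.
by rewrite coefD coefZ scalerDl scalerA.
Qed.

Lemma corner_eval0 : corner_eval 0 = 0.
Proof. by rewrite /corner_eval size_poly0 big_ord0. Qed.

Lemma corner_evalZ (a : F) p : corner_eval (a *: p) = a *: corner_eval p.
Proof. by rewrite -[a *: p]addr0 corner_evalP corner_eval0 addr0. Qed.

Lemma corner_evalD p q : corner_eval (p + q) = corner_eval p + corner_eval q.
Proof. by rewrite -[p]scale1r corner_evalP !scale1r. Qed.

Lemma corner_eval_sum I (s : seq I) (P : I -> {poly F}) :
  corner_eval (\sum_(i <- s) P i) = \sum_(i <- s) corner_eval (P i).
Proof. exact: (big_morph _ corner_evalD corner_eval0). Qed.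

Lemma corner_evalXn n : corner_eval 'X^n = corner_pow n.
Proof.
rewrite (@corner_eval_wide n.+1) ?size_polyXn // big_ord_recr /= coefXn eqxx.
rewrite scale1r big1 ?add0r // => i _.
by rewrite coefXn ltn_eqF // scale0r.
Qed.

Lemma corner_eval_mulX p : corner_eval ('X * p) = c ** corner_eval p.
Proof.
rewrite (@corner_eval_wide (size p).+1); last first.
  by rewrite (leq_trans (size_polyMleq _ _)) // size_polyX.
rewrite big_ord_recl coefXM /= scale0r add0r numul_sumr.
by apply: eq_bigr => i _; rewrite coefXM /= -scale_numulr.
Qed.

Lemma corner_eval_mulXsubC a p :
  corner_eval (('X - a%:P) * p) = c ** corner_eval p - a *: corner_eval p.
Proof.
by rewrite mulrBl corner_evalD corner_eval_mulX -mulNr -polyCN mul_polyC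
  corner_evalZ scaleNr.
Qed.

End CornerPolynomials.

(** Turns a polynomial relation for a power of a cycle into one for the cycle itself. *)
Lemma corner_eval_compXn (F : fieldType) (A : nuAlgType F) (v c : A) j
    (p : {poly F}) : v ** v = v -> v ** c = c ->
  corner_eval v c (p \Po 'X^j) = corner_eval v (corner_pow v c j) p.
Proof.
move=> vv vc; rewrite comp_polyE corner_eval_sum [RHS]/corner_eval.
apply: eq_bigr => i _; rewrite corner_evalZ -exprM corner_evalXn; congr (_ *: _).
elim: (nat_of_ord i) => [|n IH]; first by rewrite muln0.
by rewrite mulnS corner_powS -IH corner_powD.
Qed.

Section PathPowers.
Variables (F : fieldType) (A : nuAlgType F) (G : digraph).
Variables (f : leavitt_family A G) (v : vertex G) (c : seq (arrow G)).
Hypothesis clc : closed_path v c.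

Lemma closed_path_eltV : path_elt f v c ** famV f v = path_elt f v c.
Proof. by rewrite path_elt_end; case/andP: clc => _ ->. Qed.

Lemma path_elt_pow n :
  path_elt f v (path_pow n c) = corner_pow (famV f v) (path_elt f v c) n.
Proof.
have /andP[_ /eqP end_c] := clc.
by elim: n => // n IH; rewrite path_powS path_elt_cat end_c IH.
Qed.

End PathPowers.

(** * The reduction theorem *)

Section Reduction.
Variables (F : fieldType) (A : nuAlgType F) (G : digraph).
Variable f : leavitt_family A G.
Implicit Types (u v w : vertex G) (e : arrow G) (p q : seq (arrow G)).
Local Notation V := (famV f).
Local Notation E := (famE f).
Local Notation E' := (famG f).

Definition real_elt u (x : A) : Prop :=
  exists l : seq (F * seq (arrow G)),
    x = \sum_(i <- l) i.1 *: path_elt f u i.2.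

Lemma real_lin u : lin_closed (real_elt u).
Proof.
split=> [|c x y [l ->] [l' ->]]; first by exists [::]; rewrite big_nil.
exists ([seq (c * i.1, i.2) | i <- l] ++ l').
rewrite big_cat big_map /=; congr (_ + _); rewrite scaler_sumr.
by apply: eq_bigr => i _; rewrite scalerA.
Qed.

Lemma real_mulE u x e : real_elt u x -> real_elt u (x ** E e).
Proof.
move=> [l ->]; exists [seq (i.1, rcons i.2 e) | i <- l].
rewrite big_map numul_suml; apply: eq_bigr => i _.
by rewrite path_elt_rcons scale_numull.
Qed.

Lemma real_mulV u x w : real_elt u x -> real_elt u (x ** V w).
Proof.
move=> [l ->]; exists [seq i <- l | path_end u i.2 == w].
rewrite big_filter numul_suml [RHS]big_mkcond; apply: eq_bigr => i _.
by rewrite -scale_numull path_elt_end; case: eqP => //; rewrite scaler0.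
Qed.

(* Elements of [V u ** A] that are combinations of monomials p q^* with
   [size q <= n]. *)
Fixpoint ghost_deg u n (x : A) : Prop :=
  if n is n'.+1 then
    exists (S : seq (arrow G * A)) (y : A),
      [/\ real_elt u y, forall i, i \in S -> ghost_deg u n' i.2 &
          x = y + \sum_(i <- S) i.2 ** E' i.1]
  else real_elt u x.

Lemma ghost_deg_lin u n : lin_closed (ghost_deg u n).
Proof.
elim: n => [|n IH]; first exact: real_lin.
split=> [|c x y].
  by exists [::], 0; split=> //; [exact: (real_lin u).1|rewrite big_nil addr0].
move=> /= [S [x0 [rx0 hS ->]]] [S' [y0 [ry0 hS' ->]]].
exists ([seq (i.1, c *: i.2) | i <- S] ++ S'), (c *: x0 + y0); split.
- exact: (real_lin u).2.
- move=> i; rewrite mem_cat => /orP[/mapP[j jS ->]|/hS' //].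
  by apply: lin_closedZ IH _ _ _; exact: hS.
- rewrite big_cat big_map /= scalerDr scaler_sumr addrACA; congr (_ + (_ + _)).
  by apply: eq_bigr => i _; rewrite scale_numull.
Qed.

Lemma real_ghost_deg u n x : real_elt u x -> ghost_deg u n x.
Proof.
by case: n => // n rx; exists [::], x; split=> //; rewrite big_nil addr0.
Qed.

Lemma ghost_degW u m n x : (m <= n)%N -> ghost_deg u m x -> ghost_deg u n x.
Proof.
elim: m n x => [|m IH] [|n] x //; first by move=> _; exact: real_ghost_deg.
move=> mn [S [y [ry hS ->]]]; exists S, y; split=> // i /hS; exact: IH.
Qed.

Lemma ghost_deg_mulV u n x w : ghost_deg u n x -> ghost_deg u n (x ** V w).
Proof.
case: n => [|n]; first exact: real_mulV.
move=> [S [y [ry hS ->]]].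
exists [seq i <- S | w == source i.1], (y ** V w); split.
- exact: real_mulV.
- by move=> i; rewrite mem_filter => /andP[_ /hS].
- rewrite big_filter numulDl numul_suml [in RHS]big_mkcond; congr (_ + _).
  apply: eq_bigr => i _; rewrite -numulA famGV_if.
  by case: eqP => // _; rewrite numulr0.
Qed.

Lemma ghost_deg_mulE_expr (S : seq (arrow G * A)) y e :
  (y + \sum_(i <- S) i.2 ** E' i.1) ** E e =
  y ** E e + (\sum_(i <- S | i.1 == e) i.2) ** V (target e).
Proof.
rewrite numulDl !numul_suml; congr (_ + _); rewrite [RHS]big_mkcond.
apply: eq_bigr => i _; rewrite -numulA famGE_if.
by case: eqP => [->|]; rewrite ?numulr0.
Qed.

(** By CK1, multiplying by [E e] on the right cancels the last ghost arrow where it is [E' e] and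
    kills the terms that end in another one. *)
Lemma ghost_deg_mulE u n x e : ghost_deg u n.+1 x -> ghost_deg u n (x ** E e).
Proof.
move=> [S [y [ry hS ->]]]; rewrite ghost_deg_mulE_expr.
apply: (lin_closedD (ghost_deg_lin u n)).
  by apply/real_ghost_deg/real_mulE.
apply: ghost_deg_mulV; rewrite big_seq_cond.
by apply: (lin_closed_sum (ghost_deg_lin u n)) => i /andP[/hS].
Qed.

Lemma ghost_deg_mulG u n x e : ghost_deg u n x -> ghost_deg u n.+1 (x ** E' e).
Proof.
move=> hx; exists [:: (e, x)], 0; split.
- exact: (real_lin u).1.
- by move=> i; rewrite inE => /eqP ->.
- by rewrite big_seq1 add0r.
Qed.

Hypothesis gen_f : generating f.

Lemma ghost_deg_exists u x : exists n, ghost_deg u n (V u ** x).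
Proof.
(* Strengthened to a property of right multiplication by [x], which passes to products. *)
suff h : forall n d, ghost_deg u n d -> exists m, ghost_deg u m (d ** x).
  by apply: (h 0%N); exists [:: (1, [::])]; rewrite big_seq1 scale1r.
apply: (gen_f (P := fun x => forall n d, ghost_deg u n d ->
  exists m, ghost_deg u m (d ** x))) => {x}.
- split; first split.
  + move=> n d _; exists n; rewrite numulr0; exact: (ghost_deg_lin u n).1.
  + move=> c x y hx hy n d hd.
    have [m hm] := hx n d hd; have [m' hm'] := hy n d hd.
    exists (maxn m m'); rewrite numulDr -scale_numulr.
    apply (ghost_deg_lin u _); first exact: ghost_degW (leq_maxl _ _) hm.
    exact: ghost_degW (leq_maxr _ _) hm'.
  + move=> x y hx hy n d hd; have [m hm] := hx n d hd.
    by have [m' hm'] := hy m _ hm; exists m'; rewrite numulA.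
- by move=> v n d hd; exists n; exact: ghost_deg_mulV.
- move=> e n d hd; exists n; apply: ghost_deg_mulE.
  exact: ghost_degW (leqnSn n) hd.
- by move=> e n d hd; exists n.+1; exact: ghost_deg_mulG.
Qed.

(** Replaces a unit: by generation [x] is a finite sum of terms ending in vertices, and the terms
    ending in [w] add up to [x ** V w]. *)
Lemma nonzero_mulV x : x <> 0 -> exists w, x ** V w <> 0.
Proof.
move=> x0; apply: contrapT => h; apply: x0.
have xV w : x ** V w = 0 by apply: contrapT => hw; apply: h; exists w.
have [l xl] : exists l : seq (A * vertex G), x = \sum_(i <- l) i.1 ** V i.2.
  apply: (gen_f (P := fun x => exists l : seq (A * vertex G),
    x = \sum_(i <- l) i.1 ** V i.2)) => {x h xV}.
  - split; first split.
    + by exists [::]; rewrite big_nil.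
    + move=> c x y [l ->] [l' ->].
      exists ([seq (c *: i.1, i.2) | i <- l] ++ l').
      rewrite big_cat big_map /= scaler_sumr; congr (_ + _).
      by apply: eq_bigr => i _; rewrite scale_numull.
    + move=> x y _ [l ->]; exists [seq (x ** i.1, i.2) | i <- l].
      rewrite big_map numul_sumr; apply: eq_bigr => i _; exact: numulA.
  - by move=> v; exists [:: (V v, v)]; rewrite big_seq1 famVV.
  - by move=> e; exists [:: (E e, target e)]; rewrite big_seq1 famEV.
  - by move=> e; exists [:: (E' e, source e)]; rewrite big_seq1 famGV.
rewrite xl (sum_by_label (lab := snd) _ (undup_uniq [seq i.2 | i <- l]));
  last first.
  by apply/allP => i il; rewrite mem_undup; apply/mapP; exists i.
rewrite big1_seq // => w _; rewrite -[RHS](xV w) {1}xl numul_suml big_mkcond.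
by apply: eq_bigr => i _; rewrite -numulA famVV_if; case: eqP => // _;
  rewrite numulr0.
Qed.

Lemma nonzero_Vmul x : x <> 0 -> exists w, V w ** x <> 0.
Proof.
move=> x0; apply: contrapT => h; apply: x0.
have Vx w : V w ** x = 0 by apply: contrapT => hw; apply: h; exists w.
have [l xl] : exists l : seq (A * vertex G), x = \sum_(i <- l) V i.2 ** i.1.
  apply: (gen_f (P := fun x => exists l : seq (A * vertex G),
    x = \sum_(i <- l) V i.2 ** i.1)) => {x h Vx}.
  - split; first split.
    + by exists [::]; rewrite big_nil.
    + move=> c x y [l ->] [l' ->].
      exists ([seq (c *: i.1, i.2) | i <- l] ++ l').
      rewrite big_cat big_map /= scaler_sumr; congr (_ + _).
      by apply: eq_bigr => i _; rewrite scale_numulr.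
    + move=> x y [l ->] _; exists [seq (i.1 ** y, i.2) | i <- l].
      rewrite big_map numul_suml; apply: eq_bigr => i _; exact: esym (numulA _ _ _).
  - by move=> v; exists [:: (V v, v)]; rewrite big_seq1 famVV.
  - by move=> e; exists [:: (E e, source e)]; rewrite big_seq1 famVE.
  - by move=> e; exists [:: (E' e, target e)]; rewrite big_seq1 famVG.
rewrite xl (sum_by_label (lab := snd) _ (undup_uniq [seq i.2 | i <- l]));
  last first.
  by apply/allP => i il; rewrite mem_undup; apply/mapP; exists i.
rewrite big1_seq // => w _; rewrite -[RHS](Vx w) {1}xl numul_sumr big_mkcond.
apply: eq_bigr => i _; rewrite numulA famVV_if eq_sym.
by case: eqP => [->|] //; rewrite numul0r.
Qed.

(* Formally nonzero combinations of paths from [u] to [w]: the value [x] itself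
   may vanish in [A]. *)
Definition formal_nonzero u w (x : A) : Prop :=
  exists (s : seq (seq (arrow G))) (k : seq (arrow G) -> F),
    [/\ s != [::], uniq s,
        forall p, p \in s -> [/\ valid_path u p, path_end u p = w & k p != 0] &
        x = \sum_(p <- s) k p *: path_elt f u p].

Lemma real_formal_nonzero u w x : real_elt u x ->
  x ** V w = 0 \/ formal_nonzero u w (x ** V w).
Proof.
move=> [l ->]; pose k p := \sum_(i <- l | i.2 == p) i.1.
set P := fun p => [&& valid_path u p, path_end u p == w & k p != 0].
pose s := [seq p <- undup [seq i.2 | i <- l] | P p].
have -> : (\sum_(i <- l) i.1 *: path_elt f u i.2) ** V w =
    \sum_(p <- s) k p *: path_elt f u p.
  rewrite (sum_by_label (lab := snd) _ (undup_uniq [seq i.2 | i <- l])); last first.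
    by apply/allP => i il; rewrite mem_undup; apply/mapP; exists i.
  rewrite numul_suml /s big_filter [RHS]big_mkcond; apply: eq_bigr => p _.
  have -> : \sum_(i <- l | i.2 == p) i.1 *: path_elt f u i.2 = k p *: path_elt
    f u p.
    by rewrite /k scaler_suml; apply: eq_bigr => i /eqP ->.
  rewrite -scale_numull path_elt_end /P.
  have [hp|/(path_elt_invalid f) ->] := boolP (valid_path u p) => /=; last first.
    by rewrite if_same scaler0.
  case: eqP => //=; last by rewrite scaler0.
  by case: eqP => //= -> _; rewrite scale0r.
have [->|s0] := eqVneq s [::]; first by left; rewrite big_nil.
right; exists s, k; split=> //; first by rewrite filter_uniq ?undup_uniq.
by move=> p; rewrite mem_filter => /andP[/and3P[? /eqP ? ?] _].
Qed.

Lemma formal_nonzero_mulE u x e :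
  formal_nonzero u (source e) x -> formal_nonzero u (target e) (x ** E e).
Proof.
move=> [s [k [s0 us hs ->]]].
(* Appending [e] is injective, so no terms merge; the old coefficient is read off after removing the
   last arrow. *)
exists [seq rcons p e | p <- s], (fun p => k (take (size p).-1 p)).
have takeK p : take (size (rcons p e)).-1 (rcons p e) = p.
  by rewrite size_rcons -cats1 take_size_cat.
split.
- by case: (s) s0.
- by rewrite map_inj_uniq // => p q /rcons_inj[].
- move=> _ /mapP[p /hs[hp pe kp] ->]; rewrite takeK -cats1.
  by rewrite valid_path_cat path_end_cat hp pe /= eqxx.
- rewrite big_map numul_suml; apply: eq_bigr => p _.
  by rewrite takeK path_elt_rcons scale_numull.
Qed.

(** If some [x ** E e] is nonzero, it has smaller degree. If all vanish, the coefficient of each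
    [E' e] in [x] must be [- y ** E e], where [y] is the real part. So [x ** V w] is [y ** V w]
    minus [y] times the sum of [E e ** E' e] over the finite list [U] of arrows occurring at [w].
    Were [U] nonempty and the list of all arrows from [w], CK2 would give [x ** V w = 0]. *)
Lemma ghost_deg_formal_nonzero u n x : ghost_deg u n x -> x <> 0 ->
  exists w b, formal_nonzero u w (x ** b).
Proof.
elim: n x => [|n IH] x hx x0.
  have [w xw] := nonzero_mulV x0; exists w, (V w).
  by have [] := real_formal_nonzero w hx.
have [w xw] := nonzero_mulV x0.
have [[e xe]|xE0] := pselect (exists e, x ** E e <> 0).
  have [w' [b hb]] := IH _ (ghost_deg_mulE e hx) xe.
  by exists w', (E e ** b); rewrite numulA.
have {}xE0 e : x ** E e = 0 by apply: contrapT => h; apply: xE0; exists e.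
have [S [y [ry hS xE]]] := hx.
pose U := undup [seq i.1 | i <- S & source i.1 == w].
have xwE : x ** V w = y ** V w - y ** (\sum_(e <- U) E e ** E' e).
  rewrite xE numulDl numul_suml; congr (_ + _).
  have -> : \sum_(i <- S) i.2 ** E' i.1 ** V w =
      \sum_(i <- S | source i.1 == w) i.2 ** V (target i.1) ** E' i.1.
    rewrite [RHS]big_mkcond; apply: eq_bigr => i _.
    rewrite -!numulA famVG famGV_if eq_sym; case: eqP => // _; exact: numulr0.
  rewrite -big_filter (sum_by_label (lab := fst) _ (undup_uniq _ : uniq U));
    last first.
    by apply/allP => i iS; rewrite mem_undup; apply/mapP; exists i.
  rewrite numul_sumr -sumrN; apply: eq_big_seq => e.
  rewrite mem_undup => /mapP[i]; rewrite mem_filter => /andP[/eqP iw _] ei.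
  have := xE0 e; rewrite {1}xE ghost_deg_mulE_expr => /eqP.
  rewrite addrC addr_eq0 => /eqP h.
  rewrite numulA -numulNr -h !numul_suml big_filter_cond.
  apply: congr_big => // j.
    by case: (j.1 =P e) => [->|_]; rewrite ?andbF // ei iw eqxx.
  by move=> /andP[_ /eqP ->].
have yw : y ** V w <> 0.
  move=> h; apply: xw; rewrite xwE h.
  rewrite big_seq numul_sumr big1 ?subr0 // => e.
  rewrite mem_undup => /mapP[i]; rewrite mem_filter => /andP[/eqP iw _] ->.
  by rewrite -famVE iw !numulA h !numul0r.
have hyw : formal_nonzero u w (y ** V w) by have [] := real_formal_nonzero w ry.
(* In the first case the value [x ** E e] is 0 in [A], but it is written as a formally nonzero
   combination, which is all that is claimed. *)
have [[e [ew eU]]|allU] := pselect (exists e, source e = w /\ e \notin U).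
  exists (target e), (E e).
  have -> : x ** E e = y ** V w ** E e.
    have -> : x ** E e = x ** V w ** E e by rewrite -numulA -ew famVE.
    rewrite xwE numulrBl -[RHS]subr0; congr (_ - _).
    rewrite numul_sumr numul_suml big1_seq // => e1 /andP[_ e1U].
    rewrite -!numulA famGE_if; case: eqP => [ee|]; last by rewrite !numulr0.
    by rewrite -ee e1U in eU.
  by apply: formal_nonzero_mulE; rewrite ew.
have [U0|U0] := eqVneq U [::].
  by exists w, (V w); rewrite xwE U0 big_nil numulr0 subr0.
case: xw; rewrite xwE -(@famCK2 _ _ _ f w U) ?subrr ?undup_uniq //; first exact/eqP.
move=> e; split=> [|ew]; last by apply: contrapT => /negP h; apply: allU; exists e.
by rewrite mem_undup => /mapP[i]; rewrite mem_filter => /andP[/eqP iw _] ->.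
Qed.

(** Multiply on the left by the ghost of a shortest path [p] of the combination: a path that does
    not extend [p] is killed, one that does leaves a closed path at [w], and [p] itself leaves the
    vertex. *)
Lemma formal_nonzero_const u w x : formal_nonzero u w x ->
  exists (a : A) (k : F) (l : seq (F * seq (arrow G))),
    [/\ k != 0, forall i, i \in l -> closed_path w i.2 /\ i.2 != [::] &
        a ** x = k *: V w + \sum_(i <- l) i.1 *: path_elt f w i.2].
Proof.
move=> [s [k [s0 us hs ->]]].
have [p ps pmin] : exists2 p, p \in s & forall q, q \in s -> (size p <= size q)%N.
  have ex : exists n, [exists i : 'I_(size s), size (nth [::] s i) == n].
    case: (s) s0 => // p s' _; exists (size p).
    by apply/existsP; exists ord0.
  case: (ex_minnP ex) => n /existsP[i /eqP ni] nmin.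
  exists (nth [::] s i) => [|q qs]; first by rewrite mem_nth.
  rewrite ni; apply: nmin; apply/existsP.
  have iq : (index q s < size s)%N by rewrite index_mem.
  by exists (Ordinal iq); rewrite nth_index.
have [hp pw kp] := hs p ps.
exists (ghost_elt f u p), (k p),
  [seq (k q, drop (size p) q) | q <- s & (q != p) && prefix p q].
have dropP q : prefix p q -> q = p ++ drop (size p) q.
  by move=> /prefixP[r ->]; rewrite drop_size_cat.
split=> //.
- move=> _ /mapP[q] /[!mem_filter] /andP[/andP[qp pq] qs] -> /=.
  have := hs q qs; rewrite {1 2}(dropP q pq) valid_path_cat path_end_cat pw.
  move=> [/andP[_ h1] h2 _]; rewrite /closed_path h1 h2 eqxx; split=> //.
  by apply: contraNN qp => /eqP h; rewrite (dropP q pq) h cats0.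
- rewrite numul_sumr (bigD1_seq p) //= -scale_numulr ghost_path // pw.
  congr (_ + _); rewrite big_map big_filter big_mkcondr.
  rewrite [LHS]big_seq_cond [RHS]big_seq_cond; apply: eq_bigr => q /andP[qs qp].
  rewrite -scale_numulr; case: ifP => [pq|/negbT pq].
    by rewrite [in path_elt _ _ q](dropP q pq) ghost_path_cat // pw.
  rewrite ghost_path0 ?scaler0 //; apply: contra pq => /prefixP[r pr].
  have := pmin q qs; rewrite pr size_cat -{2}[size q]addn0 leq_add2l leqn0.
  by move=> /eqP /size0nil ->; rewrite cats0 prefix_refl.
Qed.

(** The path [g] runs [n] times round [c] and then leaves it by [e']. For a nonzero product [g]
    would have to be a prefix of [q ++ g]; by its length [q] would then be a positive power of [c],
    and comparing the arrows after [n] rounds and [c1] would give [e' = e]. *)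
Lemma min_closed_exit_kill w c c1 c2 e e' n q :
  min_closed w c -> c = c1 ++ e :: c2 -> source e' = source e -> e' != e ->
  closed_path w q -> q != [::] -> (size q <= n)%N ->
  let g := path_pow n c ++ rcons c1 e' in
  ghost_elt f w g ** path_elt f w q ** path_elt f w g = 0.
Proof.
move=> hc cE se e'e clq q0 qn g.
have [clc c0 _] := hc.
have -> : path_elt f w g = path_elt f (path_end w q) g.
  by case/andP: clq => _ /eqP ->.
rewrite -numulA -path_elt_cat; apply: ghost_path0; last first.
  apply/negP => /size_prefix; rewrite (size_cat q g) -{2}[size g]add0n.
  by rewrite leq_add2r leqn0 size_eq0 (negPf q0).
apply/negP => pg.
have [j qj] : exists j, q = path_pow j c.
  apply: (min_closed_pow (n := n) hc) => //.
  have qn' : (size q <= size (path_pow n c))%N.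
    by rewrite size_path_pow (leq_trans qn) // leq_pmulr // lt0n size_eq0.
  move: pg => /prefixP[r]; rewrite /g -!catA => /(congr1 (take (size q))).
  rewrite [take _ (q ++ _)]take_size_cat // takel_cat // => qe.
  by rewrite [X in prefix X _]qe prefix_take.
have j0 : j = j.-1.+1 by case: j qj q0 => // ->.
move: pg; rewrite /g qj [path_pow j c ++ _]catA path_powC -!catA.
move=> /prefixP[r]; rewrite -!catA => /eqP.
rewrite eqseq_cat // eqxx andTb j0 path_powS {1}cE -cats1 -!catA.
rewrite eqseq_cat // eqxx /= => /eqP[ee _].
by rewrite ee eqxx in e'e.
Qed.

Theorem reduction x : x <> 0 ->
  exists a b : A,
    (exists v (k : F), k != 0 /\ a ** x ** b = k *: V v) \/
    (exists v c (p : {poly F}), [/\ min_closed v c, no_exit c, p != 0 &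
       a ** x ** b = corner_eval (V v) (path_elt f v c) p]).
Proof.
move=> x0; have [u ux] := nonzero_Vmul x0.
have [n hn] := ghost_deg_exists u x.
have [w [b hb]] := ghost_deg_formal_nonzero hn ux.
have [a [k [l [k0 hl axb]]]] := formal_nonzero_const hb.
rewrite !numulA in axb.
have [[c hc]|noc] := pselect (exists c, min_closed w c); last first.
  exists (a ** V u), b; left; exists w, k; split=> //.
  rewrite axb big1_seq ?addr0 // => i /andP[_ /hl[h1 h2]].
  by case: noc; exact: min_closed_exists h1 h2.
have [clc c0 cmin] := hc.
have [ne|] := pselect (no_exit c).
  exists (a ** V u), b; right.
  have hj i : exists j, i \in l -> i.2 = path_pow j.+1 c.
    have [il|] := boolP (i \in l); last by exists 0%N.
    have [cli i0] := hl i il.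
    have [m hm] : exists m, prefix i.2 (path_pow m c).
      by apply: (no_exit_prefix clc) => //; case/andP: cli.
    have [[|j] ij] := min_closed_pow hc cli hm; first by rewrite ij in i0.
    by exists j.
  have [j {}hj] := choice hj.
  (* The exponents are positive because the paths in [l] are nonempty; so [k] stays the constant
     term and the polynomial is nonzero. *)
  exists w, c, (k%:P + \sum_(i <- l) i.1 *: 'X^((j i).+1)); split=> //.
    apply/eqP => /(congr1 (fun p : {poly F} => p`_0)).
    rewrite coefD coefC coef_sum /= big1 ?addr0 => [/eqP|i _]; last first.
      by rewrite coefZ coefXn mulr0.
    by rewrite coef0 (negPf k0).
  rewrite axb corner_evalD corner_eval_sum; congr (_ + _).
    by rewrite -[k%:P]mulr1 mul_polyC corner_evalZ -(expr0 'X) corner_evalXn.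
  apply: eq_big_seq => i il; rewrite corner_evalZ corner_evalXn -path_elt_pow //.
  by rewrite -hj.
move=> /existsNP[e /not_implyP[ec /existsNP[e' /not_implyP[se /eqP ee]]]].
have [c1 [c2 cE]] : exists c1 c2, c = c1 ++ e :: c2.
  by case/splitPr: ec => c1 c2; exists c1, c2.
(* Large enough for a single [g] to kill all closed paths in [l] at once. *)
pose n0 := \max_(i <- l) size i.2.
pose g := path_pow n0 c ++ rcons c1 e'.
have vg : valid_path w g.
  have /andP[h1 /eqP h2] := closed_path_pow n0 clc.
  rewrite valid_path_cat h1 h2 -cats1 valid_path_cat.
  move: clc; rewrite /closed_path cE valid_path_cat => /andP[/andP[-> /=
    /andP[h _]] _].
  by rewrite se h.
exists (ghost_elt f w g ** (a ** V u)), (b ** path_elt f w g); left.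
exists (path_end w g), k; split=> //.
have -> : ghost_elt f w g ** (a ** V u) ** x ** (b ** path_elt f w g) =
    ghost_elt f w g ** (a ** V u ** x ** b) ** path_elt f w g by rewrite !numulA.
rewrite axb numulDr numulDl -scale_numulr -scale_numull -ghost_elt_V.
rewrite ghost_path // numul_sumr numul_suml big1_seq ?addr0 // => i /andP[_ il].
have [cli i0] := hl i il.
rewrite -scale_numulr -scale_numull (min_closed_exit_kill hc cE se) ?scaler0 //.
exact: leq_bigmax_seq.
Qed.

End Reduction.

(** * Semiprimitivity *)

Section NonunitalModules.
Variables (R : nuRingType) (M : nuLeftModule R).
Implicit Types (a b : R) (m n : M).

Lemma nuact0l m : nuact 0 m = 0.
Proof. by apply: (addrI (nuact 0 m)); rewrite -nuactDl !addr0. Qed.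
Lemma nuact0r a : nuact a (0 : M) = 0.
Proof. by apply: (addrI (nuact a 0)); rewrite -nuactDr !addr0. Qed.
Lemma nuactNl a m : nuact (- a) m = - nuact a m.
Proof. by apply/eqP; rewrite -addr_eq0 -nuactDl addNr nuact0l. Qed.
Lemma nuactNr a m : nuact a (- m) = - nuact a m.
Proof. by apply/eqP; rewrite -addr_eq0 -nuactDr addNr nuact0r. Qed.
Lemma nuactBl a b m : nuact (a - b) m = nuact a m - nuact b m.
Proof. by rewrite nuactDl nuactNl. Qed.
Lemma nuactBr a m n : nuact a (m - n) = nuact a m - nuact a n.
Proof. by rewrite nuactDr nuactNr. Qed.
Lemma nuact_suml I (s : seq I) (f : I -> R) m :
  nuact (\sum_(i <- s) f i) m = \sum_(i <- s) nuact (f i) m.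
Proof. exact: (big_morph (fun a => nuact a m) (fun a b => nuactDl a b m)
  (nuact0l m)). Qed.

End NonunitalModules.

Record left_ideal (R : nuRingType) := LeftIdeal {
  left_ideal_set :> R -> Prop;
  left_ideal0 : left_ideal_set 0;
  left_idealB : forall x y,
    left_ideal_set x -> left_ideal_set y -> left_ideal_set (x - y);
  left_idealM : forall a x, left_ideal_set x -> left_ideal_set (a ** x) }.

Section QuotientModule.
Variables (R : nuRingType) (N : left_ideal R).

Definition left_ideal_pred : {pred R} := fun x => `[< N x >].

Lemma left_ideal_zmod_closed : zmod_closed left_ideal_pred.
Proof.
split=> [|x y /asboolP Nx /asboolP Ny]; apply/asboolP.
  exact: left_ideal0.
exact: left_idealB.
Qed.

HB.instance Definition _ := GRing.isZmodClosed.Build R left_ideal_pred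
  left_ideal_zmod_closed.

Local Notation Q := (Quotient.quot left_ideal_pred).

Lemma left_quot_eqP (x y : R) : N (x - y) <-> \pi_Q x = \pi_Q y.
Proof.
by split=> [h|/eqP]; [apply/eqP|]; rewrite -Quotient.idealrBE;
  [apply/asboolP|move/asboolP].
Qed.

Definition quot_act (a : R) (m : Q) : Q := \pi_Q (a ** repr m).

Lemma quot_act_pi a x : quot_act a (\pi_Q x) = \pi_Q (a ** x).
Proof.
apply/left_quot_eqP; rewrite -numulrBr; apply: left_idealM.
by apply/left_quot_eqP; rewrite reprK.
Qed.

Lemma quot_actA a b m : quot_act (a ** b) m = quot_act a (quot_act b m).
Proof. by rewrite -[m]reprK (quot_act_pi b) !quot_act_pi numulA. Qed.

Lemma left_quot_piD x y : (\pi_Q (x + y) : Q) = \pi_Q x + \pi_Q y.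
Proof. exact: Quotient.pi_add. Qed.

Lemma left_quot_pi0 : (\pi_Q 0 : Q) = 0.
Proof. by apply: (addrI (\pi_Q 0 : Q)); rewrite -left_quot_piD !addr0. Qed.

Lemma quot_actDl a b m : quot_act (a + b) m = quot_act a m + quot_act b m.
Proof. by rewrite -[m]reprK !quot_act_pi numulDl left_quot_piD. Qed.

Lemma quot_actDr a m n : quot_act a (m + n) = quot_act a m + quot_act a n.
Proof.
by rewrite -[m]reprK -[n]reprK -left_quot_piD !quot_act_pi numulDr left_quot_piD.
Qed.

Definition quot_module : nuLeftModule R := NuLeftModule quot_actA quot_actDl
  quot_actDr.

End QuotientModule.

(* Zorn's lemma, applied to the left ideals that contain the annihilator of [m]
   but not [w]. *)
Lemma simple_module_exists (R : nuRingType) (W : nuLeftModule R) (m : W) (w : R) :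
  nuact w m = m -> m <> 0 ->
  exists (M : nuLeftModule R) (m' : M),
    [/\ simple_module M, m' <> 0, nuact w m' = m' &
        forall r, nuact r m = 0 -> nuact r m' = 0].
Proof.
move=> wm m0.
pose ann : set R := [set r | nuact r m = 0]%classic.
pose isleft (N : set R) := [/\ N 0, forall x y, N x -> N y -> N (x - y) &
                               forall a x, N x -> N (a ** x)].
(* [ann] is joined to [N] because the empty chain has empty union, which is no left ideal. *)
pose P (N : set R) := isleft (ann `|` N)%classic /\ ~ (ann `|` N)%classic w.
have [F0 FP totF|N [[[N0 NB NM] Nw] Nmax]] := @Zorn_bigcup R P.
  split; first split.
  - by left; exact: nuact0l.
  - move=> x y hx hy.
    have sub X : F0 X -> forall z, (ann `|` X)%classic z ->
        (ann `|` \bigcup_(X in F0) X)%classic z.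
      by move=> FX z [?|Xz]; [left|right; exists X].
    case: hx hy => [ax|[X FX Xx]] [ay|[Y FY Yy]].
    + by left; rewrite /ann /= nuactBl ax ay subrr.
    + by apply: (sub Y FY); have [[_ h _] _] := FP _ FY; apply: h; [left|right].
    + by apply: (sub X FX); have [[_ h _] _] := FP _ FX; apply: h; [right|left].
    + have [XY|YX] := totF _ _ FX FY.
        apply: (sub Y FY); have [[_ h _] _] := FP _ FY; apply: h; right => //.
        exact: XY.
      apply: (sub X FX); have [[_ h _] _] := FP _ FX; apply: h; right => //.
      exact: YX.
  - move=> a x [ax|[X FX Xx]]; first by left; rewrite /ann /= nuactA ax nuact0r.
    have [[_ _ h] _] := FP _ FX.
    by have [|hX] := h a x (or_intror Xx); [left|right; exists X].
  - move=> [aw|[X FX Xw]]; first by apply: m0; rewrite -wm.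
    by have [_] := FP _ FX; apply; right.
pose I := LeftIdeal N0 NB NM.
pose pi (r : R) : quot_module I := \pi r.
have piM a r : nuact a (pi r) = pi (a ** r) by exact: quot_act_pi.
have pi0 r : pi r = 0 <-> I r.
  split=> [h|Ir].
    by rewrite -[r]subr0; apply/left_quot_eqP; rewrite left_quot_pi0.
  by rewrite -left_quot_pi0; apply/left_quot_eqP; rewrite subr0.
have piB x y : pi (x - y) = pi x - pi y.
  by apply: (addIr (pi y)); rewrite -left_quot_piD !subrK.
(* [r ** w - r] kills [m]: modulo the ideal, [w] is a right unit, so that [pi w] generates the
   quotient. *)
have piw r : pi (r ** w) = pi r.
  apply/left_quot_eqP; left.
  by rewrite /ann /= nuactBl nuactA wm subrr.
have w0 : pi w <> 0 by move/pi0.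
exists (quot_module I), (pi w); split=> //.
- split; first by exists w, (pi w); rewrite piM piw.
  move=> K [K0 KB KM].
  have [K00|] := pselect (K `<=` [set 0])%classic.
    by left; apply/seteqP; split=> // x ->.
  move=> /existsNP[x /not_implyP[Kx x0]]; right.
  pose B : set R := [set r | K (pi r)]%classic.
  have IB r : I r -> B r by move=> /pi0 h; rewrite /B /= h.
  have Bw : B w.
    apply: contrapT => Bw; apply: (Nmax B).
      split=> [r Nr|h]; first by apply: IB; right.
      apply: x0; rewrite -[x]reprK; apply/pi0; right; apply: h.
      by rewrite /B /pi /= reprK.
    have annB : (ann `|` B)%classic = B.
      by apply/seteqP; split=> [r [ar|//]|r Br]; [apply: IB; left|right].
    split; rewrite annB //; split.
    - by rewrite /B /= (_ : pi 0 = 0) //; apply/pi0.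
    - by move=> r s Br Bs; rewrite /B /= piB; exact: KB.
    - by move=> a r Br; rewrite /B /= -piM; exact: KM.
  apply/seteqP; split=> // y _.
  by rewrite -[y]reprK -/(pi _) -piw -piM; exact: KM.
- by rewrite piM piw.
- move=> r rm; rewrite piM piw; apply/pi0; by left.
Qed.

(** * Weighted representations on a branching system *)

Section Representation.
Variables (F : fieldType) (G : digraph) (a : arrow G -> F).
Hypothesis a0 : forall e, a e != 0.
Implicit Types (v : vertex G) (e : arrow G).

Local Notation K := (seq (arrow G) * nat)%type.

Definition enumerates v (es : seq (arrow G)) : Prop :=
  [/\ uniq es, es <> [::] & forall e, e \in es <-> source e = v].

Definition out_arrows v : seq (arrow G) :=
  if pselect (exists es, enumerates v es) is left h then projT1 (cid h) else [::].

Lemma out_arrowsP v es : enumerates v es -> enumerates v (out_arrows v).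
Proof.
move=> h; rewrite /out_arrows; case: pselect => [h'|[]]; last by exists es.
exact: (projT2 (cid h')).
Qed.

Lemma out_arrows_enum v : out_arrows v != [::] -> enumerates v (out_arrows v).
Proof.
by rewrite /out_arrows; case: pselect => // h _; exact: (projT2 (cid h)).
Qed.

(* The copies [v * K] of [K] form a branching system: [k |-> enc e k] embeds the
   copy at [target e] into the copy at [source e], with disjoint images, which
   cover the copy at [v] when [v] emits a finite nonempty set of arrows. *)
Definition enc e (k : K) : K :=
  let s := out_arrows (source e) in
  if s is [::] then (e :: k.1, k.2) else (k.1, k.2 * size s + index e s)%N.

Definition dec v (k : K) : option (arrow G * K) :=
  match out_arrows v with
  | [::] =>
    if k.1 is e :: p then
      if source e == v then Some (e, (p, k.2)) else None
    else None
  | e0 :: s' =>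
    let s := e0 :: s' in
    Some (nth e0 s (k.2 %% size s), (k.1, k.2 %/ size s)%N)
  end.

Lemma enc_dec e k : dec (source e) (enc e k) = Some (e, k).
Proof.
rewrite /dec /enc; have h := @out_arrows_enum (source e).
case: (out_arrows (source e)) h => [_|e0 s h] /=; first by rewrite eqxx; case: k.
have [_ _ /(_ e)[_ /(_ erefl) es]] := h isT.
have lt_i : (index e (e0 :: s) < (size s).+1)%N by rewrite -[(size s).+1]/(size
  (e0 :: s)) index_mem.
rewrite modnMDl modn_small // divnMDl // divn_small // addn0.
by rewrite -[X in Some (X, _)]/(nth e0 (e0 :: s) (index e (e0 :: s))) nth_index
  //; case: k.
Qed.

Lemma dec_enc v k e k' : dec v k = Some (e, k') -> source e = v /\ enc e k' = k.
Proof.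
rewrite /dec; move: (@out_arrows_enum v).
case outE: (out_arrows v) => [|e0 s] h.
  case: k => -[//|e1 p] n /=; case: eqP => // sv [<- <-]; split=> //.
  by rewrite /enc sv outE.
have [us _ hs] := h isT.
set e1 := nth _ _ _ => -[<- <-].
have lt_i : (k.2 %% size (e0 :: s) < size (e0 :: s))%N by rewrite ltn_mod.
have sv : source e1 = v by apply/hs; exact: mem_nth.
split=> //; rewrite /enc sv outE /e1 index_uniq // -divn_eq.
by case: (k).
Qed.

Lemma dec_regular v k es : enumerates v es -> dec v k <> None.
Proof.
by move=> /out_arrowsP[_ + _]; rewrite /dec; case: (out_arrows v).
Qed.

Lemma dec_noexit e k : (forall e', source e' = source e -> e' = e) ->
  exists k', dec (source e) k = Some (e, k').
Proof.
move=> ne; have := @dec_regular (source e) k [:: e].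
case d: (dec _ _) => [[e' k']|] h; last first.
  by case: h => //; split=> // e'; rewrite inE; split=> [/eqP ->|/ne ->].
by have [/ne <- _] := dec_enc d; exists k'.
Qed.

Local Notation W := (vertex G * K -> F^o).

Definition rep_gen (g : lpa_gen G) (m : W) : W :=
  match g with
  | Vertex v => fun x => if x.1 == v then m x else 0
  | Arrow e => fun x =>
    if dec x.1 x.2 is Some (e', k') then
      if e' == e then a e * m (target e, k') else 0
    else 0
  | Ghost e => fun x =>
    if x.1 == target e then (a e)^-1 * m (source e, enc e x.2) else 0
  end.

Lemma rep_gen_lin g (c : F) (m n : W) :
  rep_gen g (c *: m + n) = c *: rep_gen g m + rep_gen g n.
Proof.
apply/funext => -[v k]; rewrite !fctE; case: g => [w|e|e] /=.
- by case: eqP => // _; rewrite scaler0 addr0.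
- case: (dec v k) => [[e' k']|]; last by rewrite scaler0 addr0.
  case: eqP => _; last by rewrite scaler0 addr0.
  by rewrite mulrDr -![_ *: _]/(_ * _) mulrCA.
- case: eqP => _; last by rewrite scaler0 addr0.
  by rewrite mulrDr -![_ *: _]/(_ * _) mulrCA.
Qed.

Local Notation act := (term_act rep_gen).

Lemma rep_gen_rel (t u : alg_term F (lpa_gen G)) :
  leavitt_rel t u -> act t =1 act u.
Proof.
case=> {t u} /=.
- by move=> v m; apply/funext => x /=; case: eqP.
- by move=> v w vw m; apply/funext => x /=; case: eqP => // ->; case: eqP.
- move=> e m; apply/funext => -[v k] /=; case: eqP => // sv.
  case d: (dec v k) => [[e' k']|] //; case: eqP => // ee.
  by have [] := dec_enc d; rewrite ee => /esym.
- by move=> e m; apply/funext => -[v k] /=; rewrite eqxx.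
- by move=> e m; apply/funext => -[v k] /=; case: eqP.
- by move=> e m; apply/funext => -[v k] /=; rewrite eqxx.
- move=> e m; apply/funext => -[v k] /=; case: eqP => // ->.
  by rewrite enc_dec eqxx mulKf.
- move=> e e' ee m; apply/funext => -[v k] /=; case: eqP => // _.
  by rewrite enc_dec; case: eqP => // _; rewrite mulr0.
- move=> v es /uniqP_NoDup ues es0 hes m; apply/funext => -[w k] /=.
  have enum : enumerates v es by split=> // e; rewrite -hes; split=> /inP.
  have -> : act (foldr (@TAdd _ _) TZero
      [seq TMul (TGen (Arrow e)) (TGen (Ghost e)) | e <- es]) m (w, k) =
      \sum_(e <- es) rep_gen (Arrow e) (rep_gen (Ghost e) m) (w, k).
    elim: (es) => [|e es' IH]; first by rewrite big_nil.
    by rewrite big_cons -IH.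
  rewrite /=; case: eqP => [->|wv].
    case d: (dec v k) => [[e' k']|]; last by have := dec_regular enum d.
    have [se ek] := dec_enc d.
    have e'es : e' \in es by case: enum => _ _ h; apply/h.
    rewrite (bigD1_seq e') //= eqxx eqxx mulVKf // ek se big1 ?addr0 // => e.
    by rewrite eq_sym => /negPf ->.
  rewrite big1_seq // => e /andP[_ ees].
  case d: (dec w k) => [[e' k']|] //; case: eqP => // ee.
  have [se _] := dec_enc d; case: wv; rewrite -se ee.
  by case: enum => _ _ h; apply/h.
Qed.

Definition rep : nuLeftModule (lpa F G) := pres_module rep_gen_lin rep_gen_rel.

Local Notation f := (lpa_family F G).

Definition rep_vec v : rep := fun x => if x.1 == v then 1 else 0.

Lemma rep_actZ (c : F) x (m : rep) :
  nuact (c *: x) m = (c *: (nuact x m : W) : W).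
Proof. exact: (pres_actZ rep_gen_lin rep_gen_rel). Qed.

Lemma rep_act_gen g (m : rep) : nuact (lpa_gen_elt F g : lpa F G) m = rep_gen g m.
Proof. exact: (pres_act_pi rep_gen_lin rep_gen_rel (TGen g)). Qed.

Lemma rep_vec_neq0 v : rep_vec v <> 0.
Proof.
move=> /(congr1 (fun m : rep => m (v, ([::], 0%N)))) /=.
by rewrite /rep_vec /= eqxx => /eqP; rewrite oner_eq0.
Qed.

Lemma rep_vecV v : nuact (famV f v) (rep_vec v) = rep_vec v.
Proof.
by rewrite rep_act_gen; apply/funext => x /=; rewrite /rep_vec; case: eqP.
Qed.

(** A single arrow at a vertex covers its whole copy of [K], so the constant 1 is carried to the
    constant [a e]. *)
Lemma rep_vecE e : (forall e', source e' = source e -> e' = e) ->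
  nuact (famE f e) (rep_vec (target e)) = (a e *: (rep_vec (source e) : W) : W).
Proof.
move=> ne; rewrite rep_act_gen; apply/funext => -[v k] /=.
rewrite fctE /rep_vec /= eqxx; case: (v =P source e) => [->|vs].
  by have [k' ->] := dec_noexit k ne; rewrite eqxx.
case d: (dec v k) => [[e' k']|]; last by rewrite scaler0.
case: eqP => [ee|]; last by rewrite scaler0.
by have [] := dec_enc d; rewrite ee => /esym.
Qed.

(** The scalar is attached to the vertex because a [nuLeftModule] has no scalars; in this form the
    relation passes to other modules. *)
Lemma rep_vec_path v p : valid_path v p -> no_exit p ->
  nuact (path_elt f v p) (rep_vec (path_end v p)) =
  nuact ((\prod_(e <- p) a e) *: famV f v) (rep_vec v).
Proof.
elim: p v => [|e p IH] v; first by move=> _ _; rewrite big_nil scale1r.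
case/andP=> /eqP <- hp ne.
rewrite path_elt_cons nuactA -[path_end _ _]/(path_end (target e) p) IH //;
  last first.
  by move=> e' h; apply: ne; rewrite inE h orbT.
rewrite -nuactA -scale_numulr famEV rep_actZ rep_vecE; last first.
  by apply: ne; exact: mem_head.
by rewrite rep_actZ rep_vecV big_cons scalerA mulrC.
Qed.

End Representation.

Section Semiprimitivity.
Variables (F : closedFieldType) (G : digraph).
Local Notation L := (lpa F G).
Local Notation f := (lpa_family F G).

(** A second occurrence of [e] would close up a shorter path. Hence a weight on the first arrow
    counts once per round. *)
Lemma min_closed_head_notin (v : vertex G) e p :
  min_closed v (e :: p) -> e \notin p.
Proof.
move=> [/andP[+ /eqP pe] _ cmin]; apply: contraTN => ep.
case/splitPr: ep pe cmin => p1 p2 pe cmin.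
apply/negP => /= /andP[/eqP se];
  rewrite valid_path_cat => /andP[h1 /= /andP[/eqP h2 _]].
have := cmin (e :: p1); rewrite /closed_path /= se eqxx h1 -[path_end _
  _]/(path_end (target e) p1).
rewrite -h2 se eqxx => /(_ isT isT).
by rewrite ltnS size_cat /= -[X in (_ <= X)%N -> _]addn0 leq_add2l.
Qed.

Lemma jacobsonM (R : nuRingType) (a x b : R) :
  jacobson_radical R x -> jacobson_radical R (a ** x ** b).
Proof.
by move=> jx M sM m; rewrite !nuactA jx // nuact0r.
Qed.

Lemma lpa_jacobson_scaleV (v : vertex G) (k : F) :
  k != 0 -> ~ jacobson_radical L (k *: famV f v).
Proof.
move=> k0 jv; pose W := rep (a := fun=> 1 : F) (fun e : arrow G => oner_neq0 F).
have [M [m [sM m0 vm _]]] :=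
  @simple_module_exists _ W _ (famV f v) (rep_vecV _ v) (@rep_vec_neq0 _ _ _ _ v).
apply: m0; rewrite -vm -[famV f v]scale1r -(mulVf k0) -scalerA -famVV.
by rewrite scale_numulr scale_numull nuactA jv // nuact0r.
Qed.

Lemma lpa_jacobson_eval (v : vertex G) c (p : {poly F}) :
  min_closed v c -> no_exit c -> p != 0 ->
  ~ jacobson_radical L (corner_eval (famV f v) (path_elt f v c) p).
Proof.
move=> hc ne p0 jp; have [clc c0 _] := hc.
(* The factor ['X] excludes [r = 0], since weights have to be invertible. *)
have [r /negP rP] : exists r, ~~ root ('X * p) r.
  by apply/closed_nonrootP; rewrite mulf_neq0 ?polyX_eq0.
have r0 : r != 0 by apply: contra_notN rP => /eqP ->;
  rewrite rootE hornerM hornerX mul0r.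
have pr : p.[r] != 0.
  by apply: contra_notN rP => /eqP pr; rewrite rootE hornerM pr mulr0.
have [e [q cE]] : exists e q, c = e :: q.
  by case: (c) c0 => // e q _; exists e, q.
have eq : e \notin q by move: hc; rewrite cE; exact: min_closed_head_notin.
(* With weight [r] on the first arrow only, the weights along [c] multiply to [r]. *)
pose a e' := if e' == e then r else 1.
have a0 e1 : a e1 != 0.
  by rewrite /a; case: (e1 =P e) => _; [|exact: oner_neq0].
have prod_a : \prod_(e' <- c) a e' = r.
  rewrite cE big_cons {1}/a eqxx big1_seq ?mulr1 // => e' /andP[_ e'q].
  by rewrite /a; case: eqP => // ee; rewrite -ee e'q in eq.
pose C := path_elt f v c; pose V := famV f v.
have [M [m [sM m0 vm annm]]] :=
  @simple_module_exists _ (rep a0) _ V (rep_vecV a0 v) (@rep_vec_neq0 _ _ _ a0 v).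
(* [C - r *: V] annihilates [rep_vec v], hence also [m]. *)
have Cm : nuact C m = nuact (r *: V) m.
  apply/eqP; rewrite -subr_eq0 -nuactBl; apply/eqP/annm.
  rewrite nuactBl; have /andP[vc /eqP ec] := clc.
  by have := rep_vec_path a0 vc ne; rewrite ec prod_a => ->; rewrite subrr.
have powm n : nuact (corner_pow V C n) m = nuact (r ^+ n *: V) m.
  elim: n => [|n IH]; first by rewrite expr0 scale1r.
  rewrite corner_powS nuactA IH -nuactA -scale_numulr closed_path_eltV //.
  rewrite -/C {1}[C]path_elt_V scale_numull nuactA Cm -nuactA.
  by rewrite -scale_numulr -scale_numull famVV scalerA exprS.
have evalm : nuact (corner_eval V C p) m = nuact (p.[r] *: V) m.
  rewrite /corner_eval nuact_suml horner_coef scaler_suml nuact_suml.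
  apply: eq_bigr => i _.
  rewrite -[corner_pow V C i](corner_vpow (famVV _ _)); last exact/esym/path_elt_V.
  by rewrite scale_numull nuactA powm -nuactA -scale_numull -scale_numulr famVV
    scalerA.
apply: m0; rewrite -vm (_ : V = (p.[r]^-1 *: V) ** (p.[r] *: V)).
  by rewrite nuactA -evalm jp // nuact0r.
by rewrite -scale_numulr -scale_numull famVV scalerA mulfV // scale1r.
Qed.

Theorem lpa_semiprimitive : semiprimitive L.
Proof.
apply/seteqP; split=> [x jx|_ -> M _ m]; last exact: nuact0l.
apply: contrapT => /(reduction (@lpa_family_generating F G)) [a [b hab]].
have := jacobsonM a b jx; case: hab => [[v [k [k0 ->]]]|[v [c [p [hc ne p0 ->]]]]].
  exact: lpa_jacobson_scaleV.
exact: lpa_jacobson_eval.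
Qed.

End Semiprimitivity.

Lemma semiprimitive_iso (F : fieldType) (A B : nuAlgType F) :
  nualg_isomorphic A B -> semiprimitive B -> semiprimitive A.
Proof.
move=> [f [fM [g fK gK]]] jB.
have gM x y : g (x ** y) = g x ** g y by apply: (can_inj fK); rewrite fM !gK.
have gD x y : g (x + y) = g x + g y by apply: (can_inj fK); rewrite raddfD /= !gK.
apply/seteqP; split=> [a ja|_ -> M _ m]; last exact: nuact0l.
suff : jacobson_radical B (f a).
  by rewrite jB => fa0; apply: (can_inj fK); rewrite fa0 raddf0.
move=> M [[b [m bm]] sM] n.
have actA x y (k : M) : nuact (f (x ** y)) k = nuact (f x) (nuact (f y) k).
  by rewrite fM nuactA.
have actDl x y (k : M) : nuact (f (x + y)) k = nuact (f x) k + nuact (f y) k.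
  by rewrite raddfD nuactDl.
have actDr x (k l : M) : nuact (f x) (k + l) = nuact (f x) k + nuact (f x) l.
  exact: nuactDr.
apply: (ja (NuLeftModule actA actDl actDr)).
split; first by exists (g b), m; rewrite /= gK.
move=> N [N0 NB NM]; apply: sM; split=> // x k /(NM (g x)).
by rewrite /= gK.
Qed.

(** If an element [y] of a nil ideal moved a vector [n] of a simple module to a nonzero one, then
    [n = r y n] for some [r], although [r ** y] is nilpotent. *)
Lemma semiprimitive_reduced (R : nuRingType) : semiprimitive R -> reduced R.
Proof.
move=> jR; apply/seteqP; split=> [x [s [-> hs]]|_ ->]; last first.
  by exists [::]; rewrite big_nil.
suff js y : y \in s -> y = 0 by rewrite /= big1_seq // => y /andP[_ /js].
move=> /hs [I [[I0 IB IMl IMr] nilI] Iy].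
suff : jacobson_radical R y by rewrite jR.
move=> M [[a [m am]] sM] n; apply: contrapT => yn.
(* Without a unit, a nonzero vector might generate only 0; the vectors killed by [R] form a
   submodule, which is proper because [R] acts nontrivially. *)
have zero_ann (k : M) : (forall r : R, nuact r k = 0) -> k = 0.
  pose N := [set k : M | forall r : R, nuact r k = 0]%classic.
  have [|N0|NT] := sM N.
  - split=> [r|k' l hk' hl r|r k' hk' s']; first exact: nuact0r.
      by rewrite nuactBr hk' hl subrr.
    by rewrite -nuactA hk'.
  - by move=> hk; have : N k by []; rewrite N0.
  - by case: am; have : N m by rewrite NT.
pose N := [set k : M | exists r : R, k = nuact r (nuact y n)]%classic.
have NT : N = setT.
  have [|N0|//] := sM N.
    split=> [|_ _ [r ->] [s' ->]|r _ [s' ->]].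
    - by exists 0; rewrite nuact0l.
    - by exists (r - s'); rewrite nuactBl.
    - by exists (r ** s'); rewrite nuactA.
  case: yn; apply: zero_ann => r.
  by have : N (nuact r (nuact y n)) by [exists r]; rewrite N0.
have [r nr] : N n by rewrite NT.
have fix_n : nuact (r ** y) n = n by rewrite nuactA -nr.
have [k] := nilI _ (IMl r y Iy).
have fix_iter : nuact (iter k (numul (r ** y)) (r ** y)) n = n.
  by elim: k => [|k IH] //=; rewrite nuactA IH.
by move=> it0; apply: yn; rewrite -fix_iter it0 nuact0l nuact0r.
Qed.

(** * Splitting the vertices of a digraph *)

(* Each vertex [v] is split into the nonzero idempotents among [eps v i]; an
   arrow [e] that is kept gives one arrow for each component of its target, all
   of them starting at component 0 of its source; a vertex satisfying [ext] emits
   instead one arrow [S v i] from each of its components to that of [r v]. *)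
Section Refinement.
Variables (F : fieldType) (A : nuAlgType F) (G : digraph).
Variable f : leavitt_family A G.
Local Notation V := (famV f).
Local Notation E := (famE f).
Local Notation E' := (famG f).
Variables (n : vertex G -> nat) (eps : vertex G -> nat -> A).
Variables (keep : arrow G -> Prop) (ext : vertex G -> Prop).
Variables (r : vertex G -> vertex G) (S S' : vertex G -> nat -> A).

Hypothesis eps_orth : forall v i j, eps v i ** eps v j = if i == j then eps v i
  else 0.
Hypothesis eps_sum : forall v, V v = \sum_(i < n v) eps v i.
Hypothesis eps_out : forall v i, (n v <= i)%N -> eps v i = 0.
Hypothesis keepE : forall e, keep e -> eps (source e) 0 ** E e = E e.
Hypothesis keepG : forall e, keep e -> E' e ** eps (source e) 0 = E' e.
Hypothesis S_source : forall v i, ext v -> eps v i ** S v i = S v i.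
Hypothesis S_target : forall v i, ext v -> S v i ** eps (r v) i = S v i.
Hypothesis S'_target : forall v i, ext v -> eps (r v) i ** S' v i = S' v i.
Hypothesis S'_source : forall v i, ext v -> S' v i ** eps v i = S' v i.
Hypothesis SS' : forall v i, ext v -> S v i ** S' v i = eps v i.
Hypothesis S'S : forall v i, ext v -> S' v i ** S v i = eps (r v) i.
Hypothesis ext_keep : forall e, ext (source e) -> ~ keep e.
Hypothesis keep_CK2 : forall v (es : seq (arrow G)), ~ ext v -> uniq es ->
  es <> [::] ->
  (forall e, e \in es <-> [/\ keep e, source e = v & V (target e) <> 0]) ->
  eps v 0 = \sum_(e <- es) E e ** E' e.

Lemma eps_sum_nat v : V v = \sum_(0 <= i < n v) eps v i.
Proof. by rewrite big_mkord eps_sum. Qed.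

Lemma epsV v i : eps v i ** V v = eps v i.
Proof.
have [lt_i|/eps_out ->] := ltnP i (n v); last by rewrite numul0r.
rewrite eps_sum numul_sumr (bigD1 (Ordinal lt_i)) //= eps_orth eqxx.
rewrite big1 ?addr0 // => j /eqP ji; rewrite eps_orth; case: eqP => // ij.
by case: ji; apply: val_inj.
Qed.

Lemma Veps v i : V v ** eps v i = eps v i.
Proof.
have [lt_i|/eps_out ->] := ltnP i (n v); last by rewrite numulr0.
rewrite eps_sum numul_suml (bigD1 (Ordinal lt_i)) //= eps_orth eqxx.
rewrite big1 ?addr0 // => j /eqP ji; rewrite eps_orth; case: eqP => // ij.
by case: ji; apply: val_inj.
Qed.

Lemma eps_orth2 v w i j : v != w -> eps v i ** eps w j = 0.
Proof.
move=> vw; rewrite -epsV -[eps w j]Veps -numulA [V v ** _]numulA famVW //.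
by rewrite numul0r numulr0.
Qed.

Definition vertex2 := {x : vertex G * nat | eps x.1 x.2 != 0}.

Definition arrow2 :=
  ({a : arrow G * nat | `[< keep a.1 >] && (eps (target a.1) a.2 != 0)} +
   {x : vertex G * nat | `[< ext x.1 >] && (eps x.1 x.2 != 0)})%type.

Lemma kept_source_neq0 (a : arrow G * nat) :
  `[< keep a.1 >] && (eps (target a.1) a.2 != 0) -> eps (source a.1) 0 != 0.
Proof.
move=> /andP[/asboolP /keepE kE]; apply: contraNneq => h.
by rewrite -[eps _ _]Veps -famGE -kE h numul0r numulr0 numul0r.
Qed.

Lemma ext_target_neq0 (x : vertex G * nat) :
  `[< ext x.1 >] && (eps x.1 x.2 != 0) -> eps (r x.1) x.2 != 0.
Proof.
move=> /andP[/asboolP ex]; apply: contraNneq => h.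
by rewrite -SS' // -S_target // h numulr0 numul0r.
Qed.

Definition source2 (a : arrow2) : vertex2 :=
  match a with
  | inl b => exist (fun x => is_true (eps x.1 x.2 != 0)) (source (val b).1, 0%N)
               (kept_source_neq0 (valP b))
  | inr y => exist (fun x => is_true (eps x.1 x.2 != 0)) (val y)
               (proj2 (andP (valP y)))
  end.

Definition target2 (a : arrow2) : vertex2 :=
  match a with
  | inl b => exist (fun x => is_true (eps x.1 x.2 != 0))
               (target (val b).1, (val b).2) (proj2 (andP (valP b)))
  | inr y => exist (fun x => is_true (eps x.1 x.2 != 0)) (r (val y).1, (val y).2)
               (ext_target_neq0 (valP y))
  end.

Definition refined_digraph : digraph := Digraph source2 target2.
Local Notation G2 := refined_digraph.

Definition refV (x : vertex G2) : A := eps (val (x : vertex2)).1 (val (x :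
  vertex2)).2.
Definition refE (a : arrow G2) : A :=
  match (a : arrow2) with
  | inl b => E (val b).1 ** eps (target (val b).1) (val b).2
  | inr y => S (val y).1 (val y).2
  end.
Definition refG (a : arrow G2) : A :=
  match (a : arrow2) with
  | inl b => eps (target (val b).1) (val b).2 ** E' (val b).1
  | inr y => S' (val y).1 (val y).2
  end.

Lemma refV_eq0 (x y : vertex G2) : x != y -> refV x ** refV y = 0.
Proof.
case: x y => [[v i] vi] [[w j] wj] xy; rewrite /refV /=.
have [vw|] := eqVneq v w; last exact: eps_orth2.
rewrite vw eps_orth; case: eqP => // ij; case/eqP: xy.
by apply: val_inj; rewrite /= vw ij.
Qed.

Lemma refVE a : refV (source a) ** refE a = refE a.
Proof.
case: a => -[x hx] /=; have /andP[/asboolP kx x0] := hx; rewrite /refV /refE /=.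
  by rewrite numulA keepE.
exact: S_source.
Qed.

Lemma refGV a : refG a ** refV (source a) = refG a.
Proof.
case: a => -[x hx] /=; have /andP[/asboolP kx x0] := hx; rewrite /refV /refG /=.
  by rewrite -numulA keepG.
exact: S'_source.
Qed.

Lemma refEV a : refE a ** refV (target a) = refE a.
Proof.
case: a => -[x hx] /=; have /andP[/asboolP kx x0] := hx; rewrite /refV /refE /=.
  by rewrite -numulA eps_orth eqxx.
exact: S_target.
Qed.

Lemma refVG a : refV (target a) ** refG a = refG a.
Proof.
case: a => -[x hx] /=; have /andP[/asboolP kx x0] := hx; rewrite /refV /refG /=.
  by rewrite numulA eps_orth eqxx.
exact: S'_target.
Qed.

Lemma refGE a : refG a ** refE a = refV (target a).
Proof.
case: a => -[x hx] /=; have /andP[/asboolP kx x0] := hx;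
  rewrite /refV /refG /refE /=.
  by rewrite -numulA [E' _ ** _]numulA famGE Veps eps_orth eqxx.
exact: S'S.
Qed.

Lemma refGE0 (a b : arrow G2) : a != b -> refG a ** refE b = 0.
Proof.
move=> ab; have [sab|sab] := eqVneq (source a) (source b); last first.
  by rewrite -refGV -refVE -numulA [refV _ ** (_ ** _)]numulA refV_eq0 //
    numul0r numulr0.
case: a b ab sab => -[x hx] [] [y hy] ab /(congr1 val) /= sab;
  have /andP[/asboolP kx x0] := hx; have /andP[/asboolP ky y0] := hy.
- rewrite /refG /refE /= -numulA [E' _ ** _]numulA famGE_if.
  case: eqP => [xy|]; last by rewrite numul0r numulr0.
  rewrite xy Veps eps_orth; case: eqP => // xy2; case/eqP: ab.
  congr inl; apply: val_inj => /=.
  by case: (x) (y) xy xy2 => x1 x2 [y1 y2] /= -> ->.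
- by case: (@ext_keep x.1) => //; case: y sab ky {hy ab y0} => y1 y2 [-> _].
- by case: (@ext_keep y.1) => //; case: x sab kx {hx ab x0} => x1 x2 [<- _].
- by case/eqP: ab; congr inr; apply: val_inj.
Qed.

(** A component of an [ext] vertex emits exactly one arrow, and CK2 there is [SS']. *)
Lemma refCK2_ext (x : vertex G2) (es : seq (arrow G2)) :
  ext (val (x : vertex2)).1 -> uniq es -> es <> [::] ->
  (forall a, a \in es <-> source a = x) ->
  refV x = \sum_(a <- es) refE a ** refG a.
Proof.
move=> ex ues es0 hes.
have [a [aes aE]] : exists a, a \in es /\ forall b, b \in es -> b = a.
  case: es es0 hes {ues} => // a es _ hes; exists a; split; first exact: mem_head.
  have inrE b : source b = x -> exists y, b = inr y /\ val y = val (x : vertex2).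
    case: b => y /(congr1 val) /= xy; last by exists y.
    have /andP[/asboolP ky _] := valP y.
    case: (@ext_keep (val y).1) => //.
    by rewrite (congr1 fst xy : source (val y).1 = (val (x : vertex2)).1).
  move=> b /hes /inrE[y [-> yx]].
  have /hes /inrE[z [-> zx]] := mem_head a es.
  by congr inr; apply: val_inj; rewrite yx zx.
have {}aE : perm_eq es [:: a].
  apply: uniq_perm => // b; rewrite inE.
  by apply/idP/eqP => [/aE|-> //].
rewrite (perm_big _ aE) big_seq1.
have /hes <- := aes.
case: (a) aes => -[y hy]; have /andP[/asboolP ky y0] := hy;
  rewrite /refE /refG /refV /=.
  move=> /hes /(congr1 val) /= yx; case: (@ext_keep y.1) => //.
  by rewrite (congr1 fst yx : source y.1 = (val (x : vertex2)).1).
by rewrite SS'.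
Qed.

(** The new arrows from [x] are pairs of an old arrow [e] and a component of its target. Summing
    over the components restores [E e ** E' e], and [keep_CK2] applies. *)
Lemma refCK2_kept (x : vertex G2) (es : seq (arrow G2)) :
  ~ ext (val (x : vertex2)).1 -> uniq es -> es <> [::] ->
  (forall a, a \in es <-> source a = x) ->
  refV x = \sum_(a <- es) refE a ** refG a.
Proof.
move=> ex ues es0 hes.
have inlE a : a \in es -> exists b, a = inl b /\ (source (val b).1, 0%N) = val
  (x : vertex2).
  move=> /hes; case: a => y /(congr1 val) /= xy; first by exists y.
  have /andP[/asboolP ky _] := valP y.
  by case: ex; rewrite -(congr1 fst xy : (val y).1 = (val (x : vertex2)).1).
(* [x] emits a kept arrow, so it is a component 0; [e0] only supplies a default value for [lab]. *)
have [e0 x2] : exists e0 : arrow G, (val (x : vertex2)).2 = 0%N.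
  case: (es) es0 inlE => // a es' _ /(_ a (mem_head _ _)) [b [_ bx]].
  by exists (val b).1; rewrite -bx.
pose lab (a : arrow G2) := if (a : arrow2) is inl b then val b else (e0, 0%N).
pose U := undup [seq (lab a).1 | a <- es].
(* All components are listed, also the zero ones, which belong to no arrow but contribute 0. *)
pose P := [seq (e, j) | e <- U, j <- iota 0 (n (target e))].
have uP : uniq P.
  apply: allpairs_uniq_dep; first exact: undup_uniq.
    by move=> e _; exact: iota_uniq.
  by move=> [e j] [e' j'] _ _ [-> ->].
rewrite (sum_by_label (lab := lab) _ uP); last first.
  apply/allP => a aes; have [[[e j] hb] [ab _]] := inlE a aes.
  apply/allpairsPdep; exists e, j; split.
  - by rewrite mem_undup; apply/mapP; exists a => //; rewrite /lab ab.
  - rewrite mem_iota add0n /=; have /andP[_] := hb.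
    by apply: contraR; rewrite -leqNgt => /eps_out /= ->.
  - by rewrite /lab ab.
have sumE y : y \in P -> \sum_(a <- es | lab a == y) refE a ** refG a =
    E y.1 ** eps (target y.1) y.2 ** E' y.1.
  case/allpairsPdep => e [j [eU _ ->]] /=.
  have gE a : a \in es -> lab a == (e, j) ->
      refE a ** refG a = E e ** eps (target e) j ** E' e.
    move=> aes; have [b [-> _]] := inlE a aes; rewrite /lab /refE /refG => /eqP ->.
    by rewrite -numulA [eps _ _ ** (_ ** _)]numulA eps_orth eqxx numulA.
  have [h0|h0] := eqVneq (eps (target e) j) 0.
    rewrite h0 numulr0 numul0r (@big1_seq _ _ _ (arrow G2)) // => a /andP[la aes].
    by rewrite (gE a aes la) h0 numulr0 numul0r.
  move: eU; rewrite mem_undup => /mapP[a aes ea].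
  have [b [ab bx]] := inlE a aes; have /andP[/asboolP kb _] := valP b.
  rewrite /lab ab in ea; rewrite -ea in kb bx.
  have hej : `[< keep (e, j).1 >] && (eps (target (e, j).1) (e, j).2 != 0).
    by rewrite /= h0 andbT; apply/asboolP.
  pose a0 : arrow G2 := inl (exist _ (e, j) hej).
  have a0es : a0 \in es by apply/hes; apply: val_inj.
  have pe : perm_eq [seq b <- es | lab b == (e, j)] [:: a0].
    apply: uniq_perm; rewrite ?filter_uniq // => a1; rewrite mem_filter mem_seq1.
    apply/andP/eqP => [[/eqP l1 a1es]|->]; last by rewrite eqxx.
    have [b1 [a1b1 _]] := inlE a1 a1es; rewrite a1b1 /lab in l1 *.
    by congr inl; apply: val_inj.
  by rewrite -big_filter (perm_big _ pe) big_seq1 (gE a0) //= eqxx.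
rewrite (eq_big_seq _ sumE) big_allpairs_dep /=.
have <- : \sum_(e <- U) E e ** E' e =
    \sum_(e <- U) \sum_(j <- iota 0 (n (target e))) E e ** eps (target e) j ** E' e.
  apply: eq_bigr => e _; rewrite -numul_suml -numul_sumr.
  by rewrite -[n _]subn0 -/(index_iota _ _) -eps_sum_nat famEV.
rewrite /refV x2; apply: keep_CK2 => //; first exact: undup_uniq.
  have [a aes] : exists a, a \in es.
    by case: (es) es0 => // a es' _; exists a; exact: mem_head.
  have : (lab a).1 \in U by rewrite mem_undup; apply/mapP; exists a.
  by move=> + U0; rewrite U0.
move=> e; split.
  rewrite mem_undup => /mapP[a aes ->]; have [b [ab bx]] := inlE a aes.
  have /andP[/asboolP kb b0] := valP b; rewrite /lab ab -bx; split=> // h.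
  by case/eqP: b0; rewrite -Veps h numul0r.
move=> [ke sx te0].
have [j ej] : exists j, eps (target e) j <> 0.
  apply: contrapT => h; apply: te0; rewrite eps_sum big1 // => j _.
  by apply: contrapT => h'; apply: h; exists j.
have hej : `[< keep (e, j).1 >] && (eps (target (e, j).1) (e, j).2 != 0).
  by apply/andP; split; [apply/asboolP|apply/eqP].
pose a0 : arrow G2 := inl (exist _ (e, j) hej).
have a0es : a0 \in es.
  by apply/hes; apply: val_inj; rewrite /= sx -x2 -surjective_pairing.
by rewrite mem_undup; apply/mapP; exists a0.
Qed.

Definition refined_family : leavitt_family A G2.
Proof.
refine (@LeavittFamily F A G2 refV refE refG _ refV_eq0 refVE refEV refVG refGV
  refGE refGE0 _).
- by move=> x; rewrite /refV eps_orth eqxx.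
- move=> x es ues es0 hes.
  by have [ex|ex] := pselect (ext (val (x : vertex2)).1);
    [apply: refCK2_ext|apply: refCK2_kept].
Defined.

Lemma refined_family_neq0 x : famV refined_family x <> 0.
Proof. by apply/eqP; exact: (valP (x : vertex2)). Qed.

Section Generation.
Variable P : A -> Prop.
Hypothesis clP : nusubalg_closed P.
Hypothesis PV : forall x, P (famV refined_family x).
Hypothesis PE : forall a, P (famE refined_family a).
Hypothesis PG : forall a, P (famG refined_family a).

Lemma refined_gen_eps v i : P (eps v i).
Proof.
have [->|vi] := eqVneq (eps v i) 0; first exact: clP.1.1.
exact: (PV (exist _ (v, i) vi)).
Qed.

Lemma refined_gen_V v : P (V v).
Proof. by rewrite eps_sum; apply: (lin_closed_sum clP.1) => i _;
  exact: refined_gen_eps. Qed.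

Lemma refined_gen_keep e : keep e -> P (E e) /\ P (E' e).
Proof.
move=> ke; split; [rewrite -famEV|rewrite -famVG];
  rewrite eps_sum ?numul_sumr ?numul_suml;
  apply: (lin_closed_sum clP.1) => i _;
  (have [->|i0] := eqVneq (eps (target e) i) 0;
    first by rewrite ?numulr0 ?numul0r; exact: clP.1.1);
  have h : `[< keep (e, nat_of_ord i).1 >] && (eps (target (e, nat_of_ord i).1)
    (e, nat_of_ord i).2 != 0)
    by (rewrite /= i0 andbT; apply/asboolP).
  exact: (PE (inl (exist _ (e, nat_of_ord i) h))).
exact: (PG (inl (exist _ (e, nat_of_ord i) h))).
Qed.

Lemma refined_gen_ext v i : ext v -> P (S v i) /\ P (S' v i).
Proof.
move=> ev; have [v0|vi] := eqVneq (eps v i) 0.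
  by rewrite -S_source // -S'_source // v0 numul0r numulr0; split; exact: clP.1.1.
have h : `[< ext (v, i).1 >] && (eps (v, i).1 (v, i).2 != 0).
  by rewrite /= vi andbT; apply/asboolP.
split; first exact: (PE (inr (exist _ (v, i) h))).
exact: (PG (inr (exist _ (v, i) h))).
Qed.

End Generation.
End Refinement.

(** * Removal of the zero vertices *)

Section NonzeroVertices.
Variables (F : fieldType) (A : nuAlgType F) (G : digraph).
Variable f : leavitt_family A G.
Local Notation V := (famV f).
Local Notation E := (famE f).
Local Notation E' := (famG f).
Implicit Types (v : vertex G) (e : arrow G).

Definition enum_live v (es : seq (arrow G)) : Prop :=
  [/\ uniq es, es <> [::] &
      forall e, e \in es <-> source e = v /\ V (target e) <> 0].

(** In the default case [v] has no arrow to a nonzero vertex, or infinitely many; CK2 will not be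
    demanded and the second component of [v] is 0. *)
Definition live_part v : A :=
  if pselect (exists es, enum_live v es) is left h then
    \sum_(e <- projT1 (cid h)) E e ** E' e
  else V v.

Lemma live_partE v es : enum_live v es -> live_part v = \sum_(e <- es) E e ** E' e.
Proof.
move=> hv; have [ues _ hes] := hv.
rewrite /live_part; case: pselect => [h|[]]; last by exists es.
have [ues' _ hes'] := projT2 (cid h).
apply: perm_big; apply: uniq_perm => // e.
by apply/idP/idP => [/hes'/hes|/hes/hes'].
Qed.

Lemma live_partP v : live_part v = V v \/
  exists2 es, enum_live v es & live_part v = \sum_(e <- es) E e ** E' e.
Proof.
have [[es h]|h] := pselect (exists es, enum_live v es).
  by right; exists es => //; exact: live_partE.
by left; rewrite /live_part; case: pselect.
Qed.

Lemma live_partV v : live_part v ** V v = live_part v.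
Proof.
have [->|[es [_ _ hes] ->]] := live_partP v; first exact: famVV.
rewrite numul_suml; apply: eq_big_seq => e /hes[<- _].
by rewrite -numulA famGV.
Qed.

Lemma Vlive_part v : V v ** live_part v = live_part v.
Proof.
have [->|[es [_ _ hes] ->]] := live_partP v; first exact: famVV.
rewrite numul_sumr; apply: eq_big_seq => e /hes[<- _].
by rewrite numulA famVE.
Qed.

Lemma famE_dead e : V (target e) = 0 -> E e = 0.
Proof. by move=> h; rewrite -famEV h numulr0. Qed.

Lemma famG_dead e : V (target e) = 0 -> E' e = 0.
Proof. by move=> h; rewrite -famVG h numul0r. Qed.

Lemma live_partE_arrow e : live_part (source e) ** E e = E e.
Proof.
have [->|[es [ues _ hes] ->]] := live_partP (source e); first exact: famVE.
have [te0|te0] := eqVneq (V (target e)) 0; first by rewrite famE_dead // numulr0.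
have ees : e \in es by apply/hes; split=> //; apply/eqP.
rewrite numul_suml (bigD1_seq e) //= -numulA famGE famEV big1 ?addr0 // => e' ee.
by rewrite -numulA famGE0 // numulr0.
Qed.

Lemma live_partG_arrow e : E' e ** live_part (source e) = E' e.
Proof.
have [->|[es [ues _ hes] ->]] := live_partP (source e); first exact: famGV.
have [te0|te0] := eqVneq (V (target e)) 0; first by rewrite famG_dead // numul0r.
have ees : e \in es by apply/hes; split=> //; apply/eqP.
rewrite numul_sumr (bigD1_seq e) //= numulA famGE famVG big1 ?addr0 // => e' ee.
by rewrite numulA famGE0 ?numul0r // eq_sym.
Qed.

Lemma live_part_idem v : live_part v ** live_part v = live_part v.
Proof.
have [h|[es [ues _ hes] h]] := live_partP v.
  by rewrite {1}h Vlive_part.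
rewrite {2}h numul_sumr [RHS]h; apply: eq_big_seq => e /hes[<- _].
by rewrite numulA live_partE_arrow.
Qed.

Definition live_eps v (i : nat) : A :=
  match i with 0 => live_part v | 1 => V v - live_part v | _ => 0 end.

Lemma live_eps_orth v i j :
  live_eps v i ** live_eps v j = if i == j then live_eps v i else 0.
Proof.
case: i j => [|[|i]] [|[|j]] /=; rewrite ?numulr0 ?numul0r ?if_same //.
- exact: live_part_idem.
- by rewrite numulrBr live_partV live_part_idem subrr.
- by rewrite numulrBl Vlive_part live_part_idem subrr.
- by rewrite numulrBr !numulrBl famVV live_partV Vlive_part live_part_idem
  subrr subr0.
Qed.

Hypothesis gen_f : generating f.

(* A vertex with finitely many, but at least one, arrows to nonzero vertices is
   split into the sum of the [E e ** E' e] and the rest (which is nonzero only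
   for what is called a breaking vertex). *)
Lemma nonzero_vertices : exists (G1 : digraph) (f1 : leavitt_family A G1),
  generating f1 /\ forall x, famV f1 x <> 0.
Proof.
have sum2 v : V v = \sum_(i < 2) live_eps v i.
  by rewrite big_ord_recl big_ord1 /= addrC subrK.
have out2 v i : (2 <= i)%N -> live_eps v i = 0 by case: i => [|[|i]].
have ck2 v (es : seq (arrow G)) : ~ False -> uniq es -> es <> [::] ->
    (forall e, e \in es <-> [/\ True, source e = v & V (target e) <> 0]) ->
    live_eps v 0 = \sum_(e <- es) E e ** E' e.
  move=> _ ues es0 hes; apply: live_partE; split=> // e.
  by split=> [/hes[]|[? ?]]; [|apply/hes].
(* Every arrow is kept and [ext] is empty, so [id] and the zero functions only fill the places of
   [r], [S] and [S']. *)
pose f1 := @refined_family F A G f (fun=> 2%N) live_eps (fun=> True) (fun=> False)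
  id (fun _ _ => 0) (fun _ _ => 0) live_eps_orth sum2 out2
  (fun e _ => live_partE_arrow e) (fun e _ => live_partG_arrow e)
  (fun _ _ => False_ind _) (fun _ _ => False_ind _) (fun _ _ => False_ind _)
  (fun _ _ => False_ind _) (fun _ _ => False_ind _) (fun _ _ => False_ind _)
  (fun _ => False_ind _) ck2.
exists _, f1; split; last exact: refined_family_neq0.
move=> P clP PV PE PG; apply: gen_f => //.
- by move=> v; apply: (refined_gen_V clP PV).
- by move=> e; have [] := refined_gen_keep clP PE PG (e := e) I.
- by move=> e; have [] := refined_gen_keep clP PE PG (e := e) I.
Qed.

End NonzeroVertices.

(** * Algebraic cycles in reduced algebras *)

(** The ideal generated by [z] has square zero, so it is nil. Without a unit, [z ** z = 0] does not
    follow from the other condition. *)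
Lemma reduced_semiprime (R : nuRingType) (z : R) : reduced R ->
  z ** z = 0 -> (forall x, z ** x ** z = 0) -> z = 0.
Proof.
move=> redR zz zxz.
pose I : set R := [set x | forall K : set R, two_sided_ideal K -> K z -> K
  x]%classic.
have II : two_sided_ideal I.
  split=> [K hK _|x y hx hy K hK Kz|a x hx K hK Kz|a x hx K hK Kz].
  - exact: ideal0 hK.
  - by apply: (idealB hK); [apply: hx|apply: hy].
  - by apply: (Defs.idealMl hK); apply: hx.
  - by apply: (Defs.idealMr hK); apply: hx.
(* These [y] form an ideal that contains [z], hence all of [I]; in the next step the same argument
   replaces [z] on the left by any element of [I]. *)
have zI y : I y -> z ** y = 0 /\ forall a, z ** a ** y = 0.
  move=> /(_ [set y | z ** y = 0 /\ forall a, z ** a ** y = 0]%classic); apply=> //.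
  split=> [|x x' [h1 h2] [h1' h2']|a x [h1 h2]|a x [h1 h2]].
  - by split=> [|a]; rewrite numulr0.
  - by split=> [|a]; rewrite numulrBr ?h1 ?h1' ?h2 ?h2' subrr.
  - by split=> [|b]; rewrite numulA -?[z ** b ** a]numulA h2.
  - by split=> [|b]; rewrite numulA ?h1 ?h2 numul0r.
have Ixy x y : I x -> I y -> x ** y = 0.
  move=> /(_ [set x | forall y, I y -> x ** y = 0]%classic) h; apply: h y => //.
    split=> [w _|x1 x2 h1 h2 w Iw|a x1 h1 w Iw|a x1 h1 w Iw].
    - by rewrite numul0r.
    - by rewrite numulrBl h1 // h2 // subrr.
    - by rewrite -numulA h1 // numulr0.
    - by rewrite -numulA h1 //; apply: (Defs.idealMl II).
  by move=> w /zI[].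
suff : nilradical R z by rewrite redR.
exists [:: z]; split; first by rewrite big_seq1.
move=> y; rewrite inE => /eqP ->; exists I; last by move=> K.
split=> // x Ix; exists 1%N; exact: Ixy.
Qed.

Section CornerEvalMul.
Variables (F : fieldType) (A : nuAlgType F) (v c : A).
Hypotheses (vv : v ** v = v) (vc : v ** c = c) (cv : c ** v = c).
Implicit Types p q : {poly F}.
Local Notation ev := (corner_eval v c).

Lemma corner_eval1 : ev 1 = v.
Proof. by rewrite -(expr0 'X) corner_evalXn. Qed.

Lemma corner_evalV p : ev p ** v = ev p.
Proof.
rewrite /corner_eval numul_suml; apply: eq_bigr => i _.
by rewrite -scale_numull corner_powv.
Qed.

Lemma corner_Veval p : v ** ev p = ev p.
Proof.
rewrite /corner_eval numul_sumr; apply: eq_bigr => i _.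
by rewrite -scale_numulr corner_vpow.
Qed.

Lemma corner_evalM p q : ev (p * q) = ev p ** ev q.
Proof.
elim/poly_ind: p q => [q|p a IH q]; first by rewrite mul0r corner_eval0 numul0r.
rewrite mulrDl -mulrA corner_evalD IH corner_eval_mulX corner_evalD IH.
rewrite -['X]expr1 corner_evalXn corner_pow1 // mul_polyC corner_evalZ.
rewrite numulDl numulA; congr (_ + _).
by rewrite -[a%:P]mulr1 mul_polyC corner_evalZ corner_eval1 -scale_numull
  corner_Veval.
Qed.

Lemma corner_evalC p q : ev p ** ev q = ev q ** ev p.
Proof. by rewrite -!corner_evalM mulrC. Qed.

Lemma corner_evalB p q : ev (p - q) = ev p - ev q.
Proof. by rewrite corner_evalD -scaleN1r corner_evalZ scaleN1r. Qed.

(* Partial fractions, one root at a time. *)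
Lemma corner_eval_split (rs : seq F) q : uniq rs ->
  ev (\prod_(z <- rs) ('X - z%:P) * q) = 0 ->
  exists t : F -> {poly F}, ev q = \sum_(z <- rs) ev (t z) /\
    forall z, z \in rs -> ev (('X - z%:P) * t z) = 0.
Proof.
elim: rs q => [|l rs IH] q /=.
  by move=> _; rewrite big_nil mul1r => ->; exists (fun=> 0); rewrite big_nil.
move=> /andP[lrs urs]; rewrite big_cons -mulrA mulrCA => h.
have [t [tsum th]] := IH _ urs h.
have thl z : z \in rs -> ev (('X - l%:P) * t z) = (z - l) *: ev (t z).
  move=> zrs; have -> : 'X - l%:P = 'X - z%:P + (z - l)%:P :> {poly F}.
    by rewrite polyCB addrA subrK.
  by rewrite mulrDl corner_evalD th // add0r mul_polyC corner_evalZ.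
have zl z : z \in rs -> z - l != 0.
  by move=> zrs; rewrite subr_eq0; apply: contraNneq lrs => <-.
(* Induction has split [('X - l%:P) * q]. Since ['X - l%:P] acts on [t z] as [z - l], dividing by
   these scalars splits [q] up to a remainder killed by ['X - l%:P], which is the component of
   [l]. *)
exists (fun z => if z == l then q - \sum_(x <- rs) (x - l)^-1 *: t x
                 else (z - l)^-1 *: t z).
rewrite big_cons eqxx; split.
  have -> : \sum_(z <- rs) ev (if z == l then q - \sum_(x <- rs) (x - l)^-1 *: t x
                 else (z - l)^-1 *: t z) = ev (\sum_(x <- rs) (x - l)^-1 *: t x).
    rewrite corner_eval_sum; apply: eq_big_seq => z zrs.
    by case: eqP => // zl'; rewrite -zl' zrs in lrs.
  by rewrite corner_evalB subrK.
move=> z; rewrite inE; case: eqP => [->|zl'] /= => [_|zrs].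
  rewrite mulrBr corner_evalB tsum mulr_sumr corner_eval_sum -sumrB big1_seq //.
  move=> x /andP[_ xrs].
  by rewrite -scalerAr corner_evalZ thl // scalerA mulVf ?zl // scale1r subrr.
by rewrite -scalerAr corner_evalZ th // scaler0.
Qed.

End CornerEvalMul.

Lemma not_uniq_perm (T : eqType) (s : seq T) : ~~ uniq s ->
  exists x s', perm_eq s [:: x, x & s'].
Proof.
elim: s => //= x s IH; rewrite negb_and negbK;
  have [xs _|_ /= /IH[y [s' ys]]] := boolP (x \in s).
  by exists x, (rem x s); rewrite perm_cons perm_to_rem.
exists y, (x :: s'); rewrite -(perm_cons x) in ys.
by rewrite (perm_trans ys) // (perm_catCA [:: x] [:: y; y] s').
Qed.

(* Reducedness makes the minimal polynomial of [c] squarefree; the [eps i] are the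
   projections on the eigenspaces of [c]. *)
Lemma corner_idempotents (F : closedFieldType) (A : nuAlgType F) (v c : A)
    (p : {poly F}) : reduced A ->
  v ** v = v -> v ** c = c -> c ** v = c ->
  (forall x, exists q, v ** x ** v = corner_eval v c q) ->
  p != 0 -> corner_eval v c p = 0 ->
  exists (n : nat) (eps : nat -> A),
    [/\ forall i j, eps i ** eps j = if i == j then eps i else 0,
        v = \sum_(i < n) eps i, forall i, (n <= i)%N -> eps i = 0 &
        forall x, exists k : nat -> F, v ** x ** v = \sum_(i < n) k i *: eps i].
Proof.
move=> redA vv vc cv corner p0 evp.
set ev := corner_eval v c in corner evp *.
have evM q q' : ev (q * q') = ev q ** ev q' by exact: corner_evalM.
have evC q q' : ev q ** ev q' = ev q' ** ev q by exact: corner_evalC.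
have evc q : ev q ** c = c ** ev q.
  have -> : c = ev 'X by rewrite -['X]expr1 /ev corner_evalXn corner_pow1.
  exact: evC.
pose P (rs : seq F) := \prod_(z <- rs) ('X - z%:P).
(* A shortest list of roots of an annihilating product replaces the minimal polynomial. *)
have exn : exists n, `[< exists rs : seq F, size rs = n /\ ev (P rs) = 0 >].
  have [rs prs] := closed_field_poly_normal p.
  exists (size rs); apply/asboolP; exists rs; split=> //.
  move: evp; rewrite prs /ev corner_evalZ => /eqP.
  by rewrite scaler_eq0 lead_coef_eq0 (negPf p0) => /eqP.
case: (ex_minnP exn) => _ /asboolP[rs [<- evrs]] min_rs.
have urs : uniq rs.
  apply: contraT => /not_uniq_perm[l [rs' rsE]].
  have evP q q' : perm_eq q q' -> ev (P q) = ev (P q').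
    by move=> qq'; rewrite /P (perm_big _ qq').
  (* With one copy of the repeated root omitted, the value has square zero. It commutes with the
     whole corner, a quotient of the polynomial ring, so [reduced_semiprime] makes it vanish,
     against minimality. *)
  have z0 : ev (P (l :: rs')) = 0.
    have zz : ev (P (l :: rs')) ** ev (P (l :: rs')) = 0.
      have -> : ev (P (l :: rs')) ** ev (P (l :: rs')) = ev (P [:: l, l & rs'])
        ** ev (P rs').
        by rewrite -!evM /P !big_cons mulrCA !mulrA.
      by rewrite -(evP _ _ rsE) evrs numul0r.
    apply: (reduced_semiprime redA) => // x.
    have -> : ev (P (l :: rs')) ** x ** ev (P (l :: rs')) =
        ev (P (l :: rs')) ** (v ** x ** v) ** ev (P (l :: rs')).
      by rewrite !numulA (corner_evalV _ vv) -[RHS]numulA (corner_Veval vv vc).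
    by have [q ->] := corner x;
      rewrite -/ev -numulA [ev q ** _]evC numulA zz numul0r.
  have : (size rs <= size (l :: rs'))%N.
    by apply: min_rs; apply/asboolP; exists (l :: rs').
  by rewrite (perm_size rsE) /= ltnn.
(* Splitting the polynomial 1 writes the unit [v] as a sum of eigenvectors of [c]. *)
have [|t [tsum tz]] := @corner_eval_split _ _ v c rs 1 urs.
  by rewrite mulr1.
have {}tz z : z \in rs -> c ** ev (t z) = z *: ev (t z).
  move=> /tz; rewrite corner_eval_mulXsubC // => /eqP.
  by rewrite subr_eq0 => /eqP.
rewrite corner_eval1 in tsum.
have orth z w : z \in rs -> w \in rs -> z != w -> ev (t z) ** ev (t w) = 0.
  move=> zrs wrs zw.
  have : (z - w) *: (ev (t z) ** ev (t w)) = 0.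
    rewrite scalerBl {1}scale_numull -tz // scale_numulr -tz //.
    by rewrite [ev (t z) ** _]numulA evc subrr.
  move=> /eqP; rewrite scaler_eq0 subr_eq0 (negPf zw) => /eqP h; exact: h.
pose eps i := if (i < size rs)%N then ev (t (nth 0 rs i)) else 0.
have epsE i : (i < size rs)%N -> eps i = ev (t (nth 0 rs i)) by rewrite /eps => ->.
have eps0 i : (size rs <= i)%N -> eps i = 0 by rewrite /eps ltnNge => ->.
have vsum : v = \sum_(i < size rs) eps i.
  rewrite tsum (big_nth 0) big_mkord; apply: eq_bigr => i _.
  by rewrite epsE.
exists (size rs), eps; split=> //.
- move=> i j; have [ir|ir] := ltnP i (size rs); last first.
    by rewrite !(eps0 i) // numul0r if_same.
  have [jr|jr] := ltnP j (size rs); last first.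
    rewrite (eps0 j) // numulr0; case: eqP => // ij.
    by rewrite ij ltnNge jr in ir.
  have orthij k l : (k < size rs)%N -> (l < size rs)%N -> k != l -> eps k **
    eps l = 0.
    by move=> kr lr kl; rewrite !epsE // orth ?mem_nth // nth_uniq.
  case: eqVneq => [<-|]; last exact: orthij.
  have -> : eps i = eps i ** v by rewrite epsE // corner_evalV.
  rewrite {3}vsum numul_sumr (bigD1 (Ordinal ir)) //= big1 ?addr0.
    by rewrite -[eps i ** v]/(eps i ** v) epsE // corner_evalV.
  move=> k ki; rewrite orthij // eq_sym; apply: contra ki => /eqP ki.
  by apply/eqP; apply: val_inj.
- move=> x; have [q ->] := corner x; exists (fun i => q.[nth 0 rs i]).
  have pow_eval z m : z \in rs -> corner_pow v c m ** ev (t z) = z ^+ m *: ev (t z).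
    move=> zrs; elim: m => [|m IHm]; first by rewrite expr0 scale1r;
      exact: corner_Veval.
    by rewrite corner_powS -numulA IHm -scale_numulr tz // scalerA exprSr.
  have -> : ev q = \sum_(i < size rs) ev q ** eps i.
    by rewrite -numul_sumr -vsum; exact: esym (corner_evalV _ vv q).
  apply: eq_bigr => i _.
  rewrite epsE // horner_coef scaler_suml.
  rewrite (_ : ev q = \sum_(j < size q) q`_j *: corner_pow v c j) // numul_suml.
  by apply: eq_bigr => j _; rewrite -scale_numull pow_eval ?mem_nth // scalerA.
Qed.

(** * Corners at cycles without exit *)

Section AlgebraicCycles.
Variables (F : fieldType) (A : nuAlgType F) (G : digraph).
Variable f : leavitt_family A G.
Local Notation V := (famV f).
Local Notation E := (famE f).
Local Notation E' := (famG f).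
Implicit Types (v w : vertex G) (e : arrow G).

(** As [c'] is a left inverse of [c], factors ['X] can be cancelled from [p] until its constant term
    is nonzero; the relation multiplied by [c'] is then solved for [c']. *)
Lemma corner_eval_inverse (v c c' : A) (p : {poly F}) :
  v ** v = v -> v ** c = c -> c' ** c = v -> c' ** v = c' ->
  p != 0 -> corner_eval v c p = 0 -> exists q, c' = corner_eval v c q.
Proof.
move=> vv vc c'c c'v; elim/poly_ind: p => [|p a IH]; first by rewrite eqxx.
rewrite mulrC corner_evalD corner_eval_mulX => pa0.
rewrite -[a%:P]mulr1 mul_polyC corner_evalZ corner_eval1 => h.
have {h} : corner_eval v c p + a *: c' = 0.
  have := congr1 (numul c') h.
  by rewrite numulr0 numulDr numulA c'c (corner_Veval vv vc) -scale_numulr c'v.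
have [a0|a0] := eqVneq a 0.
  rewrite a0 scale0r addr0; apply: IH; apply: contra_neq pa0 => ->.
  by rewrite a0 mulr0 addr0.
move=> /eqP; rewrite addrC addr_eq0 => /eqP h.
exists (- a^-1 *: p); rewrite corner_evalZ scaleNr -scalerN -h.
by rewrite scalerA mulVf // scale1r.
Qed.

Hypothesis gen_f : generating f.

(** The corner is spanned by products of a path and a ghost path from [v]. These reduce to products
    of powers of [c] and of its ghost, and the ghost is a polynomial in [c] because [c] is
    algebraic. *)
Lemma no_exit_corner v c (p : {poly F}) : min_closed v c -> no_exit c ->
  p != 0 -> corner_eval (V v) (path_elt f v c) p = 0 ->
  forall x, exists q, V v ** x ** V v = corner_eval (V v) (path_elt f v c) q.
Proof.
move=> hc ne p0 evp x; have [clc c0 _] := hc; have /andP[vc /eqP ec] := clc.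
set C := path_elt f v c in evp *.
have VC : V v ** C = C by exact/esym/path_elt_V.
have CV : C ** V v = C by exact: closed_path_eltV.
have [q0 q0E] : exists q, ghost_elt f v c = corner_eval (V v) C q.
  apply: corner_eval_inverse p0 evp => //; first exact: famVV.
    by rewrite ghost_path // ec.
  exact/esym/ghost_elt_V.
pose B x := exists q, x = corner_eval (V v) C q.
have BM y z : B y -> B z -> B (y ** z).
  by move=> [q ->] [q' ->]; exists (q * q'); rewrite corner_evalM // famVV.
have Blin : lin_closed B.
  split; first by exists 0; rewrite corner_eval0.
  by move=> a y z [q ->] [q' ->]; exists (a *: q + q'); rewrite corner_evalP.
have Bpow j : B (path_elt f v (path_pow j c)).
  by exists 'X^j; rewrite path_elt_pow // corner_evalXn.
have BV : B (V v) by exact: (Bpow 0%N).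
have Bghost j : B (ghost_elt f v (path_pow j c)).
  elim: j => [//|j IH]; rewrite path_powS ghost_elt_cat ec; apply: BM => //.
  by exists q0.
have Bmono q1 q2 : B (path_elt f v q1 ** ghost_elt f v q2).
  have [v1|/(path_elt_invalid f) ->] := boolP (valid_path v q1); last first.
    by rewrite numul0r; exact: Blin.1.
  have [v2|/(ghost_elt_invalid f) ->] := boolP (valid_path v q2); last first.
    by rewrite numulr0; exact: Blin.1.
  have := ghost_elt_end f v q2 (path_end v q2); rewrite eqxx => <-.
  rewrite numulA path_elt_end; case: eqP => e12; last first.
    by rewrite numul0r; exact: Blin.1.
  have [n /prefixP[z hz]] := no_exit_prefix clc c0 ne v1.
  have /andP[] := closed_path_pow n clc.
  rewrite hz valid_path_cat path_end_cat => /andP[_ vz] /eqP ez.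
  have nez : no_exit z.
    move=> e ein; apply: ne; apply: (@mem_path_pow _ n).
    by rewrite hz mem_cat ein orbT.
  (* Both paths are prolonged by [z] until they close up at [v]; without exits, [z] times its ghost
     is a vertex, so the product does not change. *)
  have -> : path_elt f v q1 ** ghost_elt f v q2 =
      path_elt f v (q1 ++ z) ** ghost_elt f v (q2 ++ z).
    rewrite path_elt_cat ghost_elt_cat -e12 -numulA.
    rewrite [path_elt _ _ z ** _]numulA path_ghost_noexit // e12 ghost_elt_end.
    by rewrite eqxx.
  have cl2 : closed_path v (q2 ++ z).
    by rewrite /closed_path valid_path_cat path_end_cat v2 -e12 vz ez eqxx.
  have [m hm] : exists m, prefix (q2 ++ z) (path_pow m c).
    by apply: (no_exit_prefix clc c0 ne); case/andP: cl2.
  have [j ->] := min_closed_pow hc cl2 hm.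
  by rewrite -hz; apply: BM.
(* [q] collects the ghost arrows that the induction on the degree strips off [y]. *)
have Bdeg n y : ghost_deg f v n y -> forall q, B (y ** ghost_elt f v q).
  elim: n y => [|n IH] y.
    move=> [l ->] q; rewrite numul_suml; apply: (lin_closed_sum Blin) => i _.
    by rewrite -scale_numull; apply: (lin_closedZ Blin).
  move=> [S [y0 [ry hS ->]]] q; rewrite numulDl numul_suml.
  apply: (lin_closedD Blin).
    move: ry => [l ->]; rewrite numul_suml; apply: (lin_closed_sum Blin) => i _.
    by rewrite -scale_numull; apply: (lin_closedZ Blin).
  apply: (lin_closed_sum_seq Blin) => i iS.
  by rewrite -numulA -ghost_elt_rcons; apply: IH; exact: hS.
have [n hn] := ghost_deg_exists gen_f v x.
exact: (Bdeg n _ hn [::]).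
Qed.

(* Vertices on a cycle without exit that is algebraic over [F] in [A]. *)
Definition bad_vertex v : Prop :=
  exists c (p : {poly F}), [/\ closed_path v c, c != [::], no_exit c, p != 0 &
    corner_eval (V v) (path_elt f v c) p = 0].

(** The cycle at a bad vertex begins with its only arrow [e]. Moving [e] to the end conjugates all
    powers of the cycle by [e], so [p] annihilates the rotated cycle too. *)
Lemma bad_vertex_arrow e : bad_vertex (source e) ->
  (forall e', source e' = source e -> e' = e) /\ bad_vertex (target e).
Proof.
move=> [[|e1 c] [p [clc c0 ne p0 evp]]] //.
have /andP[/andP[/eqP se1 vc] /eqP ec] := clc; rewrite -/(valid_path _ _) in vc.
have e1E : e1 = e by apply/esym/ne; rewrite ?mem_head.
subst e1; clear se1.
have ne_e : forall e', source e' = source e -> e' = e by apply: ne; exact: mem_head.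
split=> //; exists (rcons c e), p; split=> //.
- by rewrite /closed_path -cats1 valid_path_cat path_end_cat vc -[path_end _
  c]/(path_end (source e) (e :: c)) ec /= !eqxx.
- by case: (c).
- by move=> e'; rewrite mem_rcons; exact: ne.
pose C := path_elt f (source e) (e :: c).
pose D := path_elt f (target e) (rcons c e).
have powD k : corner_pow (V (target e)) D k =
    E' e ** corner_pow (V (source e)) C k ** E e.
  elim: k => [|k IH]; first by rewrite famGV famGE.
  rewrite !corner_powS IH /D /C path_elt_rcons path_elt_cons -!numulA.
  rewrite [E e ** (E' e ** _)]numulA famEG_noexit // [E' e ** (E e ** _)]numulA
    famGE.
  rewrite [V (target e) ** _]numulA -path_elt_V; congr (_ ** _).
  rewrite numulA; congr (_ ** _); case: k {IH} => [|k]; first exact: famVV.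
  by rewrite corner_powS !numulA famVE.
rewrite /corner_eval -/D.
have := congr1 (fun x => E' e ** x ** E e) evp.
rewrite numulr0 numul0r numul_sumr numul_suml => {2}<-.
by apply: eq_bigr => i _; rewrite powD -scale_numulr -scale_numull.
Qed.

(* Murray-von Neumann equivalence of idempotents. *)
Definition mvn (a b : A) : Prop := exists s s' : A,
  [/\ s ** s' = a, s' ** s = b, a ** s = s /\ s ** b = s &
      b ** s' = s' /\ s' ** a = s'].

Lemma mvn_sym a b : mvn a b -> mvn b a.
Proof. by move=> [s [s' [h1 h2 [h3 h4] [h5 h6]]]]; exists s', s. Qed.

Lemma mvn_trans a b d : mvn a b -> mvn b d -> mvn a d.
Proof.
move=> [s [s' [h1 h2 [h3 h4] [h5 h6]]]] [t [t' [k1 k2 [k3 k4] [k5 k6]]]].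
exists (s ** t), (t' ** s'); split.
- by rewrite -numulA [t ** _]numulA k1 h5.
- by rewrite -numulA [s' ** _]numulA h2 k3.
- by rewrite numulA h3 -numulA k4.
- by rewrite numulA k5 -numulA h6.
Qed.

Lemma mvn_refl v : mvn (V v) (V v).
Proof. by exists (V v), (V v); rewrite !famVV. Qed.

Lemma bad_vertex_mvn e : bad_vertex (source e) -> mvn (V (source e)) (V (target e)).
Proof.
move=> /bad_vertex_arrow[ne _]; exists (E e), (E' e).
by rewrite famEG_noexit // famGE famVE famEV famVG famGV.
Qed.

End AlgebraicCycles.

Section BadCorner.
Variables (F : closedFieldType) (A : nuAlgType F) (G : digraph).
Variable f : leavitt_family A G.
Hypotheses (gen_f : generating f) (redA : reduced A).

(** The closed path that makes [v] bad may be a power [j] of a shortest one, [d]; then [p \Po 'X^j]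
    annihilates [d], whose polynomials fill the corner. *)
Lemma bad_vertex_idempotents v : bad_vertex f v ->
  exists (n : nat) (eps : nat -> A),
    [/\ forall i j, eps i ** eps j = if i == j then eps i else 0,
        famV f v = \sum_(i < n) eps i, forall i, (n <= i)%N -> eps i = 0 &
        forall x, exists k : nat -> F,
          famV f v ** x ** famV f v = \sum_(i < n) k i *: eps i].
Proof.
move=> [c [p [clc c0 ne p0 evp]]].
have [d [j [hd ned cE]]] := no_exit_min_closed clc c0 ne.
have [cld d0 _] := hd.
have VD : famV f v ** path_elt f v d = path_elt f v d by exact/esym/path_elt_V.
have DV := closed_path_eltV f cld.
have j0 : (0 < j)%N by case: j cE c0 => // ->.
have pX0 : p \Po 'X^j != 0 by rewrite comp_poly_eq0 // size_polyXn.
have evX : corner_eval (famV f v) (path_elt f v d) (p \Po 'X^j) = 0.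
  by rewrite corner_eval_compXn ?famVV // -path_elt_pow // -cE.
apply: (corner_idempotents redA (famVV f v) VD DV _ pX0 evX).
exact: no_exit_corner hd ned pX0 evX.
Qed.

End BadCorner.

(** * Replacing algebraic cycles by stars *)

Section BadElimination.
Variables (F : fieldType) (A : nuAlgType F) (G : digraph).
Variable f : leavitt_family A G.
Local Notation V := (famV f).
Local Notation E := (famE f).
Local Notation E' := (famG f).
Local Notation bad := (bad_vertex f).
Variables (r : vertex G -> vertex G) (s s' : vertex G -> A).
Variables (n0 : vertex G -> nat) (e0 : vertex G -> nat -> A).
Hypothesis V0 : forall v, V v <> 0.
Hypothesis r_bad : forall v, bad v -> bad (r v).
Hypothesis r_idem : forall v, bad v -> r (r v) = r v.
Hypothesis r_eq : forall v w, bad v -> bad w -> mvn (V v) (V w) -> r v = r w.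
Hypothesis ss' : forall v, bad v -> s v ** s' v = V v.
Hypothesis s's : forall v, bad v -> s' v ** s v = V (r v).
Hypothesis sV : forall v, bad v -> s v ** V (r v) = s v.
Hypothesis Vs' : forall v, bad v -> V (r v) ** s' v = s' v.
Hypothesis e0_orth : forall v i j, bad v ->
  e0 v i ** e0 v j = if i == j then e0 v i else 0.
Hypothesis e0_sum : forall v, bad v -> V v = \sum_(i < n0 v) e0 v i.
Hypothesis e0_out : forall v i, bad v -> (n0 v <= i)%N -> e0 v i = 0.
Hypothesis e0_corner : forall v, bad v -> forall x, exists k : nat -> F,
  V v ** x ** V v = \sum_(i < n0 v) k i *: e0 v i.

(* Matrix units between the components of vertices with the same [r]. *)
Definition link v w i : A := s v ** e0 (r v) i ** s' w.

Lemma e0V v i : bad v -> e0 v i ** V v = e0 v i.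
Proof.
move=> bv; have [lt_i|/(e0_out bv) ->] := ltnP i (n0 v); last by rewrite numul0r.
rewrite (e0_sum bv) numul_sumr (bigD1 (Ordinal lt_i)) //= e0_orth // eqxx.
rewrite big1 ?addr0 // => j /eqP ji; rewrite e0_orth //; case: eqP => // ij.
by case: ji; apply: val_inj.
Qed.

Lemma link_comp u v w i j : bad u -> bad v -> r u = r v ->
  link u v i ** link v w j = if i == j then link u w i else 0.
Proof.
move=> bu bv uv; rewrite /link -!numulA [s' v ** _]numulA s's //.
rewrite uv [e0 (r v) i ** (V _ ** _)]numulA e0V ?[e0 (r v) i ** _]numulA;
  last exact: r_bad.
rewrite e0_orth; last exact: r_bad.
by case: eqP => // _; rewrite numul0r numulr0.
Qed.

(** The components of a bad vertex are transported from [r v], not taken from [e0 v], so that those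
    of equal index within a class are equivalent. *)
Definition split_eps v (i : nat) : A :=
  if `[< bad v >] then link v v i else if i is 0 then V v else 0.

Definition split_n v : nat := if `[< bad v >] then n0 (r v) else 1.

Lemma split_eps_bad v i : bad v -> split_eps v i = link v v i.
Proof. by move=> bv; rewrite /split_eps asboolT. Qed.

Lemma split_eps_good v : ~ bad v -> split_eps v 0 = V v.
Proof. by move=> bv; rewrite /split_eps asboolF. Qed.

Lemma split_eps_orth v i j :
  split_eps v i ** split_eps v j = if i == j then split_eps v i else 0.
Proof.
have [bv|bv] := pselect (bad v); first by rewrite !split_eps_bad // link_comp.
rewrite /split_eps asboolF //.
by case: i j => [|i] [|j]; rewrite ?numul0r ?numulr0 ?if_same ?famVV.
Qed.

Lemma split_eps_sum v : V v = \sum_(i < split_n v) split_eps v i.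
Proof.
have [bv|bv] := pselect (bad v); last first.
  by rewrite /split_n asboolF // big_ord1 split_eps_good.
rewrite /split_n asboolT // -ss' // -[in LHS]sV // (e0_sum (r_bad bv)).
rewrite numul_sumr numul_suml; apply: eq_bigr => i _.
by rewrite split_eps_bad.
Qed.

Lemma split_eps_out v i : (split_n v <= i)%N -> split_eps v i = 0.
Proof.
have [bv|bv] := pselect (bad v); last first.
  by rewrite /split_n /split_eps asboolF //; case: i.
rewrite /split_n asboolT // split_eps_bad // => h.
by rewrite /link e0_out ?numulr0 ?numul0r //; exact: r_bad.
Qed.

(** The arrows of bad cycles disappear. The components of [r v] emit nothing any more: they are the
    centres of the stars. *)
Definition split_keep e : Prop := ~ bad (source e).
Definition split_ext v : Prop := bad v /\ v <> r v.

Lemma split_keepE e : split_keep e -> split_eps (source e) 0 ** E e = E e.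
Proof. by move=> ke; rewrite split_eps_good // famVE. Qed.

Lemma split_keepG e : split_keep e -> E' e ** split_eps (source e) 0 = E' e.
Proof. by move=> ke; rewrite split_eps_good // famGV. Qed.

Local Notation S := (fun v => link v (r v)).
Local Notation S' := (fun v => link (r v) v).

Lemma split_S_source v i : split_ext v -> split_eps v i ** S v i = S v i.
Proof. by move=> [bv _]; rewrite split_eps_bad // link_comp // eqxx. Qed.

Lemma split_S_target v i : split_ext v -> S v i ** split_eps (r v) i = S v i.
Proof.
move=> [bv _]; have br := r_bad bv.
by rewrite split_eps_bad // link_comp ?eqxx ?r_idem.
Qed.

Lemma split_S'_target v i : split_ext v -> split_eps (r v) i ** S' v i = S' v i.
Proof.
move=> [bv _]; have br := r_bad bv.
by rewrite split_eps_bad // link_comp ?eqxx ?r_idem.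
Qed.

Lemma split_S'_source v i : split_ext v -> S' v i ** split_eps v i = S' v i.
Proof.
move=> [bv _]; have br := r_bad bv.
by rewrite split_eps_bad // link_comp ?eqxx ?r_idem.
Qed.

Lemma split_SS' v i : split_ext v -> S v i ** S' v i = split_eps v i.
Proof.
move=> [bv _]; have br := r_bad bv.
by rewrite split_eps_bad // link_comp ?eqxx ?r_idem.
Qed.

Lemma split_S'S v i : split_ext v -> S' v i ** S v i = split_eps (r v) i.
Proof.
move=> [bv _]; have br := r_bad bv.
by rewrite split_eps_bad // link_comp ?eqxx ?r_idem.
Qed.

Lemma split_ext_keep e : split_ext (source e) -> ~ split_keep e.
Proof. by move=> [be _] ke. Qed.

Lemma split_CK2 v (es : seq (arrow G)) : ~ split_ext v -> uniq es ->
  es <> [::] ->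
  (forall e, e \in es <-> [/\ split_keep e, source e = v & V (target e) <> 0]) ->
  split_eps v 0 = \sum_(e <- es) E e ** E' e.
Proof.
move=> _ ues es0 hes.
have [e ees] : exists e, e \in es.
  by case: (es) es0 => // e es' _; exists e; exact: mem_head.
have [ke sv _] := (hes e).1 ees; rewrite /split_keep sv in ke.
rewrite split_eps_good // (@famCK2 _ _ _ f v es) // => e'.
split=> [/hes[]//|se']; apply/hes.
by split; [rewrite /split_keep se'| |exact: V0].
Qed.

Definition split_family :=
  refined_family split_eps_orth split_eps_sum split_eps_out split_keepE split_keepG
    split_S_source split_S_target split_S'_target split_S'_source split_SS'
    split_S'S split_ext_keep split_CK2.

(** A dropped arrow and its ghost lie in corners between two bad vertices with the same [r]. Such a
    corner is spanned by the [link]s, which are products of at most two of the new generators. *)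
Lemma split_family_generating : generating f -> generating split_family.
Proof.
move=> gen_f P clP PV PE PG.
have Pkeep e : split_keep e -> P (E e) /\ P (E' e).
  exact: (refined_gen_keep clP PE PG).
have Peps v i : P (split_eps v i) by exact: (refined_gen_eps clP PV).
have Plink_r v i : bad v -> P (link v (r v) i) /\ P (link (r v) v i).
  move=> bv; have [vr|vr] := pselect (v = r v).
    by rewrite -vr -split_eps_bad.
  by apply: (refined_gen_ext clP PE PG).
have Plink v w i : bad v -> bad w -> r v = r w -> P (link v w i).
  move=> bv bw vw; have br := r_bad bv.
  have -> : link v w i = link v (r v) i ** link (r v) w i.
    by rewrite link_comp ?eqxx ?r_idem.
  apply: clP.2; first by case: (Plink_r v i bv).
  by rewrite vw; case: (Plink_r w i bw).
have Pcorner v w x : bad v -> bad w -> r v = r w -> P (V v ** x ** V w).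
  move=> bv bw vw; have br := r_bad bv.
  (* [x] is carried to the corner of the representative, where [e0_corner] holds, and back. *)
  have [k hk] := e0_corner br (s' v ** x ** s w).
  have -> : V v ** x ** V w = \sum_(i < n0 (r v)) k i *: link v w i.
    rewrite -ss' // -(ss' bw) -{1}sV // -{1}(Vs' bw) -vw.
    have -> : s v ** V (r v) ** s' v ** x ** (s w ** (V (r v) ** s' w)) =
        s v ** (V (r v) ** (s' v ** x ** s w) ** V (r v)) ** s' w.
      by rewrite !numulA.
    rewrite hk numul_sumr numul_suml; apply: eq_bigr => i _.
    by rewrite -scale_numulr -scale_numull.
  apply: (lin_closed_sum clP.1) => i _; apply: (lin_closedZ clP.1).
  exact: Plink.
have badE e : bad (source e) -> bad (target e) /\ r (source e) = r (target e).
  move=> be; have [_ bt] := bad_vertex_arrow be; split=> //.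
  by apply: r_eq => //; exact: bad_vertex_mvn.
apply: gen_f => //.
- by move=> v; exact: (refined_gen_V clP PV).
- move=> e; have [be|ke] := pselect (bad (source e)); last by case: (Pkeep e ke).
  have [bt rt] := badE e be.
  by rewrite -famEV -famVE; exact: Pcorner.
- move=> e; have [be|ke] := pselect (bad (source e)); last by case: (Pkeep e ke).
  have [bt rt] := badE e be.
  by rewrite -famGV -famVG; exact: Pcorner.
Qed.

Lemma split_eps_good_val v i : ~ bad v -> split_eps v i != 0 -> i = 0%N.
Proof. by move=> bv; rewrite /split_eps asboolF //; case: i => // i;
  rewrite eqxx. Qed.

Local Notation f2 := split_family.
Local Notation G2 := (refined_digraph split_eps_orth split_eps_sum split_eps_out
  split_keepE split_S_target split_SS').
Local Notation arr := (arrow2 split_eps split_keep split_ext).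

Lemma good_split_family_V (x : vertex2 split_eps) :
  ~ bad (val x).1 -> split_eps (val x).1 (val x).2 = V (val x).1.
Proof.
move=> gx; have /(split_eps_good_val gx) -> := valP x.
exact: split_eps_good.
Qed.

(** A closed path avoids the star arrows, which end in sinks, so it passes through good vertices
    only. These are not split: the path projects to a closed path of [G] with the same value, and a
    bad one would make a good vertex bad. *)
Lemma split_family_no_bad x : ~ bad_vertex f2 x.
Proof.
move=> [c [p [clc c0 ne p0 evp]]].
have no_inr y : ~ (((inr y : arr) : arrow G2) \in c).
  have /andP[/asboolP[bad_y _] _] := valP y.
  move=> /(closed_path_next clc)[[] z _ /(congr1 val) /= zy].
    have /andP[/asboolP kz _] := valP z; apply: kz.
    rewrite (congr1 fst zy : source (val z).1 = r (val y).1); exact: r_bad.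
  have /andP[/asboolP[_ kz] _] := valP z; apply: kz.
  by rewrite (congr1 fst zy : (val z).1 = r (val y).1) r_idem.
have kept (a : arrow G2) : a \in c -> exists y, [/\ a = (inl y : arr),
    ~ bad (source (val y).1) & ~ bad (target (val y).1)].
  case: a => [y|y] yc; last by case: (no_inr y).
  exists y; have /andP[/asboolP ky _] := valP y; split=> //.
  have [[z|z] zc] := closed_path_next clc yc; last by case: (no_inr z).
  move=> /(congr1 val) /= zy; have /andP[/asboolP kz _] := valP z.
  by rewrite -(congr1 fst zy : source (val z).1 = target (val y).1).
have [a0 a0c sa0] : exists2 a0, a0 \in c & source a0 = x.
  case: (c) clc c0 => // a q /andP[/andP[/eqP sa _] _] _.
  by exists a; rewrite ?mem_head.
have [y0 [a0E gy0 _]] := kept a0 a0c.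
have gx : ~ bad (val (x : vertex2 split_eps)).1.
  rewrite -[x]sa0 a0E; exact: gy0.
pose lab (a : arrow G2) := if (a : arr) is inl y then (val y).1 else (val y0).1.
have main q (x' : vertex2 split_eps) : (forall a, a \in q -> a \in c) ->
    valid_path (x' : vertex G2) q -> ~ bad (val x').1 ->
    [/\ valid_path (val x').1 (map lab q),
        (val (path_end (x' : vertex G2) q : vertex2 split_eps)).1 =
          path_end (val x').1 (map lab q) &
        path_elt f2 x' q = path_elt f (val x').1 (map lab q)].
  elim: q x' => [|a q IH] x' sub; first by move=> _ gx'; split=> //;
    exact: good_split_family_V.
  move=> /andP[/eqP sa vq] gx'.
  have [y [aE gsy gty]] := kept a (sub a (mem_head _ _)).
  have sub' a' : a' \in q -> a' \in c by move=> h; apply: sub; rewrite inE h orbT.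
  have [v1 e1 h1] := IH (target (a : arrow G2)) sub' vq (ltac:(by rewrite aE)).
  have x'E : (val x').1 = source (val y).1 by rewrite -[x']sa aE.
  have labE : lab a = (val y).1 by rewrite aE.
  have tE : (val (target (a : arrow G2) : vertex2 split_eps)).1 = target (val y).1.
    by rewrite aE.
  rewrite tE in v1 e1 h1; split.
  - by rewrite /= labE x'E eqxx.
  - by move: e1; rewrite -labE.
  - have -> : path_elt f2 x' (a :: q) = famE f2 a ** path_elt f2 (target a) q.
      by rewrite -[x']sa path_elt_cons.
    have -> : path_elt f (val x').1 (map lab (a :: q)) =
        E (val y).1 ** path_elt f (target (val y).1) (map lab q).
      by rewrite x'E -labE -path_elt_cons.
    rewrite h1; congr (_ ** _).
    have -> : famE f2 a = E (val y).1 ** split_eps (target (val y).1) (val y).2.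
      by rewrite aE.
    have ht : ~ bad (val (target (a : arrow G2) : vertex2 split_eps)).1 by
      rewrite tE.
    by have := good_split_family_V ht; rewrite aE /= => ->; rewrite famEV.
have /andP[vc /eqP ec] := clc.
have [vl el pl] := main c x (fun _ h => h) vc gx; rewrite ec in el.
have Vx := good_split_family_V gx.
apply: gx; exists (map lab c), p; split=> //.
- by rewrite /closed_path vl -el eqxx.
- by case: (c) c0.
- move=> _ /mapP[a ac ->] e se.
  have [y [aE gsy _]] := kept a ac; rewrite aE /= in se *.
  (* An exit [e] of the projected path lifts to an exit of [c], since its nonzero target has a
     nonzero component. *)
  have [j ej] : exists j, split_eps (target e) j != 0.
    apply: contrapT => h; apply: (V0 (v := target e)).
    rewrite split_eps_sum big1 // => j _.
    by apply/eqP; apply: contrapT => /negP ej; apply: h; exists j.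
  have hej : `[< split_keep (e, j).1 >] &&
      (split_eps (target (e, j).1) (e, j).2 != 0).
    by rewrite /= ej andbT; apply/asboolP; rewrite /split_keep se.
  pose b : arr := inl (exist _ (e, j) hej).
  have : (b : arrow G2) = a.
    by apply: (ne a ac); apply: val_inj; rewrite aE /= se.
  by rewrite aE => -[/(congr1 (fun z => (val z).1))].
- by rewrite -pl -Vx.
Qed.

End BadElimination.

Lemma no_bad_vertices (F : closedFieldType) (A : nuAlgType F) (G : digraph)
    (f : leavitt_family A G) :
  generating f -> reduced A -> (forall v, famV f v <> 0) ->
  exists (G' : digraph) (f' : leavitt_family A G'),
    [/\ generating f', forall v, famV f' v <> 0 & forall v, ~ bad_vertex f' v].
Proof.
move=> gen_f redA V0; pose V := famV f.
pose R v w := `[< bad_vertex f w /\ mvn (V v) (V w) >].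
(* [choose] gives the same result for equivalent predicates, so [r v] depends only on the
   equivalence class of [V v]. *)
pose r v := choose (R v) v.
have rP v : bad_vertex f v -> bad_vertex f (r v) /\ mvn (V v) (V (r v)).
  move=> bv; apply/asboolP; apply: (@chooseP _ (R v)); apply/asboolP; split=> //.
  exact: mvn_refl.
have r_bad v : bad_vertex f v -> bad_vertex f (r v) by case/rP.
have r_eq v w : bad_vertex f v -> bad_vertex f w -> mvn (V v) (V w) -> r v = r w.
  move=> bv bw vw; rewrite /r (@eq_choose _ (R v) (R w)).
    by apply: choose_id; apply/asboolP; split=> //;
      [exact: mvn_sym|exact: mvn_refl].
  move=> u; apply/asboolP/asboolP => -[bu h]; split=> //.
    exact: mvn_trans (mvn_sym vw) h.
  exact: mvn_trans vw h.
have r_idem v : bad_vertex f v -> r (r v) = r v.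
  by move=> bv; have [br /mvn_sym vr] := rP v bv; exact: r_eq.
have /choice[ss hss] v : exists ss : A * A, bad_vertex f v ->
    [/\ ss.1 ** ss.2 = V v, ss.2 ** ss.1 = V (r v),
        V v ** ss.1 = ss.1 /\ ss.1 ** V (r v) = ss.1 &
        V (r v) ** ss.2 = ss.2 /\ ss.2 ** V v = ss.2].
  have [bv|bv] := pselect (bad_vertex f v); last by exists (0, 0).
  by have [_ [s [s' h]]] := rP v bv; exists (s, s').
have /choice[ne hne] v : exists ne : nat * (nat -> A), bad_vertex f v ->
    [/\ forall i j, ne.2 i ** ne.2 j = if i == j then ne.2 i else 0,
        V v = \sum_(i < ne.1) ne.2 i, forall i, (ne.1 <= i)%N -> ne.2 i = 0 &
        forall x, exists k : nat -> F,
          V v ** x ** V v = \sum_(i < ne.1) k i *: ne.2 i].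
  have [bv|bv] := pselect (bad_vertex f v); last by exists (0%N, fun=> 0).
  by have [n [eps h]] := bad_vertex_idempotents gen_f redA bv; exists (n, eps).
have h1 v : bad_vertex f v -> (ss v).1 ** (ss v).2 = V v by case/hss.
have h2 v : bad_vertex f v -> (ss v).2 ** (ss v).1 = V (r v) by case/hss.
have h4 v : bad_vertex f v -> (ss v).1 ** V (r v) = (ss v).1.
  by case/hss => _ _ [].
have h5 v : bad_vertex f v -> V (r v) ** (ss v).2 = (ss v).2.
  by case/hss => _ _ _ [].
have k1 v i j : bad_vertex f v ->
    (ne v).2 i ** (ne v).2 j = if i == j then (ne v).2 i else 0 by case/hne.
have k2 v : bad_vertex f v -> V v = \sum_(i < (ne v).1) (ne v).2 i by case/hne.
have k3 v i : bad_vertex f v -> ((ne v).1 <= i)%N -> (ne v).2 i = 0.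
  by case/hne => _ _ h _; exact: h.
have k4 v : bad_vertex f v -> forall x, exists k : nat -> F,
    V v ** x ** V v = \sum_(i < (ne v).1) k i *: (ne v).2 i by case/hne.
pose f' := @split_family F A G f r (fun v => (ss v).1) (fun v => (ss v).2)
  (fun v => (ne v).1) (fun v => (ne v).2) V0 r_bad r_idem h1 h2 h4 k1 k2 k3.
exists _, f'; split.
- exact: split_family_generating.
- exact: refined_family_neq0.
- exact: split_family_no_bad.
Qed.

(** * Quotients of Leavitt path algebras *)

Section Transport.
Variables (F : fieldType) (G : digraph).

(** The reduction is applied in the Leavitt path algebra, not in [A]: it turns a nonzero element of
    the kernel into a multiple of a vertex or a polynomial in a cycle, whose image the two
    hypotheses keep from vanishing. *)
Lemma lpa_lift_inj (A : nuAlgType F) (f : leavitt_family A G) :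
  (forall v, famV f v <> 0) -> (forall v, ~ bad_vertex f v) ->
  forall x, lpa_lift f x = 0 -> x = 0.
Proof.
move=> V0 nobad x fx0; apply: contrapT.
move=> /(reduction (@lpa_family_generating F G))[a [b hab]].
have lift0 : lpa_lift f 0 = 0 by rewrite -(scale0r 0) lpa_liftZ scale0r.
have fab : lpa_lift f (a ** x ** b) = 0.
  by rewrite !lpa_liftM fx0 numulr0 numul0r.
case: hab => [[v [k [k0 e]]]|[v [c [p [[clc c0 _] ne p0 e]]]]].
  move: fab; rewrite e lpa_liftZ lpa_lift_gen => /eqP.
  by rewrite scaler_eq0 (negPf k0) => /eqP; exact: V0.
apply: (nobad v); exists c, p; split=> //.
have liftE q w : lpa_lift f (path_elt (lpa_family F G) w q) = path_elt f w q.
  elim: q w => [|e1 q IH] w /=; first exact: lpa_lift_gen.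
  by rewrite !lpa_liftM IH !lpa_lift_gen.
rewrite -fab e /corner_eval (big_morph _ (lpa_liftD f) lift0).
apply: eq_bigr => i _; rewrite lpa_liftZ; congr (_ *: _).
elim: (nat_of_ord i) => [|m IHm]; first exact/esym/lpa_lift_gen.
by rewrite !corner_powS lpa_liftM IHm liftE.
Qed.

Lemma nualg_isomorphicP (A B : nuAlgType F) (g : A -> B) :
  (forall (c : F) x y, g (c *: x + y) = c *: g x + g y) ->
  (forall x y, g (x ** y) = g x ** g y) -> bijective g -> nualg_isomorphic A B.
Proof.
move=> lin gM bij.
pose gL : {linear A -> B} := HB.pack g (GRing.isLinear.Build F A B *:%R g lin).
by exists gL.
Qed.

Lemma lpa_lift_iso (A : nuAlgType F) (f : leavitt_family A G) :
  generating f -> (forall v, famV f v <> 0) -> (forall v, ~ bad_vertex f v) ->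
  nualg_isomorphic A (lpa F G).
Proof.
move=> gen_f V0 nobad; pose phi := lpa_lift f.
have phi_lin c x y : phi (c *: x + y) = c *: phi x + phi y.
  by rewrite /phi lpa_liftD lpa_liftZ.
have phi_inj : injective phi.
  move=> x y xy; apply/eqP; rewrite -subr_eq0; apply/eqP.
  apply: lpa_lift_inj V0 nobad _ _.
  by rewrite -/phi -scaleN1r addrC phi_lin xy scaleN1r addNr.
have /choice[g gK] : forall a, exists x, phi x = a.
  apply: gen_f.
  - split; first split.
    + by exists 0; rewrite -(scale0r 0) /phi lpa_liftZ scale0r.
    + by move=> c _ _ [x <-] [y <-]; exists (c *: x + y).
    + by move=> _ _ [x <-] [y <-]; exists (x ** y); exact: lpa_liftM.
  - by move=> v; exists (lpa_gen_elt F (Vertex v)); exact: lpa_lift_gen.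
  - by move=> e; exists (lpa_gen_elt F (Arrow e)); exact: lpa_lift_gen.
  - by move=> e; exists (lpa_gen_elt F (Ghost e)); exact: lpa_lift_gen.
have phiK x : g (phi x) = x by apply: phi_inj; rewrite gK.
apply: (@nualg_isomorphicP _ _ g).
- by move=> c x y; apply: phi_inj; rewrite phi_lin !gK.
- by move=> x y; apply: phi_inj; rewrite /phi lpa_liftM -/phi !gK.
- by exists phi.
Qed.

Section Quotient.
Variable I : alg_ideal (lpa F G).
Local Notation L := (lpa F G).
Local Notation Q := (quot_alg I).
Local Notation f := (lpa_family F G).

Definition quot_proj (x : L) : Q := \pi x.

Lemma quot_projD x y : quot_proj (x + y) = quot_proj x + quot_proj y.
Proof. exact: esym (quot_piD _ _ _). Qed.
Lemma quot_projM x y : quot_proj (x ** y) = quot_proj x ** quot_proj y.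
Proof. exact: esym (quot_piM _ _ _). Qed.
Lemma quot_projZ c x : quot_proj (c *: x) = c *: quot_proj x.
Proof. exact: esym (quot_piZ _ _ _). Qed.

Lemma quot_proj0 : quot_proj 0 = 0.
Proof. by rewrite -(scale0r 0) quot_projZ scale0r. Qed.

Definition quot_family : leavitt_family Q G.
Proof.
refine (@LeavittFamily F Q G (fun v => quot_proj (famV f v))
  (fun e => quot_proj (famE f e)) (fun e => quot_proj (famG f e))
  _ _ _ _ _ _ _ _ _).
- by move=> v; rewrite -quot_projM famVV.
- by move=> v w vw; rewrite -quot_projM famVW // quot_proj0.
- by move=> e; rewrite -quot_projM famVE.
- by move=> e; rewrite -quot_projM famEV.
- by move=> e; rewrite -quot_projM famVG.
- by move=> e; rewrite -quot_projM famGV.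
- by move=> e; rewrite -quot_projM famGE.
- by move=> e e' ee; rewrite -quot_projM famGE0 // quot_proj0.
- move=> v es ues es0 hes; rewrite (famCK2 f ues es0 hes).
  rewrite (big_morph _ quot_projD quot_proj0).
  by apply: eq_bigr => e _; rewrite quot_projM.
Defined.

Lemma quot_family_generating : generating quot_family.
Proof.
move=> P [[P0 PL] PM] PV PE PG x.
have : forall y, P (quot_proj y); last first.
  by move=> h; rewrite -[x]reprK; exact: h.
apply: (@lpa_family_generating F G) => //.
split; first split; first by rewrite quot_proj0.
  by move=> c y z hy hz; rewrite quot_projD quot_projZ; exact: PL.
by move=> y z hy hz; rewrite quot_projM; exact: PM.
Qed.

End Quotient.
End Transport.

Theorem corollary32 (F : closedFieldType) (G : digraph)
    (J : set (lpa F G)) (hJ : two_sided_ideal J) :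
  ((exists G' : digraph,
      nualg_isomorphic (quot_alg (lpa_ideal hJ)) (lpa F G')) <->
   reduced (quot_alg (lpa_ideal hJ))) /\
  (reduced (quot_alg (lpa_ideal hJ)) <->
   semiprimitive (quot_alg (lpa_ideal hJ))).
Proof.
set Q := quot_alg (lpa_ideal hJ).
have ac : (exists G' : digraph, nualg_isomorphic Q (lpa F G')) -> semiprimitive Q.
  by move=> [G' iso]; exact: semiprimitive_iso iso (lpa_semiprimitive F G').
have cb : semiprimitive Q -> reduced Q by exact: semiprimitive_reduced.
have ba : reduced Q -> exists G' : digraph, nualg_isomorphic Q (lpa F G').
  move=> redQ.
  have [G1 [f1 [gen1 V1]]] := nonzero_vertices (@quot_family_generating F G
    (lpa_ideal hJ)).
  have [G2 [f2 [gen2 V2 nobad2]]] := no_bad_vertices gen1 redQ V1.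
  by exists G2; exact: lpa_lift_iso gen2 V2 nobad2.
by split; split=> h; [exact/cb/ac|exact: ba|exact/ac/ba|exact: cb].
Qed.
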